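(* Let $V(\varphi)\subset L^2(\mathbb{R})$ be a sampling space with sampling function $s$ and let $f\in L^2(\mathbb{R})$. If $f\in V(\varphi)$, then $S(f)$ is a sampling space with sampling function $s_f=P_{S(f)}(s)$, where $P_{S(f)}(s)$ is the orthogonal projection of $s$ onto $S(f)$. In this case $\hat{s_f}=\hat{s}\,\chi_{E_f}$.
   Context: Fourier transform: $\hat f(\omega)=\int_{-\infty}^{+\infty} f(x)e^{-2\pi i x\omega}\,dx$ (extended to $L^2(\mathbb{R})$). For $f\in L^2(\mathbb{R})$, $S(f)$ is the closure in $L^2(\mathbb{R})$ of the linear span of the integer translates $\{f(\cdot-k):k\in\mathbb{Z}\}$. One writes $V(\varphi)$ for $S(\varphi)$ when $\{\varphi(\cdot-k)\}_{k\in\mathbb{Z}}$ is a frame of $S(\varphi)$. It is known that every $S(f)$ contains a function $g$ with $S(f)=V(g)$. Grammian: $G_f(\omega)=\sum_{k\in\mathbb{Z}}|\hat f(\omega+k)|^2$, and $E_f=\{\omega\in\mathbb{R}: G_f(\omega)>0\}$ (defined up to null sets); $\chi_E$ is the characteristic function of $E$. Sampling space: a closed subspace $V(\varphi)$ of $L^2(\mathbb{R})$ is a sampling space if there is a function $s$ such that (1) the translates $\{s(\cdot-k)\}_{k\in\mathbb{Z}}$ are a frame for $V(\varphi)$; (2) for every $\{c_k\}_{k\in\mathbb{Z}}\in\ell^2(\mathbb{Z})$ the series $\sum_{k\in\mathbb{Z}}c_k s(\cdot-k)$ converges pointwise to a continuous function; (3) for every $f\in V(\varphi)$, $f(x)=\sum_{k\in\mathbb{Z}}f(k)s(x-k)$,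 with convergence in $L^2(\mathbb{R})$ and uniformly on $\mathbb{R}$. Elements of a sampling space are identified with their continuous representatives, so point values make sense. The function $s$ is called the sampling function of $V(\varphi)$; it is the only function in $V(\varphi)$ satisfying (3). *)

(* Defs.v *)
From HB Require Import structures.
From mathcomp Require Import all_boot all_order all_algebra.
From mathcomp Require Import finmap complex.
From mathcomp Require Import all_classical all_reals all_analysis.

Set Implicit Arguments.
Unset Strict Implicit.
Unset Printing Implicit Defensive.

Import Order.TTheory GRing.Theory Num.Theory.
Import numFieldNormedType.Exports.

Local Open Scope classical_set_scope.
Local Open Scope complex_scope.
Local Open Scope ring_scope.

(* Elements of L^p(R) are represented by (Borel measurable) functions from R to
   the complex numbers R[i]; the equality of L^p(R) is almost everywhere
   equality. The topology of R[i] is the one of its regular module R[i]^o. *)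
Section SamplingSpaces.
Context {R : realType}.
Local Notation mu := (@lebesgue_measure R).
Local Notation normc := ComplexField.Normc.normc.
Implicit Types (f g h s phi F : R -> R[i]) (V : set (R -> R[i])).

Definition in_Lp (p : \bar R) f :=
  ((fun x => complex.Re (f x)) : measurableTypeR R -> R) \in Lfun mu p /\
  ((fun x => complex.Im (f x)) : measurableTypeR R -> R) \in Lfun mu p.

Definition norm2 f : \bar R := 'N[mu]_(2%:E)[(fun x => (normc (f x))%:E)]%E.

Definition cintegral f : R[i] :=
  (\int[mu]_x complex.Re (f x)) +i* (\int[mu]_x complex.Im (f x)).

Definition inner f g : R[i] := cintegral (fun x => f x * conjc (g x)).

Definition translates f (k : int) : R -> R[i] := fun x => f (x - k%:~R).

Definition shift_space f : set (R -> R[i]) :=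
  [set g | in_Lp 2%:E g /\
    forall e : R, 0 < e -> exists (J : {fset int}) (c : int -> R[i]),
      (norm2 (fun x => g x - \sum_(k <- J) c k * translates f k x)%R < e%:E)%E].

Definition is_frame V (u : int -> R -> R[i]) :=
  (forall k, V (u k)) /\
  exists A B : R, [/\ 0 < A, 0 < B & forall f, V f ->
    (A%:E * norm2 f ^+ 2 <= \esum_(k in [set: int]) (normc (inner f (u k)) ^+ 2)%:E
      <= B%:E * norm2 f ^+ 2)%E].

Definition is_frame_generator phi :=
  in_Lp 2%:E phi /\ is_frame (shift_space phi) (translates phi).

(* The extension to L^2 of the integral transform is the closure, in L^2 x L^2,
   of its graph on the intersection of L^1 and L^2. *)
Definition fourier1 f : R -> R[i] := fun w =>
  cintegral (fun x => f x * (cos (2 * pi * x * w) -i* sin (2 * pi * x * w))).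

Definition is_fourier f F :=
  in_Lp 2%:E F /\
  forall e : R, 0 < e -> exists g,
    [/\ in_Lp 1%:E g, in_Lp 2%:E g, in_Lp 2%:E (fourier1 g),
        (norm2 (f \- g)%R < e%:E)%E & (norm2 (F \- fourier1 g)%R < e%:E)%E].

(* A representative of the Fourier transform of f, for f in L^2. *)
Definition fourier f : R -> R[i] := xget (fun=> 0) [set F | is_fourier f F].

Definition grammian f (w : R) : \bar R :=
  \esum_(k in [set: int]) (normc (fourier f (w + k%:~R)) ^+ 2)%:E.

Definition grammian_support f : set R := [set w | (0 < grammian f w)%E].

Definition is_l2 (c : int -> R[i]) :=
  (\esum_(k in [set: int]) (normc (c k) ^+ 2)%:E < +oo)%E.

(* The sum of c k * s (x - k) for - mn.1 <= k <= mn.2; a series indexed by the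
   integers converges when these partial sums converge as mn.1 and mn.2 tend to
   infinity independently. *)
Definition partial_sum (c : int -> R[i]) s (mn : nat * nat) : R -> R[i] := fun x =>
  \sum_(j < (mn.1 + mn.2).+1)
    c (j%:Z - mn.1%:Z) * translates s (j%:Z - mn.1%:Z) x.

(* V is a sampling space with sampling function s. The function g of the last
   clause is the continuous representative of f. *)
Definition is_sampling_space V s :=
  [/\ exists2 phi, is_frame_generator phi & V = shift_space phi,
      is_frame V (translates s),
      forall c, is_l2 c -> exists2 g : R -> R[i]^o, continuous g &
        forall x, partial_sum c s mn x @[mn --> (\oo, \oo)] --> g x
    & forall f, V f -> exists g : R -> R[i]^o,
        let c := fun k : int => g k%:~R in
        [/\ continuous g, f = g %[ae mu],
            norm2 (g \- partial_sum c s mn) @[mn --> (\oo, \oo)] --> 0%E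
          & forall e : R, 0 < e -> \forall mn \near (\oo, \oo),
              forall x, normc (g x - partial_sum c s mn x) < e]].

Definition is_orthogonal_projection V f p :=
  V p /\ forall g, V g -> inner (f \- p) g = 0.

End SamplingSpaces.

(* Main.v *)
Require Import Defs.
From HB Require Import structures.
From mathcomp Require Import all_boot all_order all_algebra.
From mathcomp Require Import finmap complex ring lra zify.
From mathcomp Require Import all_classical all_reals all_analysis.
From mathcomp Require Import measurable_realfun.

(** The sampling half. Let V be the sampling space V(phi), W = S(f) inside V, and y
the continuous representative of the orthogonal projection of s onto W. The
projection commutes with integer translations, so the translates T_k y are the
projections of the T_k s, and <h, T_k y> = <h, T_k s> for h in W. Hence the
frame inequality of the T_k s, restricted to h in W, is the frame inequality of
the T_k y, and the sampling series h = sum_k h(k) T_k s projects onto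
h = sum_k h(k) T_k y. This gives convergence in L^2 only. Pointwise and uniform
convergence follow from one estimate: |g(x)| <= C |h| for every h in V, every
real x and the continuous representative g of h (eval_bound). It comes from the
hypothesis that the series sum_k c_k s(x - k) converge for all l^2 sequences,
by applying Banach-Steinhaus twice, first to the partial sums at a fixed x and
then to the values at the points x of [0, 1]; inverting the frame operator
shows that every h in V is the sum of such a series with coefficients of norm
at most D |h|, and integer translations carry [0, 1] to the whole line. The
outcome is sampling_subspace.

The Fourier half needs the transform on L^2. For real a different from 0, the
exponential tail e^(-a x) on the half-line where a x > 0 has the transform
sg(a) / (a + 2 pi i w), and the tails and their transforms have the same Gram
matrix (etail_hat_inner). The tails with rates 1, 3, 5, ... and
-2, -4, -6, ... are total, because, in the variable e^(-b x), orthogonality to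
all of them says that all moments vanish (cetail_total). So the integral
transform extends to an isometry of L^2. Pairing a transform with the tails
determines it up to null sets, by the multiplication formula; this gives
uniqueness, linearity, and the exchange of translations and multiplications by
the characters e^(-2 pi i k w).

Finally put d = s - y, which lies in V and is orthogonal to every T_k f. Then
u(w) = (Fd)(w) (Ff)(w)^* has vanishing Fourier coefficients, so its integral
over every Borel set of period 1 vanishes (moment_zero_periodic). On the other
hand d and f lie in the same principal space S(phi), so that on almost every
fibre w + Z the families (Fd)(w + k) and (Ff)(w + k) are proportional
(rank_one): along a fibre the values of u lie on one ray of the complex plane.
Integrating over the union of the fibres where the real part of a multiple of u
is positive somewhere yields u = 0 almost everywhere, and proportionality then
yields Fd = 0 wherever some (Ff)(w + k) is nonzero, that is, on E_f. Off E_f,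
Fy vanishes since it is an L^2 limit of products of Ff with trigonometric
polynomials. Hence Fy = (Fs) chi_(E_f). *)

Set Implicit Arguments.
Unset Strict Implicit.
Unset Printing Implicit Defensive.

Import Order.TTheory GRing.Theory Num.Theory.
Import numFieldNormedType.Exports.

Local Open Scope classical_set_scope.
Local Open Scope complex_scope.
Local Open Scope ring_scope.

Local Notation Re := complex.Re.
Local Notation Im := complex.Im.
Local Notation normc := ComplexField.Normc.normc.

(** * Complex numbers and Hilbert spaces *)

Section ComplexNumbers.
Context {R : realType}.
Implicit Types x y z : R[i].

Lemma ReD x y : Re (x + y) = Re x + Re y. Proof. by case: x; case: y. Qed.
Lemma ImD x y : Im (x + y) = Im x + Im y. Proof. by case: x; case: y. Qed.
Lemma ReN x : Re (- x) = - Re x. Proof. by case: x. Qed.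
Lemma ImN x : Im (- x) = - Im x. Proof. by case: x. Qed.
Lemma Re_mul x y : Re (x * y) = Re x * Re y - Im x * Im y.
Proof. by case: x; case: y. Qed.
Lemma Im_mul x y : Im (x * y) = Re x * Im y + Im x * Re y.
Proof. by case: x; case: y. Qed.
Lemma ReJ x : Re x^* = Re x. Proof. by case: x. Qed.
Lemma ImJ x : Im x^* = - Im x. Proof. by case: x. Qed.
Lemma ReC (r : R) : Re r%:C = r. Proof. by []. Qed.
Lemma ImC (r : R) : Im r%:C = 0. Proof. by []. Qed.

Lemma conjcD x y : (x + y)^* = x^* + y^*. Proof. exact: rmorphD. Qed.
Lemma conjcM x y : (x * y)^* = x^* * y^*. Proof. exact: rmorphM. Qed.
Lemma conjcN x : (- x)^* = - x^*. Proof. exact: rmorphN. Qed.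

Definition reimE := (ReD, ImD, ReN, ImN, Re_mul, Im_mul, ReJ, ImJ, ReC, ImC).

Lemma complex_ext x y : Re x = Re y -> Im x = Im y -> x = y.
Proof. by case: x => a b; case: y => c d /= -> ->. Qed.

Lemma conjcC (r : R) : (r%:C)^* = r%:C.
Proof. by apply: complex_ext; rewrite !reimE ?oppr0. Qed.

Lemma sqr_normcE x : normc x ^+ 2 = Re x ^+ 2 + Im x ^+ 2.
Proof. by case: x => a b /=; rewrite sqr_sqrtr// addr_ge0// sqr_ge0. Qed.

Lemma normc_ge0 x : 0 <= normc x.
Proof. by case: x => a b; rewrite sqrtr_ge0. Qed.

Lemma mulcJ x : x * x^* = (normc x ^+ 2)%:C.
Proof. by apply: complex_ext; rewrite !reimE ?sqr_normcE; ring. Qed.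

Lemma normcJE x : normc x^* = normc x.
Proof. by case: x => a b /=; rewrite sqrrN. Qed.

Lemma normcMl x y : normc (x * y) = normc x * normc y.
Proof. exact: ComplexField.Normc.normcM. Qed.

Lemma normc_real (r : R) : normc r%:C = `|r|.
Proof. by rewrite /= expr0n addr0 sqrtr_sqr. Qed.

Lemma normc_le_Re x : `|Re x| <= normc x.
Proof.
rewrite -(@ler_pXn2r _ 2) ?nnegrE ?normc_ge0// sqr_normcE -normrX ger0_norm ?sqr_ge0//.
by rewrite lerDl sqr_ge0.
Qed.

Lemma normc_le_Im x : `|Im x| <= normc x.
Proof.
rewrite -(@ler_pXn2r _ 2) ?nnegrE ?normc_ge0// sqr_normcE -normrX ger0_norm ?sqr_ge0//.
by rewrite lerDr sqr_ge0.
Qed.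

Lemma normc_le_ReIm x : normc x <= `|Re x| + `|Im x|.
Proof.
rewrite -(@ler_pXn2r _ 2) ?nnegrE ?normc_ge0 ?addr_ge0// sqr_normcE.
rewrite -[X in X + _ <= _]real_normK ?num_real// -[X in _ + X <= _]real_normK ?num_real//.
by rewrite sqrrD lerD2r lerDl mulrn_wge0// mulr_ge0.
Qed.

Lemma ler_normcD x y : normc (x + y) <= normc x + normc y.
Proof. exact: le_normcD. Qed.

Lemma normcNE x : normc (- x) = normc x.
Proof. exact: normcN. Qed.

Lemma normcB x y : normc (x - y) = normc (y - x).
Proof. by rewrite -normcNE opprB. Qed.

Lemma normc_sum (I : Type) (r : seq I) (F : I -> R[i]) :
  normc (\sum_(i <- r) F i) <= \sum_(i <- r) normc (F i).
Proof.
elim: r => [|i r IH]; first by rewrite !big_nil ComplexField.Normc.normc0.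
by rewrite !big_cons; apply: (le_trans (ler_normcD _ _)); rewrite lerD2l.
Qed.

End ComplexNumbers.

Section FiniteCauchySchwarz.
Context {R : realType}.

Lemma sum_sqr_ge0 (I : Type) (r : seq I) (a : I -> R[i]) :
  0 <= \sum_(i <- r) normc (a i) ^+ 2.
Proof. by apply: sumr_ge0 => i _; rewrite sqr_ge0. Qed.

(** The value at t = b / c bounds the discriminant; for c = 0 the expression is
affine in t, which forces b = 0. *)
Lemma quadratic_discr (a b c : R) : 0 <= a -> 0 <= c ->
  (forall t, 0 <= a - 2 * t * b + t ^+ 2 * c) -> b ^+ 2 <= a * c.
Proof.
move=> a0 c0 H; have [c1|c1] := eqVneq c 0.
  rewrite c1 mulr0; have [->|b0] := eqVneq b 0; first by rewrite expr0n.
  have := H ((a + 1) / (2 * b)); rewrite c1 mulr0 addr0.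
  have -> : 2 * ((a + 1) / (2 * b)) * b = a + 1 by field.
  by rewrite opprD addrA subrr sub0r ler0N1.
have cp : 0 < c by rewrite lt_neqAle eq_sym c1.
have := H (b / c).
have -> : a - 2 * (b / c) * b + (b / c) ^+ 2 * c = (a * c - b ^+ 2) / c by field.
by rewrite pmulr_lge0 ?invr_gt0// subr_ge0.
Qed.

Lemma cauchy_schwarz_sum (I : Type) (r : seq I) (a b : I -> R[i]) :
  normc (\sum_(i <- r) a i * b i) ^+ 2 <=
  (\sum_(i <- r) normc (a i) ^+ 2) * (\sum_(i <- r) normc (b i) ^+ 2).
Proof.
apply: (@le_trans _ _ ((\sum_(i <- r) normc (a i) * normc (b i)) ^+ 2)).
  rewrite ler_pXn2r ?nnegrE ?normc_ge0//; last first.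
    by apply: sumr_ge0 => i _; rewrite mulr_ge0 ?normc_ge0.
  apply: (le_trans (normc_sum _ _)).
  by rewrite le_eqVlt; apply/orP; left; apply/eqP/eq_bigr => i _; rewrite normcMl.
apply: quadratic_discr; [exact: sum_sqr_ge0|exact: sum_sqr_ge0|move=> t].
rewrite mulr_sumr mulr_sumr -sumrB -big_split/=; apply: sumr_ge0 => i _.
have -> : normc (a i) ^+ 2 - 2 * t * (normc (a i) * normc (b i)) +
  t ^+ 2 * normc (b i) ^+ 2 = (normc (a i) - t * normc (b i)) ^+ 2 by ring.
exact: sqr_ge0.
Qed.

End FiniteCauchySchwarz.

(** The form ip need not be definite: the vectors of the model used below are
functions, not classes of functions, and those that vanish almost everywhere
have norm 0. *)
Record hilbertSpace (R : realType) (E : lmodType R[i]) := HilbertSpace {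
  ip : E -> E -> R[i];
  ipDZl : forall a x y z, ip (a *: x + y) z = a * ip x z + ip y z;
  ipC : forall x y, ip y x = (ip x y)^*;
  ip_ge0 : forall x, 0 <= Re (ip x x);
  ip_complete : forall u : nat -> E,
    (forall e : R, 0 < e -> exists N, forall m n, (N <= m)%N -> (N <= n)%N ->
      Num.sqrt (Re (ip (u m - u n) (u m - u n))) < e) ->
    exists l, forall e : R, 0 < e -> exists N, forall n, (N <= n)%N ->
      Num.sqrt (Re (ip (u n - l) (u n - l))) < e }.

Section Hilbert.
Context {R : realType} {E : lmodType R[i]} (H : hilbertSpace E).
Implicit Types (x y z : E) (a : R[i]) (V : set E).

Local Notation "''[' x , y ]" := (ip H x y).

Definition nrm x : R := Num.sqrt (Re '[x, x]).

Lemma nrmE x : nrm x = Num.sqrt (Re '[x, x]). Proof. by []. Qed.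

Lemma ipDl x y z : '[x + y, z] = '[x, z] + '[y, z].
Proof. by rewrite -[x]scale1r ipDZl mul1r scale1r. Qed.

Lemma ip0l z : '[0, z] = 0.
Proof. by apply: (addrI '[0, z]); rewrite -ipDl !addr0. Qed.

Lemma ipZl a x z : '[a *: x, z] = a * '[x, z].
Proof. by rewrite -[a *: x]addr0 ipDZl ip0l addr0. Qed.

Lemma ipNl x z : '[- x, z] = - '[x, z].
Proof. by rewrite -scaleN1r ipZl mulN1r. Qed.

Lemma ipBl x y z : '[x - y, z] = '[x, z] - '[y, z].
Proof. by rewrite ipDl ipNl. Qed.

Lemma ipDr x y z : '[z, x + y] = '[z, x] + '[z, y].
Proof. by rewrite ipC ipDl conjcD -!ipC. Qed.

Lemma ipZr a x z : '[z, a *: x] = a^* * '[z, x].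
Proof. by rewrite ipC ipZl conjcM -!ipC. Qed.

Lemma ip0r z : '[z, 0] = 0.
Proof. by rewrite ipC ip0l; apply: complex_ext; rewrite reimE /= ?oppr0. Qed.

Lemma ipNr x z : '[z, - x] = - '[z, x].
Proof. by rewrite ipC ipNl conjcN -!ipC. Qed.

Lemma ipBr x y z : '[z, x - y] = '[z, x] - '[z, y].
Proof. by rewrite ipDr ipNr. Qed.

Lemma ip_suml (I : Type) (r : seq I) (F : I -> E) z :
  '[\sum_(i <- r) F i, z] = \sum_(i <- r) '[F i, z].
Proof. by elim/big_ind2: _ => [|x a y b <- <-|//]; rewrite ?ip0l ?ipDl. Qed.

Lemma ip_sumr (I : Type) (r : seq I) (F : I -> E) z :
  '[z, \sum_(i <- r) F i] = \sum_(i <- r) '[z, F i].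
Proof. by elim/big_ind2: _ => [|x a y b <- <-|//]; rewrite ?ip0r ?ipDr. Qed.

Lemma Im_ip x : Im '[x, x] = 0.
Proof.
have /(congr1 (@Im R)) := ipC H x x; rewrite ImJ => /eqP.
by rewrite -subr_eq0 opprK -mulr2n mulrn_eq0/= => /eqP.
Qed.

Lemma nrm_ge0 x : 0 <= nrm x. Proof. exact: sqrtr_ge0. Qed.
Hint Resolve nrm_ge0 : core.

Lemma sqr_nrm x : nrm x ^+ 2 = Re '[x, x].
Proof. by rewrite sqr_sqrtr// ip_ge0. Qed.

Lemma ip_nrm x : '[x, x] = (nrm x ^+ 2)%:C.
Proof. by apply: complex_ext; rewrite !reimE ?Im_ip ?sqr_nrm. Qed.

Lemma sqr_nrmD x y : nrm (x + y) ^+ 2 = nrm x ^+ 2 + 2 * Re '[x, y] + nrm y ^+ 2.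
Proof. by rewrite !sqr_nrm ipDl !ipDr (ipC H x y) !reimE; ring. Qed.

Lemma sqr_nrmB x y : nrm (x - y) ^+ 2 = nrm x ^+ 2 - 2 * Re '[x, y] + nrm y ^+ 2.
Proof. by rewrite !sqr_nrm ipBl !ipBr (ipC H x y) !reimE; ring. Qed.

Lemma nrmZ a x : nrm (a *: x) = normc a * nrm x.
Proof.
apply/eqP; rewrite -(@eqrXn2 _ 2) ?mulr_ge0 ?normc_ge0//.
by rewrite exprMn !sqr_nrm ipZl ipZr mulrA mulcJ reimE ImC mul0r subr0.
Qed.

Lemma nrm0 : nrm 0 = 0. Proof. by rewrite /nrm ip0l sqrtr0. Qed.

Lemma nrmN x : nrm (- x) = nrm x.
Proof. by rewrite /nrm ipNl ipNr opprK. Qed.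

Lemma nrmB x y : nrm (x - y) = nrm (y - x).
Proof. by rewrite -nrmN opprB. Qed.

Lemma cauchy_schwarz x y : normc '[x, y] <= nrm x * nrm y.
Proof.
rewrite -(@ler_pXn2r _ 2) ?nnegrE ?normc_ge0 ?mulr_ge0// exprMn.
have [n0|n0] := eqVneq (normc '[x, y]) 0; first by rewrite n0 expr0n mulr_ge0 ?sqr_ge0.
apply: quadratic_discr; rewrite ?sqr_ge0// => t.
pose c := (t / normc '[x, y])%:C * '[x, y].
have := sqr_ge0 (nrm (x - c *: y)); rewrite sqr_nrmB nrmZ ipZr exprMn.
rewrite conjcM conjcC -mulrA [_^* * _]mulrC mulcJ !reimE.
rewrite normcMl normc_real normrM normfV (ger0_norm (normc_ge0 _)).
rewrite !mulr0 subr0.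
have -> : 2 * (t / normc '[x, y] * normc '[x, y] ^+ 2) = 2 * t * normc '[x, y] by field.
have -> : `|t| / normc '[x, y] * normc '[x, y] = `|t| by field.
by rewrite real_normK ?num_real.
Qed.

Lemma ler_nrmD x y : nrm (x + y) <= nrm x + nrm y.
Proof.
rewrite -(@ler_pXn2r _ 2) ?nnegrE ?addr_ge0// sqr_nrmD sqrrD lerD2r lerD2l.
rewrite [leRHS](_ : _ = 2 * (nrm x * nrm y)); last by ring.
rewrite ler_pM2l//.
by rewrite (le_trans (ler_norm _))// (le_trans (normc_le_Re _))// cauchy_schwarz.
Qed.

Lemma ler_nrmB_add x y z : nrm (x - z) <= nrm (x - y) + nrm (y - z).
Proof. by have := ler_nrmD (x - y) (y - z); rewrite addrA subrK. Qed.

Lemma nrm_eq0_ip x y : nrm x = 0 -> '[x, y] = 0.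
Proof.
move=> x0; have := cauchy_schwarz x y; rewrite x0 mul0r => h.
by apply: ComplexField.Normc.eq0_normc; apply/eqP; rewrite eq_le h normc_ge0.
Qed.

Lemma parallelogram x y :
  nrm (x + y) ^+ 2 + nrm (x - y) ^+ 2 = 2 * (nrm x ^+ 2 + nrm y ^+ 2).
Proof. by rewrite sqr_nrmD sqr_nrmB; ring. Qed.

Definition nconv (u : nat -> E) (l : E) :=
  forall e : R, 0 < e -> exists N, forall n, (N <= n)%N -> nrm (u n - l) < e.

Definition ncauchy (u : nat -> E) :=
  forall e : R, 0 < e -> exists N, forall m n, (N <= m)%N -> (N <= n)%N ->
    nrm (u m - u n) < e.

Lemma ncauchy_conv u : ncauchy u -> exists l, nconv u l.
Proof. exact: ip_complete. Qed.

Record closed_subspace V : Prop := ClosedSubspace {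
  csub0 : V 0;
  csubDZ : forall a x y, V x -> V y -> V (a *: x + y);
  csub_adh : forall x, (forall e : R, 0 < e -> exists2 v, V v & nrm (x - v) < e) -> V x }.

Lemma csubZ V a x : closed_subspace V -> V x -> V (a *: x).
Proof. by move=> cV Vx; rewrite -[_ *: _]addr0; apply: csubDZ => //; exact: csub0. Qed.

Lemma csubD V x y : closed_subspace V -> V x -> V y -> V (x + y).
Proof. by move=> cV Vx Vy; rewrite -[x]scale1r; apply: csubDZ. Qed.

Lemma csubN V x : closed_subspace V -> V x -> V (- x).
Proof. by move=> cV Vx; rewrite -scaleN1r; apply: csubZ. Qed.

Lemma csubB V x y : closed_subspace V -> V x -> V y -> V (x - y).
Proof. by move=> cV Vx Vy; apply: csubD => //; apply: csubN. Qed.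

Lemma csub_sum V (I : Type) (r : seq I) (F : I -> E) : closed_subspace V ->
  (forall i, V (F i)) -> V (\sum_(i <- r) F i).
Proof.
move=> cV VF; elim/big_rec: _ => [|i x _ Vx]; first exact: csub0.
exact: csubD.
Qed.

Lemma csub_conv V u l : closed_subspace V -> (forall n, V (u n)) -> nconv u l -> V l.
Proof.
move=> cV Vu ul; apply: (csub_adh cV) => e e0; have [N h] := ul e e0.
by exists (u N) => //; rewrite nrmB h.
Qed.

Lemma archi_lt (e : R) : 0 < e -> exists n : nat, n.+1%:R^-1 < e.
Proof. by move=> e0; have [n _ h] := near_infty_natSinv_lt (PosNum e0); exists n; apply: h => /=. Qed.

(** By the parallelogram law a minimizing sequence is Cauchy. *)
Lemma closest_point V x : closed_subspace V ->
  exists2 p, V p & forall v, V v -> nrm (x - p) <= nrm (x - v).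
Proof.
move=> cV; pose D := [set nrm (x - v) ^+ 2 | v in V].
have D0 : D !=set0 by exists (nrm (x - 0) ^+ 2), 0 => //; exact: csub0.
have Dlb : has_lbound D by exists 0 => _ [v _ <-]; exact: sqr_ge0.
have Dinf : has_inf D by [].
set d := inf D.
have dle v : V v -> d <= nrm (x - v) ^+ 2 by move=> Vv; apply: ge_inf => //; exists v.
have /choice[v vP] (n : nat) : exists v, V v /\ nrm (x - v) ^+ 2 < d + n.+1%:R^-1.
  have [_ [v Vv <-] h] := inf_adherent (ltac:(by []) : 0 < n.+1%:R^-1 :> R) Dinf.
  by exists v.
have vC : ncauchy v.
  move=> e e0; have [N hN] := archi_lt (ltac:(by rewrite divr_gt0 ?exprn_gt0) : 0 < e ^+ 2 / 4).
  exists N => m n Nm Nn.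
  have invle k : (N <= k)%N -> k.+1%:R^-1 <= N.+1%:R^-1 :> R.
    by move=> Nk; rewrite lef_pV2 ?posrE// ler_nat.
  rewrite -(@ltr_pXn2r _ 2) ?nnegrE ?(ltW e0)//.
  have Vmid : V (2^-1 *: (v m + v n)).
    by apply: csubZ => //; apply: csubD => //; apply: (proj1 (vP _)).
  have := parallelogram (x - v m) (x - v n).
  (* the midpoint of v m and v n is at distance at least sqrt d from x *)
  have -> : x - v m + (x - v n) = 2 *: (x - 2^-1 *: (v m + v n)).
    rewrite scalerBr scalerA divff ?pnatr_eq0// scale1r scaler_nat mulr2n.
    by rewrite opprD addrACA.
  have -> : x - v m - (x - v n) = - (v m - v n).
    by rewrite !opprB addrC addrA subrK.
  rewrite nrmZ nrmN exprMn.
  have -> : normc (2 : R[i]) ^+ 2 = 4 :> R by rewrite sqr_normcE /=; ring.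
  have := dle _ Vmid; have := (vP m).2; have := (vP n).2.
  have := invle m Nm; have := invle n Nn; move: hN.
  move: (N.+1%:R^-1) (n.+1%:R^-1) (m.+1%:R^-1) => i j k.
  by lra.
have [p vp] := ncauchy_conv vC.
have Vp : V p by apply: (csub_conv cV _ vp) => n; exact: (vP n).1.
exists p => // w Vw; rewrite -(@ler_pXn2r _ 2) ?nnegrE//.
apply: (le_trans _ (dle _ Vw)).
(* |x - v n| tends to sqrt d and v n to p; let e tend to 0 by continuity of sqrt *)
have xpb e : 0 < e -> nrm (x - p) <= Num.sqrt (d + e) + e.
  move=> e0; have [N hN] := vp e e0; have [M hM] := archi_lt e0.
  apply: (le_trans (ler_nrmB_add x (v (maxn N M)) p)).
  apply: lerD; last by apply/ltW/hN; rewrite leq_maxl.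
  rewrite -[leLHS]ger0_norm// -sqrtr_sqr ler_wsqrtr//.
  apply: (le_trans (ltW (vP _).2)); rewrite lerD2l.
  apply: (le_trans _ (ltW hM)); rewrite lef_pV2 ?posrE// ler_nat.
  by rewrite ltnS leq_maxr.
have d0 : 0 <= d by apply: lb_le_inf => // _ [z _ <-]; exact: sqr_ge0.
have sd : nrm (x - p) <= Num.sqrt d.
  apply/ler_addgt0Pr => e e0.
  have := @sqrt_continuous R d; move/cvgrPdist_lt => /(_ (e / 2) (ltac:(by rewrite divr_gt0))).
  move=> /nbhs_ballP[r /= r0 hr].
  pose h := Num.min (r / 2) (e / 2).
  have h0 : 0 < h by rewrite lt_min !divr_gt0.
  apply: (le_trans (xpb h h0)).
  have : ball d r (d + h).
    rewrite /ball/= opprD addrA subrr sub0r normrN gtr0_norm//.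
    by rewrite gt_min ltr_pdivrMr// mulr2n mulrDr mulr1 ltrDl r0.
  move=> /hr; rewrite ltr_distlC => /andP[_ h1].
  rewrite [leRHS](_ : _ = Num.sqrt d + e / 2 + e / 2); last by field.
  by rewrite lerD// ?(ltW h1)// ge_min lexx orbT.
by rewrite -(sqr_sqrtr d0) ler_pXn2r ?nnegrE ?sqrtr_ge0.
Qed.

(** Moving p by t a g, where a = <x - p, g> and t > 0, changes the squared distance
by - 2 t |a|^2 + O(t^2), which is negative for small t unless a = 0. *)
Lemma closest_orthogonal V x p : closed_subspace V -> V p ->
  (forall v, V v -> nrm (x - p) <= nrm (x - v)) ->
  forall g, V g -> '[x - p, g] = 0.
Proof.
move=> cV Vp hp g Vg; set w := x - p; set a := '[w, g].
have key (t : R) : 0 < t -> 2 * normc a ^+ 2 <= t * (normc a ^+ 2 * nrm g ^+ 2).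
  move=> t0; have Vq : V (p + (t%:C * a) *: g) by apply: csubD => //; exact: csubZ.
  have : nrm w ^+ 2 <= nrm (w - (t%:C * a) *: g) ^+ 2.
    by rewrite ler_pXn2r ?nnegrE//; have := hp _ Vq; rewrite opprD addrA.
  rewrite (sqr_nrmB w) nrmZ ipZr -/a conjcM conjcC.
  rewrite -mulrA [_^* * _]mulrC mulcJ !reimE normcMl normc_real gtr0_norm// !exprMn.
  rewrite mulr0 subr0 -addrA lerDl addrC subr_ge0 => h.
  rewrite -(ler_pM2l t0); apply: le_trans (le_trans h _); first by rewrite mulrCA.
  by rewrite le_eqVlt; apply/orP; left; apply/eqP; ring.
apply: ComplexField.Normc.eq0_normc; apply/eqP; rewrite -(@sqrf_eq0 R); apply/eqP.
set A := normc a ^+ 2 in key *; have A0 : 0 <= A by exact: sqr_ge0.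
apply/eqP; rewrite eq_le A0 andbT.
set G := nrm g ^+ 2 in key; have G0 : 0 <= G by exact: sqr_ge0.
have := key (1 + G)^-1 (ltac:(by rewrite invr_gt0 ltr_wpDr)).
rewrite [X in _ <= X]mulrCA => h; have : (1 + G)^-1 * G <= 1.
  by rewrite ler_pdivrMl ?ltr_wpDr// mulr1 lerDr.
by move=> h2; have := ler_wpM2l A0 h2; rewrite mulr1; move: h; lra.
Qed.

Lemma projection V x : closed_subspace V ->
  exists2 p, V p & forall g, V g -> '[x - p, g] = 0.
Proof.
move=> cV; have [p Vp hp] := closest_point x cV.
by exists p => //; exact: closest_orthogonal hp.
Qed.

Lemma projection_contract V x p : V p ->
  (forall g, V g -> '[x - p, g] = 0) -> nrm p <= nrm x.
Proof.
move=> Vp /(_ _ Vp) h; rewrite -(@ler_pXn2r _ 2) ?nnegrE//.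
rewrite -[in leRHS](subrK p x) sqr_nrmD h /= mulr0 addr0 lerDr; exact: sqr_ge0.
Qed.

(** If the conclusion fails, there are nested balls centred in V, with radii
tending to 0, such that some functional of the family is at least n on the n-th
one; their common point violates the pointwise bound. The functionals need to
be linear on V only, which allows maps defined by choosing a value outside V. *)
Lemma uniform_boundedness V (I : Type) (A : set I) (T : I -> E -> R[i]) :
  closed_subspace V ->
  (forall i, A i -> forall a x y, V x -> V y -> T i (a *: x + y) = a * T i x + T i y) ->
  (forall i, A i -> exists K, forall x, V x -> normc (T i x) <= K * nrm x) ->
  (forall x, V x -> exists K, forall i, A i -> normc (T i x) <= K) ->
  exists2 M, 0 <= M & forall i x, A i -> V x -> normc (T i x) <= M * nrm x.
Proof.
move=> cV Tlin Tbd Tpt; apply: contrapT => noM.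
have unb M : 0 <= M -> exists i y, [/\ A i, V y & M * nrm y < normc (T i y)].
  move=> M0; apply: contrapT => h; apply: noM; exists M => // i x Ai Vx.
  by rewrite leNgt; apply/negP => hlt; apply: h; exists i, x.
have step (xr : E * R) (n : nat) : exists x'r' : E * R,
    V xr.1 -> 0 < xr.2 -> [/\ V x'r'.1, 0 < x'r'.2, x'r'.2 <= xr.2 / 2,
      (forall z, nrm (z - x'r'.1) <= x'r'.2 -> nrm (z - xr.1) <= xr.2) &
      exists2 i, A i & forall z, V z -> nrm (z - x'r'.1) <= x'r'.2 -> n%:R <= normc (T i z)].
  have [Vx|nVx] := pselect (V xr.1); last by exists xr.
  have [r0|nr0] := pselect (0 < xr.2); last by exists xr.
  case: xr Vx r0 => x r /= Vx r0.
  have [i [y [Ai Vy hy]]] := unb ((n%:R + 1) / (r / 2)) (ltac:(by rewrite divr_ge0 ?addr_ge0 ?ler0n// ltW// divr_gt0)).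
  have ny0 : 0 < nrm y.
    rewrite lt_neqAle eq_sym nrm_ge0 andbT; apply/eqP => y0.
    have [K hK] := Tbd i Ai; have := hK y Vy; move: hy; rewrite y0 !mulr0 => h1 h2.
    by have := lt_le_trans h1 h2; rewrite ltxx.
  pose z := (r / 2 / nrm y)%:C *: y.
  have Vz : V z by exact: csubZ.
  have c0 : 0 < r / 2 / nrm y by rewrite !divr_gt0.
  have nz : nrm z = r / 2 by rewrite nrmZ normc_real gtr0_norm// divfK// gt_eqF.
  have TZ a v : V v -> T i (a *: v) = a * T i v.
    move=> Vv; have T0 : T i 0 = 0.
      have := Tlin i Ai 1 0 0 (csub0 cV) (csub0 cV); rewrite scale1r mul1r addr0 => h.
      by apply: (addrI (T i 0)); rewrite addr0 -h.
    by rewrite -[a *: v]addr0 Tlin// ?T0 ?addr0//; exact: csub0.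
  have Tz : n%:R + 1 < normc (T i z).
    rewrite TZ// normcMl normc_real gtr0_norm//.
    rewrite mulrAC ltr_pdivlMr//.
    by rewrite -ltr_pdivrMl ?divr_gt0// mulrA [_^-1 * _]mulrC.
  have Tadd u v : V u -> V v -> T i (u + v) = T i u + T i v.
    by move=> Vu Vv; rewrite -[u]scale1r Tlin// mul1r scale1r.
  have TN v : V v -> T i (- v) = - T i v by move=> Vv; rewrite -scaleN1r TZ// mulN1r.
  (* one of x + z and x - z works, as 2 T z = T (x + z) - T (x - z) *)
  have [x' [Vx' nx' Tx']] : exists x', [/\ V x', nrm (x' - x) = r / 2 & n%:R + 1 < normc (T i x')].
    have [h|h] := ltP (n%:R + 1) (normc (T i (x + z))).
      by exists (x + z); split => //; [exact: csubD|rewrite addrC addKr].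
    exists (x - z); split => //; first exact: csubB.
      by rewrite addrC addKr nrmN.
    have : normc (T i z *+ 2) <= normc (T i (x + z)) + normc (T i (x - z)).
      have -> : T i z *+ 2 = T i (x + z) - T i (x - z).
        by rewrite !Tadd ?TN//; [rewrite opprD opprK addrACA subrr add0r|exact: csubN].
      by apply: (le_trans (ler_normcD _ _)); rewrite normcNE.
    rewrite (_ : normc (T i z *+ 2) = 2 * normc (T i z)); last first.
      by rewrite normcMn mulr_natl.
    by move: h Tz; lra.
  have [K hK] := Tbd i Ai.
  pose K' := `|K| + 1.
  have K'0 : 0 < K' by rewrite ltr_wpDl.
  pose r' := Num.min (r / 2) K'^-1.
  have r'0 : 0 < r' by rewrite lt_min divr_gt0//= invr_gt0.
  exists (x', r') => _ _ /=; split => //.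
  - by rewrite ge_min lexx.
  - move=> w hw; apply: (le_trans (ler_nrmB_add w x' x)); rewrite nx'.
    rewrite [leRHS](_ : _ = r / 2 + r / 2); last by field.
    by rewrite lerD2r (le_trans hw)// ge_min lexx.
  exists i => // w Vw hw.
  have : normc (T i (w - x')) <= 1.
    apply: (le_trans (hK _ _)); first exact: csubB.
    apply: (@le_trans _ _ (K' * r')).
      apply: (@le_trans _ _ (K' * nrm (w - x'))); last by rewrite ler_pM2l.
      by apply: ler_wpM2r => //; rewrite (le_trans (ler_norm _))// lerDl.
    by rewrite -ler_pdivlMl// mulr1 ge_min lexx orbT.
  rewrite Tadd ?TN//; last exact: csubN.
  have := ler_normcD (T i w) (T i x' - T i w); rewrite addrC subrK normcB.
  by move: Tx'; lra.
have /choice[F FP] (xrn : (E * R) * nat) := step xrn.1 xrn.2.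
pose B := fix B n := if n is m.+1 then F (B m, m) else (0 : E, 1 : R).
have BP n : V (B n).1 /\ 0 < (B n).2.
  elim: n => [|n [h1 h2]]; first by split; [exact: csub0|exact: ltr01].
  by have [? ? _ _ _] := FP (B n, n) h1 h2.
have Bs n := FP (B n, n) (BP n).1 (BP n).2.
have Bsub m n z : (n <= m)%N -> nrm (z - (B m).1) <= (B m).2 -> nrm (z - (B n).1) <= (B n).2.
  move=> /subnK <-; elim: (m - n)%N => [//|k IH]; rewrite addSn => h.
  by apply: IH; have [_ _ _ + _] := Bs (k + n)%N; apply.
have Br n : (B n).2 <= 2^-1 ^+ n.
  elim: n => [|n IH]; first by rewrite expr0.
  have [_ _ + _ _] := Bs n => /le_trans; apply.
  by rewrite exprS mulrC ler_pM2l.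
have BC : ncauchy (fun n => (B n).1).
  move=> e e0; have [N hN] : exists N, 2^-1 ^+ N < e / 2 :> R.
    have /cvgrPdist_lt := @cvg_expr R (2^-1) (ltac:(by rewrite ger0_norm// invf_lt1// ltr1n)).
    move=> /(_ (e / 2) (ltac:(by rewrite divr_gt0)))[N _ /(_ N (leqnn N))].
    by rewrite sub0r normrN ger0_norm ?exprn_ge0// => h; exists N.
  exists N => m n Nm Nn.
  have h k : (N <= k)%N -> nrm ((B k).1 - (B N).1) < e / 2.
    move=> Nk; apply: le_lt_trans hN; apply: le_trans (Br N).
    by apply: (Bsub k N _ Nk); rewrite subrr nrm0 ltW// (BP k).2.
  apply: (le_lt_trans (ler_nrmB_add _ (B N).1 _)).
  rewrite [ltRHS](_ : _ = e / 2 + e / 2); last by field.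
  by apply: ltrD; rewrite ?h// nrmB h.
have [l Bl] := ncauchy_conv BC.
have Vl : V l by apply: (csub_conv cV _ Bl) => n; exact: (BP n).1.
have lB n : nrm (l - (B n).1) <= (B n).2.
  apply/ler_addgt0Pr => e e0; have [N hN] := Bl e e0.
  apply: (le_trans (ler_nrmB_add l (B (maxn N n)).1 _)); rewrite addrC; apply: lerD.
    apply: (@Bsub (maxn N n)); first by rewrite leq_maxr.
    by rewrite subrr nrm0 ltW// (BP _).2.
  by rewrite nrmB; apply/ltW/hN; rewrite leq_maxl.
have [K hK] := Tpt l Vl.
pose n := (Num.bound K).
have [_ _ _ _ [i Ai hi]] := Bs n.
have K0 : 0 <= K := le_trans (normc_ge0 _) (hK i Ai).
have := le_trans (hi l Vl (lB n.+1)) (hK i Ai).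
by apply/negP; rewrite -ltNge archi_boundP.
Qed.

Lemma nrmB_ip x y X Y : '[x, x] = '[X, X] -> '[y, y] = '[Y, Y] -> '[x, y] = '[X, Y] ->
  nrm (x - y) = nrm (X - Y).
Proof.
move=> xx yy xy; apply/eqP; rewrite -(@eqrXn2 _ 2) ?nrm_ge0//.
by rewrite !sqr_nrmB !sqr_nrm xx yy xy.
Qed.

(** The hypothesis compares norms instead of assuming a linear map, so that it
applies to maps that are linear up to vectors of norm 0. *)
Lemma polarization x y X Y :
  (forall a, nrm (x + a *: y) = nrm (X + a *: Y)) -> nrm y = nrm Y ->
  '[x, y] = '[X, Y].
Proof.
move=> h hy; have hx : nrm x = nrm X by have := h 0; rewrite !scale0r !addr0.
have key a : Re (a^* * '[x, y]) = Re (a^* * '[X, Y]).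
  have := congr1 (fun r => r ^+ 2) (h a).
  by rewrite !sqr_nrmD !ipZr !nrmZ hx hy; lra.
apply: complex_ext; first by have := key 1; rewrite !reimE/=; lra.
have := key (0 +i* 1); rewrite !reimE /= !mul0r !sub0r !mulN1r !opprK.
by [].
Qed.

End Hilbert.

#[global] Hint Extern 0 (is_true (0 <= nrm _ _)) => solve [exact: nrm_ge0] : core.

(** * Frames and closed spans *)

Section Frames.
Context {R : realType} {E : lmodType R[i]} (H : hilbertSpace E) {I : choiceType}.
Implicit Types (x y z : E) (a : R[i]) (V : set E).
Local Notation "''[' x , y ]" := (ip H x y).
Local Notation nrm := (nrm H).
Local Notation closed_subspace := (closed_subspace H).
Implicit Types (u : I -> E) (c : I -> R[i]) (J : {fset I}).

Lemma fsum_split (M : nmodType) (F : I -> M) (J1 J2 : {fset I}) : (J1 `<=` J2)%fset ->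
  \sum_(k <- J2) F k = \sum_(k <- J1) F k + \sum_(k <- (J2 `\` J1)%fset) F k.
Proof.
move=> /fsubsetP sub; rewrite (big_fsetID _ (mem J1))/=; congr (_ + _); congr bigop.
  apply: congr1; apply/fsetP => k; rewrite !inE/=.
  by apply/andP/idP => [[]//|kJ]; split => //; exact: sub.
by apply: congr1; apply/fsetP => k; rewrite !inE/= andbC.
Qed.

(** Unconditional convergence: the limit is taken along the finite subsets of I. *)
Definition usum u c (l : E) := forall e : R, 0 < e -> exists J0 : {fset I},
  forall J, (J0 `<=` J)%fset -> nrm (l - \sum_(k <- J) c k *: u k) < e.

Definition bessel V u (B : R) := forall J h, V h ->
  \sum_(k <- J) normc '[h, u k] ^+ 2 <= B * nrm h ^+ 2.

Lemma usum0 u : usum u (fun=> 0) 0.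
Proof.
move=> e e0; exists fset0 => J _; rewrite big1 => [|k _]; last exact: scale0r.
by rewrite subrr nrm0.
Qed.

Lemma usumDZ u c c' l l' a : usum u c l -> usum u c' l' ->
  usum u (fun k => a * c k + c' k) (a *: l + l').
Proof.
move=> ul ul' e e0; pose d := e / (normc a + 1) / 2.
have na0 : 0 < normc a + 1 by rewrite ltr_wpDl ?normc_ge0.
have d0 : 0 < d by rewrite !divr_gt0.
have [J1 h1] := ul d d0; have [J2 h2] := ul' (e / 2) (ltac:(by rewrite divr_gt0)).
exists (J1 `|` J2)%fset => J; rewrite fsubUset => /andP[/h1{}h1 /h2{}h2].
rewrite (_ : _ - _ = a *: (l - \sum_(k <- J) c k *: u k) + (l' - \sum_(k <- J) c' k *: u k)).
  apply: (le_lt_trans (ler_nrmD H _ _)); rewrite nrmZ.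
  have : normc a * nrm (l - \sum_(k <- J) c k *: u k) <= (normc a + 1) * d.
    by apply: ler_pM; rewrite ?normc_ge0// ?lerDl// ltW.
  have -> : (normc a + 1) * d = e / 2 by rewrite /d; field; rewrite gt_eqF.
  by move: h2; lra.
rewrite scalerBr scaler_sumr addrACA -opprD -big_split/=; congr (_ - _).
by apply: eq_bigr => k _; rewrite scalerDl scalerA.
Qed.

(** Duality: |y|^2 = sum_k c_k^* <y, u_k> is bounded by Cauchy-Schwarz and the
Bessel inequality for y. *)
Lemma synthesis_le V u B c J : closed_subspace V -> (forall k, V (u k)) ->
  0 <= B -> bessel V u B ->
  nrm (\sum_(k <- J) c k *: u k) ^+ 2 <= B * \sum_(k <- J) normc (c k) ^+ 2.
Proof.
move=> cV Vu B0 Bu; set y := \sum_(k <- J) _.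
have Vy : V y by apply: (csub_sum _ cV) => k; exact: (csubZ _ cV).
have [y0|y0] := eqVneq (nrm y) 0.
  by rewrite y0 expr0n mulr_ge0 ?sum_sqr_ge0.
have yp : 0 < nrm y ^+ 2 by rewrite exprn_gt0// lt_neqAle eq_sym y0 nrm_ge0.
have h : (nrm y ^+ 2) ^+ 2 <=
    (\sum_(k <- J) normc (c k) ^+ 2) * (\sum_(k <- J) normc '[y, u k] ^+ 2).
  have -> : nrm y ^+ 2 = normc (\sum_(k <- J) (c k)^* * '[y, u k]).
    rewrite (_ : \sum_(k <- J) _ = '[y, y]).
      by rewrite ip_nrm normc_real ger0_norm ?sqr_ge0.
    by rewrite [in RHS]/y ip_sumr; apply: eq_bigr => k _; rewrite ipZr.
  apply: (le_trans (cauchy_schwarz_sum _ _ _)).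
  by under eq_bigr do rewrite normcJE.
rewrite -(ler_pM2r yp) -expr2; apply: (le_trans h).
rewrite [leRHS](_ : _ = (\sum_(k <- J) normc (c k) ^+ 2) * (B * nrm y ^+ 2)); last by ring.
by apply: ler_wpM2l; [exact: sum_sqr_ge0|exact: Bu].
Qed.

(** By synthesis_le, the sums over finite sets that catch almost all of the l^2
mass of c form a Cauchy sequence. *)
Lemma synthesis_conv V u B c M : closed_subspace V -> (forall k, V (u k)) ->
  0 <= B -> bessel V u B -> (forall J, \sum_(k <- J) normc (c k) ^+ 2 <= M) ->
  exists2 l, V l & usum u c l.
Proof.
move=> cV Vu B0 Bu cM.
pose D := [set \sum_(k <- J) normc (c k) ^+ 2 | J in @setT {fset I}].
have Dsup : has_sup D.
  by split; [exists (\sum_(k <- fset0) normc (c k) ^+ 2), fset0|exists M => _ [J _ <-]].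
have /choice[J hJ] (n : nat) : exists J : {fset I},
    sup D - n.+1%:R^-1 < \sum_(k <- J) normc (c k) ^+ 2.
  have [_ [J _ <-] h] := sup_adherent (ltac:(by []) : 0 < n.+1%:R^-1 :> R) Dsup.
  by exists J.
have tail n (K : {fset I}) : (J n `<=` K)%fset ->
    nrm (\sum_(k <- K) c k *: u k - \sum_(k <- J n) c k *: u k) ^+ 2 <= B * n.+1%:R^-1.
  move=> JK; rewrite (fsum_split (fun k => c k *: u k) JK) addrC addKr.
  apply: (le_trans (synthesis_le _ _ cV Vu B0 Bu)); apply: ler_wpM2l => //.
  have := fsum_split (fun k => normc (c k) ^+ 2) JK; have := hJ n.
  have : \sum_(k <- K) normc (c k) ^+ 2 <= sup D.
    by apply: ub_le_sup; [exact: Dsup.2|exists K].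
  by move: (n.+1%:R^-1) => q; lra.
have small (e : R) : 0 < e -> exists N, forall n, (N <= n)%N -> B * n.+1%:R^-1 < e ^+ 2.
  move=> e0; have B1 : 0 < B + 1 by rewrite ltr_wpDl.
  have [N hN] := archi_lt (ltac:(by rewrite divr_gt0 ?exprn_gt0) : 0 < e ^+ 2 / (B + 1)).
  exists N => n Nn; apply: (@le_lt_trans _ _ (B * N.+1%:R^-1)).
    by apply: ler_wpM2l => //; rewrite lef_pV2 ?posrE// ler_nat.
  apply: (@le_lt_trans _ _ ((B + 1) * N.+1%:R^-1)).
    by apply: ler_wpM2r; rewrite ?invr_ge0// lerDl.
  by rewrite -ltr_pdivlMl// mulrC.
pose v n := \sum_(k <- J n) c k *: u k.
have tail' (e : R) : 0 < e -> exists N, forall n, (N <= n)%N -> forall K : {fset I},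
    (J n `<=` K)%fset -> nrm (\sum_(k <- K) c k *: u k - v n) < e.
  move=> e0; have [N hN] := small e e0; exists N => n Nn K JK.
  rewrite -(@ltr_pXn2r _ 2) ?nnegrE ?(ltW e0)//.
  exact: (le_lt_trans (tail _ _ JK) (hN _ Nn)).
have vC : ncauchy H v.
  move=> e e0; have [N hN] := tail' (e / 2) (ltac:(by rewrite divr_gt0)).
  exists N => m n Nm Nn; have K := (J m `|` J n)%fset.
  apply: (le_lt_trans (ler_nrmB_add H _ (\sum_(k <- (J m `|` J n)%fset) c k *: u k) _)).
  rewrite [ltRHS](_ : _ = e / 2 + e / 2); last by field.
  by apply: ltrD; [rewrite nrmB|]; apply: hN => //; rewrite ?fsubsetUl ?fsubsetUr.
have [l vl] := ncauchy_conv vC.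
exists l.
  by apply: (csub_conv cV _ vl) => n; apply: (csub_sum _ cV) => k; exact: (csubZ _ cV).
move=> e e0; have e20 : 0 < e / 2 by rewrite divr_gt0.
have [N1 h1] := tail' _ e20; have [N2 h2] := vl _ e20.
exists (J (maxn N1 N2)) => K JK.
apply: (le_lt_trans (ler_nrmB_add H _ (v (maxn N1 N2)) _)).
rewrite [ltRHS](_ : _ = e / 2 + e / 2); last by field.
apply: ltrD; first by rewrite nrmB h2// leq_maxr.
by rewrite nrmB h1// leq_maxl.
Qed.

(** Let S h = sum_k <h, u_k> u_k be the frame operator. On V the operator 1 - S / B
has norm at most q < 1, so S is inverted by the Neumann series; h' is the
preimage of h under S. *)
Lemma frame_inversion V u A B : closed_subspace V -> (forall k, V (u k)) ->
  0 < A -> 0 < B -> bessel V u B ->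
  (forall h, V h -> forall e : R, 0 < e -> exists J : {fset I},
    A * nrm h ^+ 2 < \sum_(k <- J) normc '[h, u k] ^+ 2 + e) ->
  exists2 C, 0 <= C & forall h, V h ->
    exists h', [/\ V h', nrm h' <= C * nrm h & usum u (fun k => '[h', u k]) h].
Proof.
move=> cV Vu A0 B0 Bu Al.
have /choice[S SP] h : exists y, V h -> V y /\ usum u (fun k => '[h, u k]) y.
  have [Vh|nVh] := pselect (V h); last by exists 0.
  have [y Vy hy] := synthesis_conv cV Vu (ltW B0) Bu (fun J => Bu J h Vh).
  by exists y.
have contr h : V h -> nrm (h - B^-1%:C *: S h) ^+ 2 <= (1 - A / B) * nrm h ^+ 2.
  move=> Vh; have [VS uS] := SP h Vh.
  apply/ler_addgt0Pr => e e0.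
  (* |h - S h / B|^2 <= |h|^2 - (sum_k |<h, u_k>|^2) / B <= (1 - A / B) |h|^2,
     where finite sums approximate S h and the lower bound up to e *)
  pose n := nrm h; have n0 : 0 <= n by exact: nrm_ge0.
  pose d := Num.min 1 (e / 2 / (2 * n + 1)).
  have d0 : 0 < d by rewrite lt_min ltr01 !divr_gt0// ltr_wpDl// mulr_ge0.
  have [J1 hJ1] := Al h Vh (B * e / 2) (ltac:(by rewrite divr_gt0// mulr_gt0)).
  have [J2 hJ2] := uS (B * d) (ltac:(by rewrite mulr_gt0)).
  pose J := (J1 `|` J2)%fset; pose N := \sum_(k <- J) normc '[h, u k] ^+ 2.
  pose SJ := \sum_(k <- J) '[h, u k] *: u k.
  have hN : A * n ^+ 2 <= N + B * e / 2.
    apply: (le_trans (ltW hJ1)); rewrite lerD2r /N (fsum_split _ (fsubsetUl J1 J2)).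
    by rewrite lerDl sum_sqr_ge0.
  have hS : nrm (SJ - S h) <= B * d by rewrite nrmB ltW// hJ2// fsubsetUr.
  pose x := h - B^-1%:C *: SJ.
  have hx : nrm x ^+ 2 <= n ^+ 2 - B^-1 * N.
    rewrite (sqr_nrmB H) ipZr ip_sumr (_ : \sum_(k <- J) _ = N%:C); last first.
      rewrite /N (rmorph_sum (real_complex R)); apply: eq_bigr => k _.
      by rewrite ipZr mulrC mulcJ.
    rewrite nrmZ exprMn normc_real gtr0_norm ?invr_gt0// !reimE mulr0 subr0.
    have := synthesis_le (fun k => '[h, u k]) J cV Vu (ltW B0) Bu; rewrite -/SJ -/N => hSJ.
    have : B^-1 ^+ 2 * nrm SJ ^+ 2 <= B^-1 * N.
      rewrite expr2 -mulrA ler_pM2l ?invr_gt0//.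
      by rewrite -(ler_pM2l B0) mulrA divff ?gt_eqF// mul1r.
    by rewrite /n; move: (B^-1 * N) (B^-1 ^+ 2 * nrm SJ ^+ 2) => p1 p2; lra.
  have N0 : 0 <= N by exact: sum_sqr_ge0.
  have xn : nrm x <= n.
    rewrite -(@ler_pXn2r _ 2) ?nnegrE//; apply: (le_trans hx).
    by rewrite gerBl mulr_ge0// invr_ge0 ltW.
  have -> : h - B^-1%:C *: S h = x + B^-1%:C *: (SJ - S h).
    by rewrite scalerBr addrA subrK.
  have : nrm (x + B^-1%:C *: (SJ - S h)) <= nrm x + d.
    apply: (le_trans (ler_nrmD H _ _)); rewrite lerD2l nrmZ normc_real gtr0_norm ?invr_gt0//.
    by rewrite -(ler_pM2l B0) mulrA divff ?gt_eqF// mul1r.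
  rewrite -(@ler_pXn2r _ 2) ?nnegrE ?addr_ge0// ?(ltW d0)// => /le_trans; apply.
  have h1 : A / B * n ^+ 2 <= B^-1 * N + e / 2.
    rewrite -(ler_pM2l B0).
    rewrite (_ : B * (A / B * n ^+ 2) = A * n ^+ 2); last by field; rewrite gt_eqF.
    by rewrite (_ : B * _ = N + B * e / 2)//; field; rewrite gt_eqF.
  have h2 : 2 * nrm x * d + d ^+ 2 <= e / 2.
    apply: (@le_trans _ _ ((2 * n + 1) * d)).
      rewrite [leRHS](_ : _ = 2 * n * d + d); last by ring.
      rewrite expr2; apply: lerD; first by rewrite ler_pM2r// ler_pM2l.
      by rewrite ler_piMl ?(ltW d0)// ge_min lexx.
    rewrite -ler_pdivlMl ?ltr_wpDl// ?mulr_ge0// mulrC.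
    by rewrite ge_min lexx orbT.
  rewrite sqrrD (mulrBl _ 1) mul1r.
  rewrite (_ : nrm x * d *+ 2 = 2 * nrm x * d); last by ring.
  rewrite -[nrm h]/n.
  by move: (B^-1 * N) (A / B * n ^+ 2) hx h1 h2 => p1 p2; lra.
(* A > B is possible when every vector of V has norm 0, whence the max *)
pose q := Num.sqrt (Num.max 0 (1 - A / B)).
have q0 : 0 <= q by exact: sqrtr_ge0.
have q1 : q < 1.
  rewrite -[1]sqrtr1 ltr_sqrt// gt_max ltr01/= ltrBlDr ltrDl divr_gt0//.
have q2 : q ^+ 2 = Num.max 0 (1 - A / B) by rewrite sqr_sqrtr// le_max lexx.
have contrq h : V h -> nrm (h - B^-1%:C *: S h) <= q * nrm h.
  move=> Vh; rewrite -(@ler_pXn2r _ 2) ?nnegrE ?mulr_ge0//.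
  apply: (le_trans (contr h Vh)); rewrite exprMn q2.
  by apply: ler_wpM2r; rewrite ?sqr_ge0// le_max lexx orbT.
pose C := B^-1 / (1 - q).
have C0 : 0 <= C by rewrite divr_ge0 ?invr_ge0 ?ltW// subr_gt0.
exists C => // h Vh.
pose r := fix r n := if n is m.+1 then r m - B^-1%:C *: S (r m) else h.
have Vr n : V (r n).
  elim: n => [//|n IH] /=; apply: (csubB cV) => //; apply: (csubZ _ cV) => //.
  exact: (SP _ IH).1.
have rq n : nrm (r n) <= q ^+ n * nrm h.
  elim: n => [|n IH]; first by rewrite expr0 mul1r.
  apply: (le_trans (contrq _ (Vr n))); rewrite exprS -mulrA.
  exact: ler_wpM2l.
(* w n is the n-th partial sum of the Neumann series and S (w n) = h - r n *)
pose w n := \sum_(j < n) B^-1%:C *: r j.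
have Vw n : V (w n) by apply: (csub_sum _ cV) => j; exact: (csubZ _ cV).
have wS n : w n.+1 = B^-1%:C *: r n + w n by rewrite /w big_ord_recr addrC.
have Bn x : nrm (B^-1%:C *: x) = B^-1 * nrm x.
  by rewrite nrmZ normc_real gtr0_norm ?invr_gt0.
have wtail n k : nrm (w (n + k)%N - w n) <= C * nrm h * (q ^+ n - q ^+ (n + k)).
  elim: k => [|k IH]; first by rewrite addn0 !subrr nrm0 mulr0.
  rewrite addnS wS -addrA; apply: (le_trans (ler_nrmD H _ _)).
  apply: (le_trans (lerD _ IH)).
    rewrite Bn; apply: ler_wpM2l; first by rewrite invr_ge0 ltW.
    exact: rq.
  rewrite exprSr /C le_eqVlt; apply/orP; left; apply/eqP.
  have q10 : 1 - q != 0 by rewrite gt_eqF ?subr_gt0.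
  by move: (B^-1) (q ^+ n) (q ^+ (n + k)) => b a a'; field.
have uw n : usum u (fun k => '[w n, u k]) (h - r n).
  elim: n => [|n IH].
    rewrite /w big_ord0 subrr.
    by under eq_fun do rewrite ip0l; exact: usum0.
  have := usumDZ B^-1%:C (SP _ (Vr n)).2 IH.
  rewrite wS /= opprB addrCA.
  by under eq_fun do rewrite -ipDZl.
have qlt (e : R) : 0 < e -> exists N, q ^+ N < e.
  move=> e0.
  have /cvgrPdist_lt := @cvg_expr R q (ltac:(by rewrite ger0_norm)).
  move=> /(_ e e0)[N _ /(_ N (leqnn N))].
  by rewrite sub0r normrN ger0_norm ?exprn_ge0// => qN; exists N.
have qtail (e : R) : 0 < e -> exists N, C * nrm h * q ^+ N < e.
  move=> e0; have C1 : 0 < C * nrm h + 1 by rewrite ltr_wpDl// mulr_ge0.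
  have [N hN] := qlt _ (divr_gt0 e0 C1); exists N.
  apply: (@le_lt_trans _ _ ((C * nrm h + 1) * q ^+ N)).
    by rewrite ler_wpM2r ?exprn_ge0// lerDl.
  by rewrite -ltr_pdivlMl// mulrC.
have wtl N n : (N <= n)%N -> nrm (w n - w N) <= C * nrm h * q ^+ N.
  move=> /subnKC <-; apply: (le_trans (wtail _ _)); apply: ler_wpM2l.
    by rewrite mulr_ge0.
  by rewrite lerBlDr lerDl exprn_ge0.
have wC : ncauchy H w.
  move=> e e0; have [N hN] := qtail (e / 2) (ltac:(by rewrite divr_gt0)).
  exists N => m n Nm Nn; apply: (le_lt_trans (ler_nrmB_add H _ (w N) _)).
  rewrite [ltRHS](_ : _ = e / 2 + e / 2); last by field.
  apply: ltrD; first exact: (le_lt_trans (wtl _ _ Nm)).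
  by rewrite nrmB; exact: (le_lt_trans (wtl _ _ Nn)).
have [h' wh'] := ncauchy_conv wC.
have Vh' : V h' by exact: (csub_conv cV Vw wh').
exists h'; split => //.
  apply/ler_addgt0Pr => e e0; have [N hN] := wh' e e0.
  rewrite -[h'](subrK (w N)) addrC; apply: (le_trans (ler_nrmD H _ _)); apply: lerD.
    have := wtl 0 N isT; rewrite expr0 mulr1 => /(le_trans _); apply.
    by rewrite /w big_ord0 subr0.
  by rewrite nrmB ltW// hN.
move=> e e0; have e40 : 0 < e / 4 by rewrite divr_gt0.
have eB0 : 0 < e / 4 / (B + 1) by rewrite divr_gt0// ltr_wpDl// ltW.
have [N1 h1] := qlt _ (divr_gt0 e40 (ltac:(by rewrite ltr_wpDl) : 0 < nrm h + 1)).
have [N2 h2] := wh' _ eB0.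
pose n := maxn N1 N2.
have [J0 hJ0] := uw n _ e40; exists J0 => J JJ.
have TB z : V z -> nrm (\sum_(k <- J) '[z, u k] *: u k) <= B * nrm z.
  move=> Vz; rewrite -(@ler_pXn2r _ 2) ?nnegrE ?mulr_ge0// ?(ltW B0)//.
  apply: (le_trans (synthesis_le _ J cV Vu (ltW B0) Bu)).
  by rewrite exprMn expr2 -mulrA ler_pM2l//; exact: Bu.
rewrite (_ : _ - _ = r n + (h - r n - \sum_(k <- J) '[w n, u k] *: u k) -
                     \sum_(k <- J) '[h' - w n, u k] *: u k); last first.
  rewrite addrA [r n + _]addrC subrK -addrA -opprD -big_split/=; congr (_ - _).
  by apply: eq_bigr => k _; rewrite -scalerDl -ipDl addrC subrK.
apply: (le_lt_trans (ler_nrmD H _ _)); rewrite nrmN.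
rewrite [ltRHS](_ : _ = e / 4 + e / 4 + e / 2); last by field.
apply: ltrD.
  apply: (le_lt_trans (ler_nrmD H _ _)); apply: ltrD; last exact: hJ0.
  apply: (le_lt_trans (rq n)).
  apply: (@le_lt_trans _ _ (q ^+ N1 * (nrm h + 1))).
    apply: ler_pM; rewrite ?exprn_ge0// ?lerDl//.
    by apply: ler_wiXn2l => //; [exact: ltW|exact: leq_maxl].
  by rewrite -ltr_pdivlMr// ltr_wpDl.
apply: (le_lt_trans (TB _ (csubB cV Vh' (Vw n)))).
apply: (@le_lt_trans _ _ ((B + 1) * nrm (h' - w n))).
  by rewrite ler_wpM2r// lerDl.
apply: (@lt_le_trans _ _ (e / 4)); last by move: e0; lra.
rewrite -ltr_pdivlMl ?ltr_wpDl// ?(ltW B0)// mulrC nrmB.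
by apply: h2; exact: leq_maxr.
Qed.

Definition closed_span u : set E := [set x | forall e : R, 0 < e ->
  exists (J : {fset I}) (c : I -> R[i]), nrm (x - \sum_(k <- J) c k *: u k) < e].

Lemma closed_span_sum u J c : closed_span u (\sum_(k <- J) c k *: u k).
Proof. by move=> e e0; exists J, c; rewrite subrr nrm0. Qed.

Lemma closed_span_gen u k : closed_span u (u k).
Proof.
by have := closed_span_sum u [fset k]%fset (fun=> 1); rewrite big_seq_fset1 scale1r.
Qed.

Lemma closed_span_closed u : closed_subspace (closed_span u).
Proof.
split.
- by have := closed_span_sum u fset0 (fun=> 0); rewrite big_seq_fset0.
- move=> a x y Sx Sy e e0; pose d := e / (normc a + 1) / 2.
  have na0 : 0 < normc a + 1 by rewrite ltr_wpDl ?normc_ge0.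
  have d0 : 0 < d by rewrite !divr_gt0.
  have [J1 [c1 h1]] := Sx d d0; have [J2 [c2 h2]] := Sy (e / 2) (ltac:(by rewrite divr_gt0)).
  (* extend the coefficients by 0, so that both sums range over the same set *)
  pose ext J (c : I -> R[i]) k := if k \in J then c k else 0.
  have extE J K c : (J `<=` K)%fset ->
      \sum_(k <- K) ext J c k *: u k = \sum_(k <- J) c k *: u k.
    move=> JK; rewrite (fsum_split (fun k => ext J c k *: u k) JK).
    have -> : \sum_(k <- (K `\` J)%fset) ext J c k *: u k = 0.
      rewrite big_seq big1// => k.
      by rewrite inE => /andP[kJ _]; rewrite /ext (negbTE kJ) scale0r.
    rewrite addr0 big_seq [RHS]big_seq.
    by apply: eq_bigr => k kJ; rewrite /ext kJ.
  exists (J1 `|` J2)%fset, (fun k => a * ext J1 c1 k + ext J2 c2 k).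
  rewrite (_ : _ - _ = a *: (x - \sum_(k <- J1) c1 k *: u k) + (y - \sum_(k <- J2) c2 k *: u k)).
    apply: (le_lt_trans (ler_nrmD H _ _)); rewrite nrmZ.
    have : normc a * nrm (x - \sum_(k <- J1) c1 k *: u k) <= (normc a + 1) * d.
      by apply: ler_pM; rewrite ?normc_ge0// ?lerDl// ltW.
    have -> : (normc a + 1) * d = e / 2 by rewrite /d; field; rewrite gt_eqF.
    by move: h2; lra.
  rewrite -(extE J1 _ c1 (fsubsetUl J1 J2)) -(extE J2 _ c2 (fsubsetUr J1 J2)).
  rewrite scalerBr scaler_sumr addrACA -opprD -big_split/=; congr (_ - _).
  by apply: eq_bigr => k _; rewrite scalerDl scalerA.
- move=> x hx e e0; have e20 : 0 < e / 2 by rewrite divr_gt0.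
  have [v Sv xv] := hx _ e20; have [J [c hc]] := Sv _ e20.
  exists J, c; apply: (le_lt_trans (ler_nrmB_add H _ v _)).
  by rewrite [ltRHS](_ : _ = e / 2 + e / 2); [exact: ltrD|field].
Qed.

Lemma closed_span_min u V : closed_subspace V -> (forall k, V (u k)) -> closed_span u `<=` V.
Proof.
move=> cV Vu x Sx; apply: (csub_adh cV) => e e0; have [J [c h]] := Sx e e0.
exists (\sum_(k <- J) c k *: u k) => //.
by apply: (csub_sum _ cV) => k; exact: (csubZ _ cV).
Qed.

(** Translations of L^2 are such maps; the Fourier transform is not, being linear
only up to null sets. *)
Lemma isometry_preimage_closed V (T : E -> E) : closed_subspace V ->
  (forall a x y, T (a *: x + y) = a *: T x + T y) -> (forall x, nrm (T x) = nrm x) ->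
  closed_subspace (T @^-1` V).
Proof.
move=> cV Tlin Tiso.
have T0 : T 0 = 0.
  have := Tlin 1 0 0; rewrite scale1r scale1r addr0 => h.
  by apply: (addrI (T 0)); rewrite addr0 -h.
split => /=; first by rewrite /= T0; exact: (csub0 cV).
- by move=> a x y Vx Vy; rewrite Tlin; apply: (csubDZ cV).
- move=> x hx; apply: (csub_adh cV) => e e0; have [v Vv xv] := hx e e0.
  exists (T v) => //; rewrite (_ : T x - T v = T (x - v)) ?Tiso//.
  have -> : x - v = (-1) *: v + x by rewrite scaleN1r addrC.
  by rewrite Tlin scaleN1r addrC.
Qed.

End Frames.

(** * Square integrable complex functions *)

Section L2.
Context {R : realType}.
Local Notation mu := (@lebesgue_measure R).
Local Notation mR := (measurableTypeR R).
Implicit Types (f g h : R -> R[i]).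

Definition cmeas f := measurable_fun [set: mR] (fun x : mR => Re (f x)) /\
  measurable_fun [set: mR] (fun x : mR => Im (f x)).

Definition cintegrable f := mu.-integrable [set: mR] (fun x : mR => (Re (f x))%:E) /\
  mu.-integrable [set: mR] (fun x : mR => (Im (f x))%:E).

(** The square of norm2. Unlike a norm it is an integral, to which Fatou's lemma and
changes of variables apply. *)
Definition sqint f : \bar R := (\int[mu]_x (normc (f x) ^+ 2)%:E)%E.

Lemma cmeasD f g : cmeas f -> cmeas g -> cmeas (f \+ g).
Proof.
move=> [f1 f2] [g1 g2]; split => /=.
  by under eq_fun do rewrite ReD; exact: measurable_funD.
by under eq_fun do rewrite ImD; exact: measurable_funD.
Qed.

Lemma cmeasM f g : cmeas f -> cmeas g -> cmeas (f \* g).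
Proof.
move=> [f1 f2] [g1 g2]; split => /=.
  by under eq_fun do rewrite Re_mul; apply: measurable_funB; exact: measurable_funM.
by under eq_fun do rewrite Im_mul; apply: measurable_funD; exact: measurable_funM.
Qed.

Lemma cmeasN f : cmeas f -> cmeas (\- f).
Proof.
move=> [f1 f2]; split => /=.
  by under eq_fun do rewrite ReN; exact: measurable_funN.
by under eq_fun do rewrite ImN; exact: measurable_funN.
Qed.

Lemma cmeasB f g : cmeas f -> cmeas g -> cmeas (f \- g).
Proof. by move=> mf mg; apply: cmeasD => //; exact: cmeasN. Qed.

Lemma cmeasJ f : cmeas f -> cmeas (fun x => (f x)^*).
Proof.
move=> [f1 f2]; split => /=.
  by under eq_fun do rewrite ReJ.
by under eq_fun do rewrite ImJ; exact: measurable_funN.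
Qed.

Lemma cmeas_cst (a : R[i]) : cmeas (cst a).
Proof. by split; exact: measurable_cst. Qed.

Lemma measurable_sqr_normc f : cmeas f ->
  measurable_fun [set: mR] (fun x : mR => normc (f x) ^+ 2).
Proof.
move=> [f1 f2]; under eq_fun do rewrite sqr_normcE.
by apply: measurable_funD; exact: measurable_funX.
Qed.

Lemma measurable_normc f : cmeas f ->
  measurable_fun [set: mR] (fun x : mR => normc (f x)).
Proof.
move=> /measurable_sqr_normc mf.
rewrite (_ : (fun x : mR => _) = Num.sqrt \o (fun x : mR => normc (f x) ^+ 2)).
  apply: measurableT_comp mf.
  apply: continuous_measurable_fun; exact: sqrt_continuous.
by apply/funext => x /=; rewrite sqrtr_sqr ger0_norm ?normc_ge0.
Qed.

Lemma norm2E f : norm2 f = ((sqint f) `^ (2^-1))%E.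
Proof.
rewrite /norm2 unlock; congr (_ `^ _)%E; apply: eq_integral => x _ /=.
by rewrite powR_mulrn ?normr_ge0// ger0_norm ?normc_ge0.
Qed.

Lemma sqint_ge0 f : (0 <= sqint f)%E.
Proof. by apply: integral_ge0 => x _; rewrite lee_fin sqr_ge0. Qed.

Lemma norm2_fin f (r : R) : sqint f = r%:E -> norm2 f = (Num.sqrt r)%:E.
Proof.
move=> h; have r0 : 0 <= r by rewrite -lee_fin -h sqint_ge0.
by rewrite norm2E h poweR12_sqrt//.
Qed.

Lemma Lfun2P (u : mR -> R) : u \in Lfun mu 2%:E <->
  measurable_fun [set: mR] u /\ (\int[mu]_x (u x ^+ 2)%:E < +oo)%E.
Proof.
have e : ('N[mu]_2%:E[EFin \o u] = (\int[mu]_x (u x ^+ 2)%:E) `^ 2^-1)%E.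
  rewrite unlock; congr (_ `^ _)%E; apply: eq_integral => x _ /=.
  by rewrite powR_mulrn ?normr_ge0// real_normK ?num_real.
have i0 : (0 <= \int[mu]_x (u x ^+ 2)%:E)%E.
  by apply: integral_ge0 => x _; rewrite lee_fin sqr_ge0.
split.
  move=> /[dup] h /Lfun2_integrable_sqr/integrableP[_ hi].
  move: h => /andP[/[!inE]/= mu_ _]; split => //.
  apply: le_lt_trans hi; apply: ge0_le_integral => //.
  - by move=> x _; rewrite lee_fin sqr_ge0.
  - by apply/measurable_EFinP; exact: measurable_funX.
  - by apply/measurable_EFinP/measurableT_comp => //; exact: measurable_funX.
  - by move=> x _; rewrite lee_fin ler_norm.
move=> [mu_ hi]; apply/andP; split; rewrite inE//=.
by rewrite /finite_norm e poweR_lty.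
Qed.

Lemma in_Lp2P f : in_Lp 2%:E f <-> cmeas f /\ (sqint f < +oo)%E.
Proof.
split.
  move=> [/Lfun2P[m1 i1] /Lfun2P[m2 i2]]; split; first by split.
  rewrite /sqint; under eq_integral do rewrite sqr_normcE EFinD.
  rewrite ge0_integralD//.
  - by rewrite lte_add_pinfty.
  - by move=> x _; rewrite lee_fin sqr_ge0.
  - by apply/measurable_EFinP; exact: measurable_funX.
  - by move=> x _; rewrite lee_fin sqr_ge0.
  - by apply/measurable_EFinP; exact: measurable_funX.
move=> [[m1 m2] i]; split; apply/Lfun2P; split => //; apply: le_lt_trans i;
  apply: ge0_le_integral => //.
- by move=> x _; rewrite lee_fin sqr_ge0.
- by apply/measurable_EFinP; exact: measurable_funX.
- by apply/measurable_EFinP; exact: measurable_sqr_normc.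
- by move=> x _; rewrite lee_fin sqr_normcE lerDl sqr_ge0.
- by move=> x _; rewrite lee_fin sqr_ge0.
- by apply/measurable_EFinP; exact: measurable_funX.
- by apply/measurable_EFinP; exact: measurable_sqr_normc.
- by move=> x _; rewrite lee_fin sqr_normcE lerDr sqr_ge0.
Qed.

Lemma in_Lp1P f : in_Lp 1%:E f <-> cintegrable f.
Proof. by split => -[h1 h2]; split; exact/Lfun1_integrable. Qed.

Lemma cintegrable_norm f : cmeas f ->
  cintegrable f <-> mu.-integrable [set: mR] (fun x : mR => (normc (f x))%:E).
Proof.
move=> [m1 m2]; have mn := @measurable_normc f (conj m1 m2); split.
  move=> [i1 i2]; apply: (le_integrable _ _ _ (integrableD _ (integrable_abse i1) (integrable_abse i2))) => //.
    exact/measurable_EFinP.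
  move=> x _ /=; rewrite lee_fin [X in _ <= X]ger0_norm ?addr_ge0//.
  by rewrite ger0_norm ?normc_ge0// normc_le_ReIm.
move=> i; split; apply: (le_integrable _ _ _ i) => //.
- exact/measurable_EFinP.
- by move=> x _; rewrite lee_fin [X in _ <= X]ger0_norm ?normc_ge0// normc_le_Re.
- exact/measurable_EFinP.
- by move=> x _; rewrite lee_fin [X in _ <= X]ger0_norm ?normc_ge0// normc_le_Im.
Qed.

Lemma cintegrable_le f g : cmeas f -> cintegrable g ->
  (forall x, normc (f x) <= normc (g x)) -> cintegrable f.
Proof.
move=> mf ig fg; apply/(cintegrable_norm mf).
have mg : cmeas g by case: ig => /integrableP[/measurable_EFinP ? _] /integrableP[/measurable_EFinP ? _].
apply: (le_integrable _ _ _ ((cintegrable_norm mg).1 ig)) => //.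
  by apply/measurable_EFinP; exact: measurable_normc.
by move=> x _; rewrite lee_fin !ger0_norm ?normc_ge0.
Qed.

Lemma cintegrable_meas f : cintegrable f -> cmeas f.
Proof. by case=> /integrableP[/measurable_EFinP ? _] /integrableP[/measurable_EFinP ? _]. Qed.

Lemma cintegrableD f g : cintegrable f -> cintegrable g -> cintegrable (f \+ g).
Proof.
move=> [f1 f2] [g1 g2]; split.
  by under eq_fun do rewrite ReD EFinD; exact: integrableD.
by under eq_fun do rewrite ImD EFinD; exact: integrableD.
Qed.

Lemma cintegrableZ a f : cintegrable f -> cintegrable (fun x => a * f x).
Proof.
move=> [f1 f2]; split.
  under eq_fun do rewrite Re_mul EFinB !EFinM.
  by apply: integrableB => //; exact: integrableZl.
under eq_fun do rewrite Im_mul EFinD !EFinM.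
by apply: integrableD => //; exact: integrableZl.
Qed.

Lemma cintegralD f g : cintegrable f -> cintegrable g ->
  cintegral (f \+ g) = cintegral f + cintegral g.
Proof.
move=> [f1 f2] [g1 g2]; apply: complex_ext; rewrite ?ReD ?ImD /=.
  by under eq_Rintegral do rewrite ReD; rewrite RintegralD.
by under eq_Rintegral do rewrite ImD; rewrite RintegralD.
Qed.

Lemma integrable_scale (r : R) (u : mR -> R) :
  mu.-integrable [set: mR] (EFin \o u) ->
  mu.-integrable [set: mR] (EFin \o (fun x => r * u x)).
Proof. by move=> iu; rewrite (_ : _ \o _ = fun x => r%:E * (EFin \o u) x)%E//; exact: integrableZl. Qed.

Lemma cintegralZ a f : cintegrable f -> cintegral (fun x => a * f x) = a * cintegral f.
Proof.
move=> [f1 f2]; apply: complex_ext; rewrite ?Re_mul ?Im_mul /=.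
  under eq_Rintegral do rewrite Re_mul; rewrite RintegralB ?RintegralZl//; exact: integrable_scale.
under eq_Rintegral do rewrite Im_mul; rewrite RintegralD ?RintegralZl//; exact: integrable_scale.
Qed.

Lemma cintegralJ f : cintegrable f -> cintegral (fun x => (f x)^*) = (cintegral f)^*.
Proof.
move=> [f1 f2]; apply: complex_ext; rewrite ?ReJ ?ImJ /=.
  by under eq_Rintegral do rewrite ReJ.
under eq_Rintegral do rewrite ImJ -mulN1r; rewrite RintegralZl//.
by rewrite mulN1r.
Qed.

Lemma L2_mul f g : in_Lp 2%:E f -> in_Lp 2%:E g -> cintegrable (fun x => f x * g x).
Proof.
move=> [f1 f2] [g1 g2].
have L u v : u \in Lfun mu 2%:E -> v \in Lfun mu 2%:E ->
    mu.-integrable [set: mR] (fun x : mR => (u x * v x)%:E).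
  by move=> lu lv; exact/Lfun1_integrable/Lfun2_mul_Lfun1.
split.
  under eq_fun do rewrite Re_mul EFinB.
  by apply: integrableB => //; exact: L.
under eq_fun do rewrite Im_mul EFinD.
by apply: integrableD => //; exact: L.
Qed.

Lemma L2J f : in_Lp 2%:E f -> in_Lp 2%:E (fun x => (f x)^*).
Proof.
move=> /in_Lp2P[mf i]; apply/in_Lp2P; split; first exact: cmeasJ.
by rewrite /sqint; under eq_integral do rewrite normcJE.
Qed.

Lemma L2_inner f g : in_Lp 2%:E f -> in_Lp 2%:E g -> cintegrable (fun x => f x * (g x)^*).
Proof. by move=> Lf Lg; apply: L2_mul => //; exact: L2J. Qed.

Lemma L2D f g : in_Lp 2%:E f -> in_Lp 2%:E g -> in_Lp 2%:E (f \+ g).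
Proof.
have D u v : u \in Lfun mu 2%:E -> v \in Lfun mu 2%:E -> (u \+ v) \in Lfun mu 2%:E.
  move=> lu lv; have := (Lfun_submod_closed mu (lee1n 2)).2 1 u v lu lv.
  by rewrite scale1r.
move=> [f1 f2] [g1 g2]; split.
  by under [X in X \in _]eq_fun do rewrite ReD; exact: D.
by under [X in X \in _]eq_fun do rewrite ImD; exact: D.
Qed.

Lemma L2Z a f : in_Lp 2%:E f -> in_Lp 2%:E (fun x => a * f x).
Proof.
move=> /in_Lp2P[mf i]; apply/in_Lp2P; split; first exact: cmeasM (cmeas_cst a) mf.
rewrite /sqint; under eq_integral do rewrite normcMl exprMn EFinM.
rewrite ge0_integralZl//.
- by apply: lte_mul_pinfty => //; rewrite lee_fin sqr_ge0.
- by apply/measurable_EFinP; exact: measurable_sqr_normc.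
- by move=> x _; rewrite lee_fin sqr_ge0.
- by rewrite lee_fin sqr_ge0.
Qed.

Lemma inner_sqint f : in_Lp 2%:E f -> (Re (inner f f))%:E = sqint f.
Proof.
move=> Lf; rewrite /inner /cintegral /= /Rintegral.
have [_ h] := (in_Lp2P f).1 Lf.
rewrite (_ : (\int[mu]_x _)%E = sqint f); first by rewrite fineK// ge0_fin_numE ?sqint_ge0.
by apply: eq_integral => x _; rewrite mulcJ.
Qed.

Lemma norm2_inner f : in_Lp 2%:E f -> norm2 f = (Num.sqrt (Re (inner f f)))%:E.
Proof. by move=> Lf; apply: norm2_fin; rewrite inner_sqint. Qed.

End L2.

(** * Completeness of L^2 *)

Section Completeness.
Context {R : realType}.
Local Notation mu := (@lebesgue_measure R).
Local Notation mR := (measurableTypeR R).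
Implicit Types (f g : R -> R[i]).

Lemma ae_mono (P Q : R -> Prop) : (forall x, P x -> Q x) ->
  {ae mu, forall x, P x} -> {ae mu, forall x, Q x}.
Proof.
move=> PQ [A [mA A0 hA]]; exists A; split => // x nQ; apply: hA => Px.
exact/nQ/PQ.
Qed.

Lemma ae_and (P Q : R -> Prop) :
  {ae mu, forall x, P x} -> {ae mu, forall x, Q x} -> {ae mu, forall x, P x /\ Q x}.
Proof.
move=> hP hQ; have := negligibleU hP hQ; apply: negligibleS => x /= nPQ.
by apply: contrapT => /not_orP[/contrapT Px /contrapT Qx]; exact: nPQ.
Qed.

Lemma limn_einf_le (u : (\bar R)^nat) (M : \bar R) :
  (forall n, (u n <= M)%E) -> (limn_einf u <= M)%E.
Proof.
move=> uM; rewrite limn_einf_lim; apply: lime_le; first exact: is_cvg_einfs.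
by apply: nearW => n; apply: le_trans (uM n); apply: ereal_inf_lbound; exists n => /=.
Qed.

Lemma measurable_limn_einf (u : (mR -> \bar R)^nat) :
  (forall n, measurable_fun [set: mR] (u n)) ->
  measurable_fun [set: mR] (fun x => limn_einf (u ^~ x)).
Proof.
move=> mu_; rewrite (_ : (fun x => _) = (fun x => (- limn_esup (fun n => - u n x))%E)).
  apply: measurableT_comp => //; apply: measurable_fun_limn_esup => n.
  exact: measurableT_comp.
apply/funext => x; rewrite -limn_einfN; congr limn_einf.
by apply/funext => n /=; rewrite oppeK.
Qed.

Lemma cvg_sqr_normc (z : nat -> R[i]) (l : R[i]) :
  normc (z n) @[n --> \oo] --> normc l ->
  ((normc (z n) ^+ 2)%:E @[n --> \oo] --> (normc l ^+ 2)%:E)%E.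
Proof. by move=> zl; apply: cvg_EFin; [exact: nearW|rewrite !expr2; exact: cvgM]. Qed.

(** Fatou's lemma; only the absolute values are required to converge. *)
Lemma fatou_sqint (h : nat -> R -> R[i]) g (M : \bar R) :
  (forall k, cmeas (h k)) -> cmeas g ->
  {ae mu, forall x, normc (h k x) @[k --> \oo] --> normc (g x)} ->
  (forall k, (sqint (h k) <= M)%E) -> (sqint g <= M)%E.
Proof.
move=> mh mg hg hM.
have mh2 k : measurable_fun [set: mR] (fun x : mR => (normc (h k x) ^+ 2)%:E).
  by apply/measurable_EFinP; exact: measurable_sqr_normc.
have -> : sqint g = (\int[mu]_x limn_einf (fun k => (normc (h k x) ^+ 2)%:E))%E.
  apply: ae_eq_integral => //.
  - by apply/measurable_EFinP; exact: measurable_sqr_normc.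
  - exact: measurable_limn_einf.
  - apply: ae_mono hg => x hx _; apply/esym.
    by apply: (cvg_limn_einf_sup _).1; exact: cvg_sqr_normc.
apply: (le_trans (fatou _ _ _ _)) => //.
- by move=> n x _; rewrite lee_fin sqr_ge0.
- exact: limn_einf_le.
Qed.

Lemma cvg_geometric_increments (a : nat -> R) (M : R) :
  (forall k, `|a k.+1 - a k| <= M * 2^-1 ^+ k) -> cvgn a.
Proof.
move=> aM; have M0 : 0 <= M by have := aM 0%N; rewrite expr0 mulr1; apply: le_trans.
have cs : cvgn (series (telescope a)).
  apply: normed_cvg; apply: (@series_le_cvg _ _ (geometric M 2^-1)) => //.
  - by move=> n /=.
  - by move=> n; rewrite /geometric /= mulr_ge0// exprn_ge0.
  - by apply: is_cvg_geometric_series; rewrite ger0_norm// invf_lt1// ltr1n.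
rewrite (_ : a = (fun n => a 0%N + series (telescope a) n)).
  by apply: is_cvgD => //; exact: is_cvg_cst.
by apply/funext => n; exact: eq_sum_telescope.
Qed.

Lemma normc_cvg (z : nat -> R[i]) (l : R[i]) :
  Re (z n) @[n --> \oo] --> Re l -> Im (z n) @[n --> \oo] --> Im l ->
  normc (z n) @[n --> \oo] --> normc l.
Proof.
move=> hr hi.
have e w : normc w = Num.sqrt (Re w ^+ 2 + Im w ^+ 2) :> R by case: w.
under eq_fun do rewrite e; rewrite e.
apply: (@cvg_comp _ _ _ _ (@Num.sqrt R) _ (nbhs (Re l ^+ 2 + Im l ^+ 2))).
  by rewrite !expr2; apply: cvgD; apply: cvgM.
exact: sqrt_continuous.
Qed.

(** Riesz-Fischer: along a subsequence, sum_k 4^k |u_(k+1) - u_k|^2 is integrable,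
so that almost everywhere the increments decrease geometrically and the
subsequence converges; Fatou's lemma turns the Cauchy property into convergence
in L^2 to the pointwise limit. *)
Lemma L2_complete (u : nat -> R -> R[i]) :
  (forall n, in_Lp 2%:E (u n)) ->
  (forall e : R, 0 < e -> exists N, forall m n, (N <= m)%N -> (N <= n)%N ->
     (sqint (u m \- u n)%R <= e%:E)%E) ->
  exists2 g, in_Lp 2%:E g & forall e : R, 0 < e -> exists N, forall n, (N <= n)%N ->
     (sqint (u n \- g)%R <= e%:E)%E.
Proof.
move=> Lu uC.
have mu_ n : cmeas (u n) by exact: ((in_Lp2P _).1 (Lu n)).1.
pose w (k : nat) : R := 4 ^+ k.
have w0 k : 0 < w k by rewrite exprn_gt0.
have /choice[N hN] (k : nat) : exists N, forall m n, (N <= m)%N -> (N <= n)%N ->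
    (sqint (u m \- u n)%R <= ((w k)^-1 * (1 / (2 ^ k.+1)%:R))%:E)%E.
  by apply: uC; rewrite mulr_gt0 ?invr_gt0// divr_gt0// ltr0n expn_gt0.
pose phi k := (\sum_(j < k.+1) (N j).+1)%N.
have phiN k : (N k <= phi k)%N by rewrite /phi big_ord_recr/= (leq_trans (leqnSn _))// leq_addl.
have phiS k : (phi k <= phi k.+1)%N by rewrite /phi [leqRHS]big_ord_recr/= leq_addr.
have phi_ge k : (k <= phi k)%N.
  elim: k => [//|k IH]; rewrite /phi big_ord_recr/= -/(phi k) -addn1.
  by rewrite leq_add.
pose d k := u (phi k.+1) \- u (phi k).
have mdk k : cmeas (d k) by exact: cmeasB.
pose F x := (\sum_(0 <= k <oo) (w k * normc (d k x) ^+ 2)%:E)%E.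
have mwd k : measurable_fun [set: mR] (fun x : mR => (w k * normc (d k x) ^+ 2)%:E).
  apply/measurable_EFinP; apply: measurable_funM; first exact: measurable_cst.
  exact: measurable_sqr_normc.
have wd0 k x : (0 <= (w k * normc (d k x) ^+ 2)%:E)%E.
  by rewrite lee_fin mulr_ge0 ?sqr_ge0// ltW.
have F0 x : (0 <= F x)%E by apply: nneseries_ge0 => k _ _.
have mF : measurable_fun [set: mR] F.
  by apply: ge0_emeasurable_sum => // k x _ _.
have iF : (\int[mu]_x F x < +oo)%E.
  rewrite /F integral_nneseries//.
  apply: (@le_lt_trans _ _ 1%:E); last exact: ltry.
  apply: (le_trans _ (@epsilon_trick0 R 1 xpredT ler01)).
  apply: lee_nneseries; first by move=> i _ _; exact: integral_ge0.
  move=> k _; under eq_integral do rewrite EFinM.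
  rewrite ge0_integralZl//; last 3 first.
  - by apply/measurable_EFinP; exact: measurable_sqr_normc.
  - by move=> x _; rewrite lee_fin sqr_ge0.
  - by rewrite lee_fin ltW.
  rewrite -lee_pdivlMl// -EFinM; apply: hN; last exact: phiN.
  exact: (leq_trans (phiN k) (phiS k)).
have FN : {ae mu, forall x, F x \is a fin_num}.
  have : mu.-integrable [set: mR] F.
    apply/integrableP; split => //.
    by under eq_integral do rewrite gee0_abs//.
  by move=> /(integrable_ae measurableT); apply: ae_mono => x; exact.
have [A [mA A0 hA]] := FN.
(* a term of a convergent series of nonnegative terms is bounded by the sum *)
have inc x : ~ A x -> exists M, forall k, normc (d k x) <= M * 2^-1 ^+ k.
  move=> nAx; have Ff : F x \is a fin_num by apply: contrapT => h; exact/nAx/hA.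
  exists (Num.sqrt (fine (F x))) => k.
  rewrite -(@ler_pXn2r _ 2) ?nnegrE ?normc_ge0 ?mulr_ge0 ?sqrtr_ge0 ?exprn_ge0//.
  rewrite exprMn sqr_sqrtr ?fine_ge0// -exprM mulnC exprM.
  have -> : (2^-1 ^+ 2) ^+ k = (w k)^-1 by rewrite /w -exprVn; congr (_ ^+ _); field.
  rewrite ler_pdivlMr// mulrC -lee_fin fineK//.
  apply: (@le_trans _ _ (\sum_(0 <= j < k.+1) (w j * normc (d j x) ^+ 2)%:E)%E).
    by rewrite big_nat_recr//= leeDr// sume_ge0.
  exact: nneseries_lim_ge.
have cvRe x : ~ A x -> cvgn (fun k => Re (u (phi k) x)).
  move=> /inc[M hM]; apply: (@cvg_geometric_increments _ M) => k.
  apply: le_trans (hM k); rewrite -ReN -ReD; exact: normc_le_Re.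
have cvIm x : ~ A x -> cvgn (fun k => Im (u (phi k) x)).
  move=> /inc[M hM]; apply: (@cvg_geometric_increments _ M) => k.
  apply: le_trans (hM k); rewrite -ImN -ImD; exact: normc_le_Im.
have mI : measurable_fun [set: mR] (\1_(~` A) : mR -> R).
  by apply: measurable_indic; exact: measurableC.
(* cutting off the null set A makes the sequence converge everywhere, so that
   the limit is measurable *)
pose gr x := lim (Re (u (phi k) x) * \1_(~` A) x @[k --> \oo]).
pose gi x := lim (Im (u (phi k) x) * \1_(~` A) x @[k --> \oo]).
have cr x : Re (u (phi k) x) * \1_(~` A) x @[k --> \oo] --> gr x.
  suff : cvgn (fun k => Re (u (phi k) x) * \1_(~` A) x) by [].
  have [Ax|nAx] := pselect (A x).
    rewrite indicE memNset; last by move=> /(_ Ax).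
    by under eq_fun do rewrite mulr0; exact: is_cvg_cst.
  by rewrite indicE mem_set//; under eq_fun do rewrite mulr1; exact: cvRe.
have ci x : Im (u (phi k) x) * \1_(~` A) x @[k --> \oo] --> gi x.
  suff : cvgn (fun k => Im (u (phi k) x) * \1_(~` A) x) by [].
  have [Ax|nAx] := pselect (A x).
    rewrite indicE memNset; last by move=> /(_ Ax).
    by under eq_fun do rewrite mulr0; exact: is_cvg_cst.
  by rewrite indicE mem_set//; under eq_fun do rewrite mulr1; exact: cvIm.
pose g x := gr x +i* gi x.
have mg : cmeas g.
  split.
    apply: (@measurable_fun_cvg _ _ _ _ (fun k x => Re (u (phi k) x) * \1_(~` A) x)) => //.
    by move=> k; apply: measurable_funM => //; exact: (mu_ _).1.
  apply: (@measurable_fun_cvg _ _ _ _ (fun k x => Im (u (phi k) x) * \1_(~` A) x)) => //.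
  by move=> k; apply: measurable_funM => //; exact: (mu_ _).2.
have ug (e : R) : 0 < e -> exists N, forall n, (N <= n)%N -> (sqint (u n \- g)%R <= e%:E)%E.
  move=> e0; have [K hK] := uC e e0; exists K => n Kn.
  apply: (@fatou_sqint (fun k => u n \- u (phi (k + K)%N))).
  - by move=> k; exact: cmeasB.
  - exact: cmeasB.
  - exists A; split => // x /= h; apply: contrapT => nAx; apply: h.
    have i1 : \1_(~` A) x = 1 :> R by rewrite indicE mem_set.
    apply: normc_cvg; rewrite ?ReD ?ImD ?ReN ?ImN.
      under eq_fun do rewrite ReD ReN; apply: cvgB; first exact: cvg_cst.
      have := cr x; rewrite i1; under eq_fun do rewrite mulr1.
      by rewrite -(cvg_shiftn K).
    under eq_fun do rewrite ImD ImN; apply: cvgB; first exact: cvg_cst.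
    have := ci x; rewrite i1; under eq_fun do rewrite mulr1.
    by rewrite -(cvg_shiftn K).
  - move=> k; apply: hK => //; apply: leq_trans (phi_ge _); exact: leq_addl.
have [N1 h1] := ug 1 ltr01.
exists g => //; rewrite (_ : g = u N1 \- (u N1 \- g)).
  have Lug : in_Lp 2%:E (u N1 \- g).
    apply/in_Lp2P; split; first exact: cmeasB.
    by apply: (le_lt_trans (h1 N1 (leqnn _))); rewrite ltry.
  apply: L2D => //; have := L2Z (-1) Lug.
  by congr in_Lp; apply/funext => x; rewrite mulN1r.
by apply/funext => x /=; rewrite opprB addrC subrK.
Qed.

End Completeness.

(** * The Hilbert space of square integrable functions *)

Section L2Space.
Context {R : realType}.
Local Notation mu := (@lebesgue_measure R).
Local Notation mR := (measurableTypeR R).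
Implicit Types (f g : R -> R[i]).

Definition L2pred : {pred R -> R[i]} := fun f => `[< in_Lp 2%:E f >].

Lemma L2predP f : reflect (in_Lp 2%:E f) (f \in L2pred).
Proof. exact: asboolP. Qed.

Lemma L2_0 : in_Lp 2%:E (fun _ : R => 0 : R[i]).
Proof.
apply/in_Lp2P; split; first exact: cmeas_cst.
rewrite /sqint; under eq_integral do rewrite ComplexField.Normc.normc0 expr0n.
by rewrite integral0 ltry.
Qed.

Lemma L2pred_submod : submod_closed L2pred.
Proof.
split; first exact/L2predP/L2_0.
move=> a f g /L2predP Lf /L2predP Lg; apply/L2predP.
exact: L2D (L2Z a Lf) Lg.
Qed.

HB.instance Definition _ := GRing.isSubmodClosed.Build R[i] (R -> R[i]) L2pred L2pred_submod.

(** Functions, not classes: point values and translations remain available, and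
equality almost everywhere appears as distance 0. *)
Record L2 := L2Sub { L2val :> R -> R[i]; _ : L2val \in L2pred }.
HB.instance Definition _ := [isSub for L2val].
HB.instance Definition _ := [Choice of L2 by <:].
HB.instance Definition _ := [SubChoice_isSubLmodule of L2 by <:].

End L2Space.
Arguments L2 R : clear implicits.

Section L2Hilbert.
Context {R : realType}.
Local Notation mu := (@lebesgue_measure R).
Local Notation mR := (measurableTypeR R).
Implicit Types (f g : R -> R[i]) (x y z : L2 R).

Lemma L2P x : in_Lp 2%:E x. Proof. by case: x => f /= /L2predP. Qed.

Definition mkL2 f (Lf : in_Lp 2%:E f) : L2 R := L2Sub (introT (L2predP f) Lf).

Lemma L2addE x y : (x + y : L2 R) = (fun t => x t + y t) :> (R -> R[i]).
Proof. by []. Qed.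
Lemma L2oppE x : (- x : L2 R) = (fun t => - x t) :> (R -> R[i]).
Proof. by []. Qed.
Lemma L2sumE (I : Type) (r : seq I) (F : I -> L2 R) :
  (\sum_(i <- r) F i : L2 R) = (fun t => \sum_(i <- r) F i t) :> (R -> R[i]).
Proof.
elim: r => [|i r IH]; first by rewrite big_nil; apply/funext => t; rewrite big_nil.
by rewrite big_cons L2addE IH; apply/funext => t; rewrite big_cons.
Qed.

Definition L2ip x y : R[i] := inner x y.

Lemma L2ipDZl a x y z : L2ip (a *: x + y) z = a * L2ip x z + L2ip y z.
Proof.
rewrite /L2ip /inner -cintegralZ -?cintegralD.
- by congr cintegral; apply/funext => t; rewrite /= mulrDl mulrA.
- by apply: cintegrableZ; apply: L2_inner; exact: L2P.
- by apply: L2_inner; exact: L2P.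
- by apply: L2_inner; exact: L2P.
Qed.

Lemma L2ipC x y : L2ip y x = (L2ip x y)^*.
Proof.
rewrite /L2ip /inner -cintegralJ; last by apply: L2_inner; exact: L2P.
congr cintegral; apply/funext => t.
by apply: complex_ext; rewrite !reimE; ring.
Qed.

Lemma L2ip_sqint x : (Re (L2ip x x))%:E = sqint x.
Proof. by rewrite /L2ip inner_sqint//; exact: L2P. Qed.

Lemma L2ip_ge0 x : 0 <= Re (L2ip x x).
Proof. by rewrite -lee_fin L2ip_sqint sqint_ge0. Qed.

Lemma L2ip_complete (u : nat -> L2 R) :
  (forall e : R, 0 < e -> exists N, forall m n, (N <= m)%N -> (N <= n)%N ->
    Num.sqrt (Re (L2ip (u m - u n) (u m - u n))) < e) ->
  exists l, forall e : R, 0 < e -> exists N, forall n, (N <= n)%N ->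
    Num.sqrt (Re (L2ip (u n - l) (u n - l))) < e.
Proof.
move=> uC; have [|e e0|g Lg hg] := @L2_complete R u.
- by move=> n; exact: L2P.
- have [|N hN] := uC (Num.sqrt e); first by rewrite sqrtr_gt0.
  exists N => m n Nm Nn; have := hN m n Nm Nn; rewrite ltr_sqrt// => /ltW.
  by rewrite -lee_fin L2ip_sqint.
- exists (mkL2 Lg) => e e0; have [|N hN] := hg (e ^+ 2 / 2); first by rewrite divr_gt0// exprn_gt0.
  exists N => n Nn; have := hN n Nn; rewrite -[X in (X <= _)%E](L2ip_sqint (u n - mkL2 Lg)) lee_fin => h.
  rewrite -[ltRHS](ger0_norm (ltW e0)) -sqrtr_sqr ltr_sqrt ?exprn_gt0//.
  apply: (le_lt_trans h); rewrite ltr_pdivrMr// mulr_natr mulr2n ltrDl exprn_gt0//.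
Qed.

Definition L2H : hilbertSpace (L2 R) :=
  HilbertSpace L2ipDZl L2ipC L2ip_ge0 L2ip_complete.

Lemma norm2_nrm x : norm2 x = (nrm L2H x)%:E.
Proof. by rewrite norm2_inner//; exact: L2P. Qed.

Lemma sqint_nrm x : sqint x = (nrm L2H x ^+ 2)%:E.
Proof. by rewrite sqr_nrm -L2ip_sqint. Qed.

Lemma sqint_eq0 f : cmeas f -> sqint f = 0%E -> {ae mu, forall t, f t = 0}.
Proof.
move=> mf f0.
have m : measurable_fun [set: mR] (fun t : mR => (normc (f t) ^+ 2)%:E).
  by apply/measurable_EFinP; exact: measurable_sqr_normc.
have : (\int[mu]_t `|(normc (f t) ^+ 2)%:E| = 0)%E.
  by rewrite -f0; apply: eq_integral => t _; rewrite gee0_abs// lee_fin sqr_ge0.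
move=> /(ae_eq_integral_abs mu measurableT m).1; apply: ae_mono => t /(_ I) [] /eqP.
by rewrite sqrf_eq0 => /eqP/ComplexField.Normc.eq0_normc.
Qed.

Lemma nrm_eq0_ae x : nrm L2H x = 0 -> {ae mu, forall t, x t = 0}.
Proof.
move=> x0; apply: sqint_eq0; first exact: ((in_Lp2P _).1 (L2P x)).1.
by rewrite sqint_nrm x0 expr0n.
Qed.

Lemma sqint_ae f g : cmeas f -> cmeas g -> {ae mu, forall t, f t = g t} ->
  sqint f = sqint g.
Proof.
move=> mf mg fg; apply: ae_eq_integral => //.
- by apply/measurable_EFinP; exact: measurable_sqr_normc.
- by apply/measurable_EFinP; exact: measurable_sqr_normc.
- by apply: ae_mono fg => t -> _.
Qed.

Lemma nrm_ae0 x : {ae mu, forall t, x t = 0} -> nrm L2H x = 0.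
Proof.
move=> x0; have : sqint x = sqint (fun=> 0 : R[i]).
  by apply: sqint_ae x0; [exact: ((in_Lp2P _).1 (L2P x)).1|exact: cmeas_cst].
rewrite sqint_nrm /sqint; under eq_integral do rewrite ComplexField.Normc.normc0 expr0n.
by rewrite integral0 => -[] /eqP; rewrite sqrf_eq0 => /eqP.
Qed.

Lemma L2_ae f x : cmeas f -> {ae mu, forall t, f t = x t} -> in_Lp 2%:E f.
Proof.
move=> mf fx; apply/in_Lp2P; split => //.
rewrite (sqint_ae mf _ fx); last exact: ((in_Lp2P _).1 (L2P x)).1.
by rewrite sqint_nrm ltry.
Qed.

End L2Hilbert.

(** * Translations of the line *)

Section Translation.
Context {R : realType}.
Local Notation mu := (@lebesgue_measure R).
Local Notation mR := (measurableTypeR R).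
Implicit Types (f g : R -> R[i]) (a : R).

Lemma measurable_shift a : measurable_fun [set: mR] (fun x : mR => x + a : mR).
Proof. by apply: measurable_funD; [exact: measurable_id|exact: measurable_cst]. Qed.

(** Both measures agree on intervals. *)
Lemma lebesgue_measure_shift a (A : set mR) : measurable A ->
  pushforward mu (fun x : mR => x + a : mR) A = mu A.
Proof.
have mf := measurable_shift a.
move=> mA; apply/esym/lebesgue_measure_unique => //= _ [[b c]] _ <-.
rewrite /pushforward /=.
rewrite (_ : _ @^-1` _ = `]b - a, c - a]%classic); last first.
  by apply/seteqP; split => x /=; rewrite !in_itv/= ltrBlDr lerBrDr.
rewrite !lebesgue_measure_itv/= !lte_fin ltrD2r; case: ifP => // _.
by rewrite -!EFinB; congr (_%:E); ring.
Qed.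

Lemma ge0_integral_shift a (f : mR -> \bar R) : measurable_fun [set: mR] f ->
  (forall x, (0 <= f x)%E) -> (\int[mu]_x f (x + a)%R = \int[mu]_x f x)%E.
Proof.
move=> mf f0; have ms := measurable_shift a.
transitivity (\int[pushforward mu (fun x : mR => (x + a)%R : mR)]_x f x)%E.
  by rewrite ge0_integral_pushforward//= preimage_setT.
by apply: eq_measure_integral => A mA _; exact: lebesgue_measure_shift.
Qed.

Lemma cmeas_shift a f : cmeas f -> cmeas (fun x => f (x + a)).
Proof.
by move=> [m1 m2]; split;
  [apply: (@measurableT_comp _ _ _ _ _ _ (fun x : mR => Re (f x)))|
   apply: (@measurableT_comp _ _ _ _ _ _ (fun x : mR => Im (f x)))] => //;
  exact: measurable_shift.
Qed.

Lemma sqint_shift a f : cmeas f -> sqint (fun x => f (x + a)) = sqint f.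
Proof.
move=> mf; apply: (@ge0_integral_shift a (fun x : mR => (normc (f x) ^+ 2)%:E)).
  by apply/measurable_EFinP; exact: measurable_sqr_normc.
by move=> x; rewrite lee_fin sqr_ge0.
Qed.

Lemma integrable_shift a (u : mR -> R) : mu.-integrable [set: mR] (EFin \o u) ->
  mu.-integrable [set: mR] (EFin \o (fun x => u (x + a))).
Proof.
move=> /integrableP[mu_ iu]; apply/integrableP; split.
  by apply: measurableT_comp mu_ _; exact: measurable_shift.
rewrite (ge0_integral_shift a (f := fun x => `|(EFin \o u) x|%E))//.
exact: measurableT_comp.
Qed.

Lemma Rintegral_shift a (u : mR -> R) : mu.-integrable [set: mR] (EFin \o u) ->
  \int[mu]_x u (x + a) = \int[mu]_x u x.
Proof.
move=> iu; congr fine; have ms := measurable_shift a.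
transitivity (\int[pushforward mu (fun x : mR => (x + a)%R : mR)]_x (u x)%:E)%E.
  have mEu : measurable_fun [set: mR] (EFin \o u) by case/integrableP: iu.
  have := @integral_pushforward _ _ _ _ R _ ms mu setT (EFin \o u) mEu.
  rewrite preimage_setT => h; apply/esym; apply: h => //.
  exact: integrable_shift.
by apply: eq_measure_integral => A mA _; exact: lebesgue_measure_shift.
Qed.

Lemma cintegrable_shift a f : cintegrable f -> cintegrable (fun x => f (x + a)).
Proof.
by move=> [i1 i2]; split; [exact: (integrable_shift a i1)|exact: (integrable_shift a i2)].
Qed.

Lemma cintegral_shift a f : cintegrable f -> cintegral (fun x => f (x + a)) = cintegral f.
Proof.
move=> [i1 i2]; apply: complex_ext => /=.
  exact: (Rintegral_shift a i1).
exact: (Rintegral_shift a i2).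
Qed.

Lemma ae_shift a (P : R -> Prop) :
  {ae mu, forall x, P x} -> {ae mu, forall x, P (x + a)}.
Proof.
move=> [A [mA A0 hA]]; exists ((fun x : mR => x + a) @^-1` A); split.
- by rewrite -[X in measurable X]setTI; apply: measurable_shift.
- by rewrite -A0; exact: lebesgue_measure_shift.
- by move=> x /= nP; exact: hA.
Qed.

Lemma ae_all_int (P : int -> R -> Prop) :
  (forall k, {ae mu, forall x, P k x}) -> {ae mu, forall x, forall k, P k x}.
Proof.
move=> hP; pose d n : int := odflt 0 (choice.unpickle n).
have dK k : d (choice.pickle k) = k by rewrite /d choice.pickleK.
have := negligible_bigcup (mu := mu) (F := fun n => ~` [set x | P (d n) x]) (fun n => hP (d n)).
apply: negligibleS => x /= /existsNP[k nPk]; exists (choice.pickle k) => //=.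
by rewrite dK.
Qed.

Lemma in_Lp2_translates f k : in_Lp 2%:E f -> in_Lp 2%:E (translates f k).
Proof.
move=> /in_Lp2P[mf h]; apply/in_Lp2P; split; first exact: cmeas_shift.
by rewrite sqint_shift.
Qed.

Lemma inner_translates f g k : in_Lp 2%:E f -> in_Lp 2%:E g ->
  inner (translates f k) (translates g k) = inner f g.
Proof.
move=> Lf Lg.
exact: (cintegral_shift (- k%:~R) (L2_inner Lf Lg)).
Qed.

Lemma translates0 f : translates f 0 = f.
Proof. by apply/funext => x; rewrite /translates subr0. Qed.

Lemma translatesD f k l : translates (translates f k) l = translates f (k + l).
Proof. by apply/funext => x; rewrite /translates intrD opprD addrA addrAC. Qed.

End Translation.

(** * Sums over the integers and continuous complex functions *)

Section SumsAndContinuity.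
Context {R : realType}.
Local Notation mu := (@lebesgue_measure R).
Local Notation mR := (measurableTypeR R).

Lemma esum_ub (I : choiceType) (a : I -> R) (J : {fset I}) : (forall i, 0 <= a i) ->
  ((\sum_(k <- J) a k)%:E <= \esum_(k in [set: I]) (a k)%:E)%E.
Proof.
move=> a0; apply: esum_ge; exists [set` J]; first by split.
by rewrite fsbig_finite//= set_fsetK sumEFin.
Qed.

Lemma esum_lub (I : choiceType) (a : I -> R) (M : \bar R) :
  (forall J : {fset I}, ((\sum_(k <- J) a k)%:E <= M)%E) ->
  (\esum_(k in [set: I]) (a k)%:E <= M)%E.
Proof.
move=> aM; apply: ge_ereal_sup => _ [X [finX _] <-].
by rewrite fsbig_finite//= sumEFin.
Qed.

(** The indices of partial_sum as a finite set, for comparison with usum. *)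
Definition window (mn : nat * nat) : {fset int} :=
  [fset k in [seq j%:Z - mn.1%:Z | j <- iota 0 (mn.1 + mn.2).+1]]%fset.

Lemma mem_window k mn :
  (k \in window mn) = (k \in [seq j%:Z - mn.1%:Z | j <- iota 0 (mn.1 + mn.2).+1]).
Proof. by rewrite /window in_fset. Qed.

Lemma window_sum (M : nmodType) (F : int -> M) mn :
  \sum_(j < (mn.1 + mn.2).+1) F (j%:Z - mn.1%:Z) = \sum_(k <- window mn) F k.
Proof.
rewrite -(big_mkord xpredT (fun j : nat => F (j%:Z - mn.1%:Z))) /index_iota subn0.
rewrite -(big_map (fun j : nat => j%:Z - mn.1%:Z) xpredT F).
apply: perm_big; apply: uniq_perm.
- by rewrite map_inj_uniq ?iota_uniq// => i j; lia.
- exact: fset_uniq.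
- by move=> k; rewrite mem_window.
Qed.

Lemma sub_window (J : {fset int}) : exists N, forall m n, (N <= m)%N -> (N <= n)%N ->
  (J `<=` window (m, n))%fset.
Proof.
exists (\sum_(k <- J) absz k)%N => m n Jm Jn; apply/fsubsetP => k kJ.
have kN : (absz k <= \sum_(k <- J) absz k)%N by rewrite (big_fsetD1 k)//= leq_addr.
rewrite mem_window; apply/mapP; exists (absz (k + m%:Z)); last by rewrite /fst; lia.
by rewrite mem_iota /fst /snd; lia.
Qed.

Lemma near_oo2 (P : nat * nat -> Prop) :
  (exists N, forall m n, (N <= m)%N -> (N <= n)%N -> P (m, n)) ->
  \forall mn \near (\oo, \oo), P mn.
Proof.
move=> [N hN]; exists ([set n | (N <= n)%N], [set n | (N <= n)%N]) => /=.
  by split; exists N.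
by move=> [m n] /= [? ?]; exact: hN.
Qed.

Lemma oo2_near (P : nat * nat -> Prop) :
  (\forall mn \near (\oo, \oo), P mn) ->
  exists N, forall m n, (N <= m)%N -> (N <= n)%N -> P (m, n).
Proof.
move=> [[A B] /= [[N1 _ h1] [N2 _ h2]] h]; exists (maxn N1 N2) => m n.
rewrite !geq_max => /andP[m1 m2] /andP[n1 n2]; apply: h; split; [exact: h1|exact: h2].
Qed.

Lemma normE_C (z : R[i]^o) : `|z| = (normc z)%:C.
Proof. by case: z. Qed.

Lemma ltC_real (x : R) (e : R[i]) : 0 < e -> (x%:C < e) = (x < Re e).
Proof.
by case: e => a b; rewrite !ltcE /= => /andP[/eqP b0 _]; rewrite b0 eqxx.
Qed.

(** The balls of the normed module R[i]^o have complex radii; here the radius is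
real. *)
Lemma ccvgP (T : Type) (F : set_system T) {FF : Filter F} (z : T -> R[i]^o) (l : R[i]^o) :
  z @ F --> l <-> forall e : R, 0 < e -> \forall t \near F, normc (l - z t) < e.
Proof.
split.
  move=> /cvgrPdist_lt h e e0; have /h : 0 < e%:C :> R[i] by rewrite ltcR.
  by apply: filterS => t; rewrite normE_C ltcR.
move=> h; apply/cvgrPdist_lt => e e0.
have e1 : 0 < Re e by move: e0; rewrite ltcE => /andP[].
by apply: filterS (h _ e1) => t; rewrite normE_C ltC_real.
Qed.

Lemma ccontP (g : R -> R[i]^o) : continuous g <->
  forall x (e : R), 0 < e -> \forall y \near x, normc (g x - g y) < e.
Proof.
by split => h x; [exact: ((@ccvgP _ (nbhs x) _ g (g x)).1 (h x))|
                  exact: ((@ccvgP _ (nbhs x) _ g (g x)).2 (h x))].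
Qed.

Lemma ccont_normc (g : R -> R[i]^o) : continuous g -> continuous (fun x => normc (g x)).
Proof.
move=> /ccontP h x; apply/cvgrPdist_lt => e e0; apply: filterS (h x e e0) => y.
apply: le_lt_trans; rewrite ler_norml; apply/andP; split.
  rewrite lerNl opprB lerBlDr normcB; apply: le_trans (ler_normcD _ _); by rewrite subrK.
by rewrite lerBlDr; apply: le_trans (ler_normcD _ _); rewrite subrK.
Qed.

Lemma ccont_Re (g : R -> R[i]^o) : continuous g -> continuous (fun x => Re (g x) : R).
Proof.
move=> /ccontP h x; apply/cvgrPdist_lt => e e0; apply: filterS (h x e e0) => y.
by apply: le_lt_trans; rewrite -ReN -ReD normc_le_Re.
Qed.

Lemma ccont_Im (g : R -> R[i]^o) : continuous g -> continuous (fun x => Im (g x) : R).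
Proof.
move=> /ccontP h x; apply/cvgrPdist_lt => e e0; apply: filterS (h x e e0) => y.
by apply: le_lt_trans; rewrite -ImN -ImD normc_le_Im.
Qed.

Lemma ccont_cmeas (g : R -> R[i]^o) : continuous g -> cmeas g.
Proof.
by move=> h; split; apply: continuous_measurable_fun; [exact: ccont_Re|exact: ccont_Im].
Qed.

Lemma ccont_shift (g : R -> R[i]^o) a : continuous g -> continuous (fun x => g (x + a) : R[i]^o).
Proof.
move=> h x; apply: (@continuous_comp _ _ _ (fun x => x + a) g); last exact: h.
by apply: cvgD; [exact: cvg_id|exact: cvg_cst].
Qed.

Lemma ccontB (g h : R -> R[i]^o) : continuous g -> continuous h ->
  continuous (fun x => g x - h x : R[i]^o).
Proof. by move=> cg ch x; apply: cvgB; [exact: cg|exact: ch]. Qed.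

Lemma ccont_partial_sum c (s : R -> R[i]^o) mn : continuous s ->
  continuous (partial_sum c s mn : R -> R[i]^o).
Proof.
move=> cs; pose F k : R -> R[i]^o := fun x => c k * translates s k x.
have cF k : continuous (F k).
  move=> x; apply: (@cvgM _ _ _ _ (cst _) _ (c k : R[i]) _); first exact: cvg_cst.
  exact: (@ccont_shift s (- k%:~R) cs x).
have cS (r : seq int) : continuous (fun x => \sum_(k <- r) F k x : R[i]^o).
  elim: r => [|k r IH].
    rewrite (_ : (fun _ => _) = cst 0); first by move=> x; exact: cvg_cst.
    by apply/funext => x; rewrite big_nil.
  rewrite (_ : (fun _ => _) = (fun x => F k x + \sum_(k <- r) F k x)).
    by move=> x; apply: cvgD; [exact: cF|exact: IH].
  by apply/funext => x; rewrite big_cons.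
rewrite (_ : partial_sum c s mn = (fun x => \sum_(k <- window mn) F k x)); first exact: cS.
by apply/funext => x; rewrite -window_sum.
Qed.

(** The set where two continuous functions differ is open, and a nonempty open set
has positive measure. *)
Lemma ccont_ae_eq (g h : R -> R[i]^o) : continuous g -> continuous h ->
  {ae mu, forall x, g x = h x} -> g = h.
Proof.
move=> cg ch [A [mA A0 hA]]; apply/funext => x; apply: contrapT => gh.
have e0 : 0 < normc (g x - h x).
  rewrite lt_neqAle normc_ge0 andbT; apply/eqP => /esym/ComplexField.Normc.eq0_normc/eqP.
  by rewrite subr_eq0 => /eqP.
have /ccontP/(_ x _ e0) /nbhs_ballP[r /= r0 hr] := ccontB cg ch.
have sub : `]x - r, x + r[%classic `<=` A.
  move=> y /=; rewrite in_itv/= => /andP[y1 y2]; apply: hA => gy.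
  have /hr : ball x r y by rewrite /ball/= ltr_distl; apply/andP; split; lra.
  by rewrite /= gy subrr subr0 ltxx.
have : (mu (`]x - r, x + r[%classic)%R <= mu A)%E by apply: le_measure; rewrite ?inE.
rewrite A0 lebesgue_measure_itv/= lte_fin ifT; last by lra.
by rewrite -EFinB lee_fin; apply/negP; rewrite -ltNge; lra.
Qed.

End SumsAndContinuity.

(** * Shift-invariant spaces *)

Section ShiftSpaces.
Context {R : realType}.
Local Notation mu := (@lebesgue_measure R).
Local Notation mR := (measurableTypeR R).
Local Notation nrm := (nrm (@L2H R)).
Local Notation closed_subspace := (closed_subspace (@L2H R)).
Local Notation "''[' x , y ]" := (ip (@L2H R) x y).
Implicit Types (x y z h : L2 R) (f g : R -> R[i]) (k : int).

Lemma L2_ext x y : (x : R -> R[i]) = y -> x = y. Proof. exact: val_inj. Qed.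

Definition transl x k : L2 R := mkL2 (in_Lp2_translates k (L2P x)).

Lemma translE x k : transl x k = translates x k :> (R -> R[i]). Proof. by []. Qed.

Lemma translDZ a x y k : transl (a *: x + y) k = a *: transl x k + transl y k.
Proof. exact: L2_ext. Qed.

Lemma translB x y k : transl (x - y) k = transl x k - transl y k.
Proof. exact: L2_ext. Qed.

Lemma transl0 x : transl x 0 = x.
Proof. by apply: L2_ext; rewrite translE translates0. Qed.

Lemma translD x k l : transl (transl x k) l = transl x (k + l).
Proof. by apply: L2_ext; rewrite !translE translatesD. Qed.

Lemma ip_transl x y k : '[transl x k, transl y k] = '[x, y].
Proof. exact: (inner_translates k (L2P x) (L2P y)). Qed.

Lemma nrm_transl x k : nrm (transl x k) = nrm x.
Proof. by rewrite !nrmE ip_transl. Qed.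

Lemma shift_spaceP x y : shift_space x y <-> closed_span (@L2H R) (transl x) y.
Proof.
have E (J : {fset int}) (c : int -> R[i]) :
    norm2 (fun t => y t - \sum_(k <- J) c k * translates x k t) =
    (nrm (y - \sum_(k <- J) c k *: transl x k))%:E.
  rewrite -norm2_nrm; congr norm2; apply/funext => t.
  by rewrite L2addE L2oppE L2sumE.
split.
  move=> [_ h] e e0; have [J [c hc]] := h e e0.
  by exists J, c; rewrite -lte_fin -E.
move=> h; split; first exact: L2P.
by move=> e e0; have [J [c hc]] := h e e0; exists J, c; rewrite E lte_fin.
Qed.

Lemma shift_space_L2 f g : shift_space f g -> in_Lp 2%:E g.
Proof. by case. Qed.

Lemma shift_space_closed x : closed_subspace (fun y => shift_space x y).
Proof.
rewrite (_ : (fun y : L2 R => _) = closed_span (@L2H R) (transl x)); first exact: closed_span_closed.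
by apply/funext => y; apply/propext/shift_spaceP.
Qed.

Lemma shift_space_gen x k : shift_space x (transl x k).
Proof. by apply/shift_spaceP; exact: closed_span_gen. Qed.

Lemma shift_space_min x (V : set (L2 R)) : closed_subspace V -> (forall k, V (transl x k)) ->
  forall y, shift_space x y -> V y.
Proof. by move=> cV Vx y /shift_spaceP; exact: closed_span_min. Qed.

Lemma shift_space_transl x y k : shift_space x y -> shift_space x (transl y k).
Proof.
move=> Sy.
have cV := isometry_preimage_closed (T := transl^~ k) (shift_space_closed x)
  (fun a x y => translDZ a x y k) (fun x => nrm_transl x k).
apply: (shift_space_min cV _ Sy) => l.
change (shift_space x (transl (transl x l) k)); rewrite translD; exact: shift_space_gen.
Qed.

(** S(y) is the smallest closed subspace that contains the translates of y. *)
Lemma shift_space_sub x y : shift_space x y -> forall z, shift_space y z -> shift_space x z.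
Proof.
move=> Sy; apply: shift_space_min; first exact: shift_space_closed.
by move=> k; exact: shift_space_transl.
Qed.

Lemma closed_subspace_ae (V : set (L2 R)) x y : closed_subspace V ->
  {ae mu, forall t, x t = y t} -> V x -> V y.
Proof.
move=> cV xy Vx; apply: (csub_adh cV) => e e0; exists x => //.
rewrite nrm_ae0//; apply: ae_mono xy => t.
by rewrite L2addE L2oppE => ->; rewrite subrr.
Qed.

Lemma nrm_ae x y : {ae mu, forall t, x t = y t} -> nrm (x - y) = 0.
Proof.
by move=> xy; rewrite nrm_ae0//; apply: ae_mono xy => t; rewrite L2addE L2oppE => ->; rewrite subrr.
Qed.

(** The frame inequality in terms of finite sums: these bound an unconditional sum
from below, and approach it. *)
Lemma frame_boundsP (V : set (R -> R[i])) (u : int -> L2 R) :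
  is_frame V (fun k => u k) -> exists A B : R, [/\ 0 < A, 0 < B,
  bessel (@L2H R) (fun y => V y) u B &
  forall h, V h -> forall e : R, 0 < e -> exists J : {fset int},
    A * nrm h ^+ 2 < \sum_(k <- J) normc '[h, u k] ^+ 2 + e].
Proof.
move=> [_ [A [B [A0 B0 H]]]]; exists A, B; split => //.
- move=> J h Vh; have /andP[_ h2] := H h Vh.
  rewrite -lee_fin; apply: le_trans (le_trans h2 _).
    apply: (@esum_ub _ _ (fun k => normc '[h, u k] ^+ 2)) => k; exact: sqr_ge0.
  by rewrite norm2_nrm -EFin_expe -EFinM.
- move=> h Vh e e0; apply: contrapT => hn; have /andP[h1 _] := H h Vh.
  have : (\esum_(k in [set: int]) (normc (inner h (u k)) ^+ 2)%:E
          <= (A * nrm h ^+ 2 - e)%:E)%E.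
    apply: esum_lub => J; rewrite lee_fin lerBrDr leNgt; apply/negP => hJ.
    by apply: hn; exists J.
  move=> /(le_trans h1); rewrite norm2_nrm -EFin_expe -EFinM lee_fin.
  by rewrite lerBrDr gerDl leNgt e0.
Qed.

Lemma usum_conv (u : int -> L2 R) (c : int -> R[i]) l : usum (@L2H R) u c l ->
  forall e : R, 0 < e -> exists N, forall m n, (N <= m)%N -> (N <= n)%N ->
    nrm (l - \sum_(k <- window (m, n)) c k *: u k) < e.
Proof.
move=> ul e e0; have [J hJ] := ul e e0; have [N hN] := sub_window J.
by exists N => m n Nm Nn; apply: hJ; exact: hN.
Qed.

Lemma partial_sum_window c x mn :
  partial_sum c x mn = (\sum_(k <- window mn) c k *: transl x k : L2 R) :> (R -> R[i]).
Proof.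
rewrite L2sumE; apply/funext => t; rewrite /partial_sum.
exact: (window_sum (fun k => c k * translates x k t)).
Qed.

End ShiftSpaces.

(** * Bounded point evaluations *)

Section Evaluation.
Context {R : realType}.
Local Notation mu := (@lebesgue_measure R).
Local Notation mR := (measurableTypeR R).
Local Notation nrm := (nrm (@L2H R)).
Local Notation closed_subspace := (closed_subspace (@L2H R)).
Local Notation "''[' x , y ]" := (ip (@L2H R) x y).
Implicit Types (h : L2 R) (f : R -> R[i]) (k : int).

Lemma ccvg_unique (z : nat -> R[i]) (l l' : R[i]) :
  (forall e : R, 0 < e -> exists N, forall n, (N <= n)%N -> normc (l - z n) < e) ->
  (forall e : R, 0 < e -> exists N, forall n, (N <= n)%N -> normc (l' - z n) < e) -> l = l'.
Proof.
move=> h h'; apply/eqP; rewrite -subr_eq0; apply/eqP/ComplexField.Normc.eq0_normc/eqP.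
rewrite eq_le normc_ge0 andbT; apply/ler_addgt0Pr => e e0; rewrite add0r.
have e20 : 0 < e / 2 by rewrite divr_gt0.
have [N1 h1] := h _ e20; have [N2 h2] := h' _ e20.
have := h1 (maxn N1 N2) (leq_maxl _ _); have := h2 (maxn N1 N2) (leq_maxr _ _).
have := ler_normcD (l - z (maxn N1 N2)) (z (maxn N1 N2) - l').
rewrite addrA subrK (normcB (z _) l'); lra.
Qed.

Lemma l2_bessel V (u : int -> L2 R) (B : R) h :
  bessel (@L2H R) V u B -> V h -> is_l2 (fun k => '[h, u k]).
Proof.
move=> Bu Vh; apply: (@le_lt_trans _ _ (B * nrm h ^+ 2)%:E); last exact: ltry.
by apply: esum_lub => J; rewrite lee_fin; exact: Bu.
Qed.

(** Fatou's lemma applied to the differences p_n - l, whose pointwise limit is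
g - l. *)
Lemma L2_pointwise_limit (p : nat -> L2 R) l (g : R -> R[i]) : cmeas g ->
  (forall e : R, 0 < e -> exists N, forall n, (N <= n)%N -> nrm (l - p n) < e) ->
  {ae mu, forall t : R, forall e : R, 0 < e -> exists N, forall n, (N <= n)%N -> normc (g t - p n t) < e} ->
  {ae mu, forall t, l t = g t}.
Proof.
move=> mg pl pg.
have ml : cmeas l by exact: ((in_Lp2P _).1 (L2P l)).1.
have mp n : cmeas (p n) by exact: ((in_Lp2P _).1 (L2P (p n))).1.
suff : sqint (g \- l) = 0%E.
  move=> /(sqint_eq0 (cmeasB mg ml)); apply: ae_mono => t /= /eqP.
  by rewrite subr_eq0 => /eqP.
apply/eqP; rewrite eq_le sqint_ge0 andbT; apply/lee_addgt0Pr => e e0; rewrite add0e.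
have [N hN] := pl (Num.sqrt e) (ltac:(by rewrite sqrtr_gt0)).
apply: (@fatou_sqint R (fun n => p (n + N)%N \- l)).
- by move=> n; exact: cmeasB.
- exact: cmeasB.
- apply: ae_mono pg => t pgt; apply/cvgrPdist_lt => d d0.
  have [M hM] := pgt d d0; exists M => // n /= Mn.
  apply: le_lt_trans (hM (n + N)%N _); last exact: leq_trans Mn (leq_addr _ _).
  have -> : g t - p (n + N)%N t = (g t - l t) - (p (n + N)%N t - l t) by rewrite opprB addrA subrK.
  rewrite ler_norml; apply/andP; split.
    rewrite lerNl opprB lerBlDr normcB; apply: le_trans (ler_normcD _ _); by rewrite subrK.
  by rewrite lerBlDr; apply: le_trans (ler_normcD _ _); rewrite subrK.
- move=> n; have := hN (n + N)%N (leq_addl _ _).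
  rewrite nrmB (_ : p (n + N)%N \- l = (p (n + N)%N - l : L2 R))// sqint_nrm lee_fin => h.
  rewrite -[leRHS](sqr_sqrtr (ltW e0)) ler_pXn2r ?nnegrE ?sqrtr_ge0//; exact: ltW.
Qed.

Lemma oo2_diag (z : nat * nat -> R[i]^o) (l : R[i]^o) : z mn @[mn --> (\oo, \oo)] --> l ->
  forall e : R, 0 < e -> exists N, forall n, (N <= n)%N -> normc (l - z (n, n)) < e.
Proof.
move=> /ccvgP h e e0; have [N hN] := oo2_near (h e e0).
by exists N => n Nn; apply: hN.
Qed.

Lemma bounded_of_cvg (z : nat -> R[i]) (l : R[i]) :
  (forall e : R, 0 < e -> exists N, forall n, (N <= n)%N -> normc (l - z n) < e) ->
  exists K, forall n, normc (z n) <= K.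
Proof.
move=> h; have [N hN] := h 1 ltr01.
exists (normc l + 1 + \sum_(j < N) normc (z j)) => n.
have s0 : 0 <= \sum_(j < N) normc (z j) by apply: sumr_ge0 => j _; exact: normc_ge0.
have [nN|Nn] := ltnP n N.
  have : normc (z n) <= \sum_(j < N) normc (z j).
    by rewrite (bigD1 (Ordinal nN))//= lerDl; apply: sumr_ge0 => j _; exact: normc_ge0.
  by have := normc_ge0 l; lra.
have := hN n Nn; have := ler_normcD (z n - l) l; rewrite subrK normcB; lra.
Qed.

Lemma partial_sum_ip (u : int -> L2 R) s (n : nat) h x :
  partial_sum (fun k => '[h, u k]) s (n, n) x =
  \sum_(k <- window (n, n)) '[h, u k] * translates s k x.
Proof. exact: (window_sum (fun k => '[h, u k] * translates s k x)). Qed.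

(** Banach-Steinhaus twice. At a fixed x the partial sums of
sum_k <h, T_k s> s(x - k) are bounded functionals of h that converge for every
h, so their limit G h x is a bounded functional of h. For fixed h the function
G h is continuous, hence bounded on [0, 1], so these functionals are bounded
uniformly in x. By frame_inversion every h in V is the sum of such a series. *)
Lemma eval_on_unit_interval (V : set (L2 R)) (s : L2 R) (A B : R) :
  closed_subspace V -> (forall k, V (transl s k)) -> 0 < A -> 0 < B ->
  bessel (@L2H R) V (transl s) B ->
  (forall h, V h -> forall e : R, 0 < e -> exists J : {fset int},
    A * nrm h ^+ 2 < \sum_(k <- J) normc '[h, transl s k] ^+ 2 + e) ->
  (forall c, is_l2 c -> exists2 g : R -> R[i]^o, continuous g &
    forall x, partial_sum c s mn x @[mn --> (\oo, \oo)] --> g x) ->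
  exists2 C, 0 <= C & forall h (g : R -> R[i]^o), V h -> continuous g ->
    {ae mu, forall t, h t = g t} -> forall x, 0 <= x <= 1 -> normc (g x) <= C * nrm h.
Proof.
move=> cV Vs A0 B0 Bs Ls sums.
have [D D0 hD] := frame_inversion cV Vs A0 B0 Bs Ls.
have /choice[G GP] h : exists g : R -> R[i]^o, V h -> continuous g /\
    forall x, partial_sum (fun k => '[h, transl s k]) s mn x @[mn --> (\oo, \oo)] --> g x.
  have [Vh|nVh] := pselect (V h); last by exists (cst 0).
  by have [g cg hg] := sums _ (l2_bessel Bs Vh); exists g.
have Gdiag h x : V h -> forall e : R, 0 < e -> exists N, forall n, (N <= n)%N ->
    normc (G h x - partial_sum (fun k => '[h, transl s k]) s (n, n) x) < e.
  by move=> Vh; apply: (oo2_diag (z := fun mn => partial_sum (fun k => '[h, transl s k]) s mn x)); exact: (GP h Vh).2.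
pose T (x : R) (n : nat) h := partial_sum (fun k => '[h, transl s k]) s (n, n) x.
have Tlin x n a h h' : T x n (a *: h + h') = a * T x n h + T x n h'.
  rewrite /T !partial_sum_ip mulr_sumr -big_split; apply: eq_bigr => k _.
  by rewrite ipDZl mulrDl -mulrA.
have Tbd x n : exists K, forall h, V h -> normc (T x n h) <= K * nrm h.
  exists (\sum_(k <- window (n, n)) nrm (transl s k) * normc (translates s k x)) => h _.
  rewrite /T partial_sum_ip; apply: (le_trans (normc_sum _ _)).
  rewrite mulr_suml; apply: ler_sum => k _; rewrite normcMl mulrAC.
  by apply: ler_wpM2r; rewrite ?normc_ge0// mulrC; exact: cauchy_schwarz.
have UB1 x : exists2 M, 0 <= M & forall n h, V h -> normc (T x n h) <= M * nrm h.
  have [//| | |M M0 hM] := @uniform_boundedness _ _ (@L2H R) V nat setT (T x) cV.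
  - by move=> n _; exact: Tbd.
  - move=> h Vh; have [K hK] := bounded_of_cvg (Gdiag h x Vh).
    by exists K => n _; exact: hK.
  - by exists M => // n h Vh; exact: hM.
have Gbd x : exists K, forall h, V h -> normc (G h x) <= K * nrm h.
  have [M M0 hM] := UB1 x; exists M => h Vh.
  apply/ler_addgt0Pr => e e0; have [N hN] := Gdiag h x Vh e e0.
  have := hN N (leqnn _); have := hM N h Vh; rewrite /T.
  have := ler_normcD (G h x - T x N h) (T x N h); rewrite subrK /T; lra.
have Glin x a h h' : V h -> V h' -> G (a *: h + h') x = a * G h x + G h' x.
  move=> Vh Vh'; have Vhh' : V (a *: h + h') by apply: (csubDZ cV).
  apply: (ccvg_unique (Gdiag _ x Vhh')) => e e0.
  have na0 : 0 < normc a + 1 by rewrite ltr_wpDl ?normc_ge0.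
  have d0 : 0 < e / (normc a + 1) / 2 by rewrite !divr_gt0.
  have [N1 h1] := Gdiag h x Vh _ d0; have [N2 h2] := Gdiag h' x Vh' (e / 2) (ltac:(by rewrite divr_gt0)).
  exists (maxn N1 N2) => n; rewrite geq_max => /andP[/h1{}h1 /h2{}h2].
  rewrite -/(T x n (a *: h + h')) Tlin.
  have -> : a * G h x + G h' x - (a * T x n h + T x n h') =
      a * (G h x - T x n h) + (G h' x - T x n h') by rewrite mulrBr opprD addrACA.
  apply: (le_lt_trans (ler_normcD _ _)); rewrite normcMl.
  have : normc a * normc (G h x - T x n h) <= (normc a + 1) * (e / (normc a + 1) / 2).
    by apply: ler_pM; rewrite ?normc_ge0// ?lerDl// ltW.
  have -> : (normc a + 1) * (e / (normc a + 1) / 2) = e / 2 by field; rewrite gt_eqF.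
  by move: h2; rewrite -/(T x n h'); lra.
have [| | |M M0 hM] := @uniform_boundedness _ _ (@L2H R) V R [set x | 0 <= x <= 1] (fun x h => G h x) cV.
- by move=> x _ a h h'; exact: Glin.
- by move=> x _; exact: Gbd.
- move=> h Vh; have := ccont_normc (GP h Vh).1 => cG.
  have [c _ hc] := EVT_max (@ler01 R) (continuous_subspaceT cG).
  by exists (normc (G h c)) => x x01; apply: hc; rewrite in_itv.
exists (M * D); first by rewrite mulr_ge0.
move=> h g Vh cg hg x x01.
have [h' [Vh' nh' uh']] := hD h Vh.
have hG : {ae mu, forall t, h t = G h' t}.
  apply: (@L2_pointwise_limit (fun n => \sum_(k <- window (n, n)) '[h', transl s k] *: transl s k)).
  - exact: ccont_cmeas (GP h' Vh').1.
  - move=> e e0; have [N hN] := usum_conv uh' e0.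
    by exists N => n Nn; exact: hN.
  - apply: aeW => t e e0; have [N hN] := Gdiag h' t Vh' e e0; exists N => n Nn.
    by have := hN n Nn; rewrite partial_sum_window.
have -> : g = G h'.
  apply: (ccont_ae_eq cg (GP h' Vh').1).
  by apply: ae_mono (ae_and hg hG) => t [<- <-].
apply: (le_trans (hM x h' x01 Vh')); rewrite -mulrA.
exact: ler_wpM2l.
Qed.

End Evaluation.

(** * Sampling in a shift-invariant subspace *)

Section Heredity.
Context {R : realType}.
Local Notation mu := (@lebesgue_measure R).
Local Notation mR := (measurableTypeR R).
Local Notation nrm := (nrm (@L2H R)).
Local Notation closed_subspace := (closed_subspace (@L2H R)).
Local Notation "''[' x , y ]" := (ip (@L2H R) x y).

Lemma ae_eqT (f g : R -> R[i]) : f = g %[ae mu] -> {ae mu, forall x, f x = g x}.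
Proof. by apply: ae_mono => x; apply. Qed.

(** The bound on [0, 1] is carried to the other unit intervals by integer
translations. *)
Lemma eval_bound (V : set (L2 R)) (s : L2 R) (A B : R) :
  closed_subspace V -> (forall h k, V h -> V (transl h k)) -> V s -> 0 < A -> 0 < B ->
  bessel (@L2H R) V (transl s) B ->
  (forall h, V h -> forall e : R, 0 < e -> exists J : {fset int},
    A * nrm h ^+ 2 < \sum_(k <- J) normc '[h, transl s k] ^+ 2 + e) ->
  (forall c, is_l2 c -> exists2 g : R -> R[i]^o, continuous g &
    forall x, partial_sum c s mn x @[mn --> (\oo, \oo)] --> g x) ->
  exists2 C, 0 <= C & forall h (g : R -> R[i]^o), V h -> continuous g ->
    {ae mu, forall t, h t = g t} -> forall x, normc (g x) <= C * nrm h.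
Proof.
move=> cV VT Vs A0 B0 Bs Ls sums.
have [C C0 hC] := eval_on_unit_interval cV (fun k => VT s k Vs) A0 B0 Bs Ls sums.
exists C => // h g Vh cg hg x.
pose k := Num.floor x.
have := hC (transl h (- k)) (fun t => g (t + k%:~R)) (VT _ _ Vh)
  (@ccont_shift R g (k%:~R) cg).
rewrite nrm_transl => /(_ _ (x - k%:~R)); rewrite subrK; apply.
  have := ae_shift (k%:~R) hg; apply: ae_mono => t <-.
  by rewrite translE /translates rmorphN opprK.
rewrite subr_ge0 floor_le_tmp //= lerBlDr addrC.
by have := floorD1_gt x; rewrite intrD1 => /ltW.
Qed.

Lemma cvge_norm2 (r : nat * nat -> \bar R) (y : nat * nat -> L2 R) :
  (forall mn, r mn = (nrm (y mn))%:E) ->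
  (forall e : R, 0 < e -> exists N, forall m n, (N <= m)%N -> (N <= n)%N -> nrm (y (m, n)) < e) ->
  r mn @[mn --> (\oo, \oo)] --> 0%E.
Proof.
move=> rE hy; under eq_fun do rewrite rE.
apply: cvg_EFin; first exact: nearW.
apply/cvgrPdist_lt => e e0; apply: near_oo2; have [N hN] := hy e e0.
by exists N => m n Nm Nn; rewrite sub0r normrN /= ger0_norm//; exact: hN.
Qed.

Lemma norm2_cvg (r : nat * nat -> \bar R) (y : nat * nat -> L2 R) :
  (forall mn, r mn = (nrm (y mn))%:E) -> r mn @[mn --> (\oo, \oo)] --> 0%E ->
  forall e : R, 0 < e -> exists N, forall m n, (N <= m)%N -> (N <= n)%N -> nrm (y (m, n)) < e.
Proof.
move=> rE /fine_cvgP[_ h] e e0.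
move/cvgrPdist_lt : h => /(_ e e0) /oo2_near[N hN]; exists N => m n Nm Nn.
by have := hN m n Nm Nn; rewrite sub0r normrN /= rE /= ger0_norm.
Qed.

(** The projection y of s onto S(f) inherits the frame inequality and the sampling
series of s because <h, T_k y> = <h, T_k s> for h in S(f). The error of the
sampling series of y is the projection of that of s, hence smaller in L^2, and
eval_bound makes the convergence uniform. *)
Lemma sampling_subspace (phi s f : L2 R) :
  is_sampling_space (shift_space phi) s -> shift_space phi f ->
  exists y : L2 R, is_orthogonal_projection (shift_space f) s y /\
    is_sampling_space (shift_space f) y.
Proof.
move=> [_ frs sums samp] Vf.
pose V := (fun h : L2 R => shift_space phi h).
pose W := (fun h : L2 R => shift_space f h).
have cV : closed_subspace V := shift_space_closed phi.
have cW : closed_subspace W := shift_space_closed f.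
have WV h : W h -> V h by exact: shift_space_sub.
have Vs : V s by have := frs.1 0; rewrite translates0.
have [A [B [A0 B0 Bs Ls]]] := frame_boundsP (V := shift_space phi) (u := transl s) frs.
have VT h k : V h -> V (transl h k) := @shift_space_transl R phi h k.
have WT h k : W h -> W (transl h k) := @shift_space_transl R f h k.
have [C C0 hC] := eval_bound cV VT Vs A0 B0 Bs Ls sums.
(* p0 is one projection; y is its continuous representative, which is needed for
   point values *)
have [p0 Wp0 p0P] := projection s cW.
have [g [cg /ae_eqT p0g _ _]] := samp p0 (WV _ Wp0).
have Lg : in_Lp 2%:E g.
  by apply: (@L2_ae _ g p0 (ccont_cmeas cg)); apply: ae_mono p0g => t ->.
pose y := mkL2 Lg; have cy : continuous (y : R -> R[i]^o) by exact: cg.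
have Wy : W y by exact: (closed_subspace_ae (y := y) cW p0g Wp0).
have yP h : W h -> '[s - y, h] = 0.
  move=> Wh; have -> : s - y = (s - p0) + (p0 - y) by rewrite addrA subrK.
  by rewrite ipDl p0P// add0r nrm_eq0_ip//; exact: nrm_ae.
have yTP h k : W h -> '[transl s k - transl y k, h] = 0.
  move=> Wh; rewrite -translB -[h]transl0 -(addNr k) -translD ip_transl; apply: yP.
  exact: WT.
have ipE h k : W h -> '[h, transl y k] = '[h, transl s k].
  move=> Wh; apply/eqP; rewrite eq_sym -subr_eq0 -ipBr ipC yTP//.
  by apply/eqP; apply: complex_ext; rewrite reimE /= ?oppr0.
have WTy k : W (transl y k) by exact: WT.
have frW : is_frame (shift_space f) (translates y).
  split => [k|]; first exact: WTy.
  have [_ [A' [B' [A'0 B'0 H]]]] := frs; exists A', B'; split => // h Wh.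
  have Lh := shift_space_L2 Wh; pose hh := mkL2 Lh.
  have e k : inner h (translates y k) = inner h (translates s k) := ipE hh k Wh.
  rewrite (_ : \esum_(k in _) _ = \esum_(k in [set: int]) (normc (inner h (translates s k)) ^+ 2)%:E).
    exact: (H h (WV hh Wh)).
  by apply: eq_esum => k _; rewrite e.
have [A1 [B1 [A10 B10 BW LW]]] := frame_boundsP (V := shift_space f) (u := transl y) frW.
(* a vector of S(f) orthogonal to all T_k y has norm 0 by the lower frame bound *)
have Sy : shift_space f = shift_space y.
  apply/seteqP; split => h Sh; last first.
    exact: (shift_space_sub Wy (z := mkL2 (shift_space_L2 Sh)) Sh).
  pose hh := mkL2 (shift_space_L2 Sh).
  have cY := shift_space_closed y.
  have [q Yq qP] := projection hh cY.
  have Wq : W q by exact: (shift_space_sub Wy Yq).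
  have Wd : W (hh - q) by apply: (csubB cW).
  have d0 : nrm (hh - q) = 0.
    apply/eqP; rewrite -sqrf_eq0 eq_le sqr_ge0 andbT -(ler_pM2l A10) mulr0.
    apply/ler_addgt0Pr => e e0; have [J hJ] := LW _ Wd e e0; apply/ltW.
    apply: (lt_le_trans hJ); rewrite big1// => k _.
    by rewrite qP ?ComplexField.Normc.normc0 ?expr0n//; exact: shift_space_gen.
  suff : shift_space y hh by [].
  apply: (csub_adh cY) => e e0; exists q => //.
  by rewrite d0.
exists y; split.
  by split => // h Wh; have := yP (mkL2 (shift_space_L2 Wh)) Wh.
split => //.
- exists y => //; split; first exact: L2P.
  by rewrite -Sy.
- move=> c cl2.
  have [M cM] : exists M : R, forall J : {fset int}, \sum_(k <- J) normc (c k) ^+ 2 <= M.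
    exists (fine (\esum_(k in [set: int]) (normc (c k) ^+ 2)%:E)) => J.
    rewrite -lee_fin fineK; first by apply: (@esum_ub _ _ (fun k => normc (c k) ^+ 2)) => k; exact: sqr_ge0.
    by rewrite ge0_fin_numE//; apply: esum_ge0 => k _; rewrite lee_fin sqr_ge0.
  have [l Wl ul] := synthesis_conv cW WTy (ltW B10) BW cM.
  have [gl [cgl /ae_eqT lgl _ _]] := samp l (WV _ Wl).
  exists gl; first exact: cgl.
  move=> x; apply/ccvgP => e e0; apply: near_oo2.
  have C1 : 0 < C + 1 by rewrite ltr_wpDl.
  have [N hN] := usum_conv ul (divr_gt0 e0 C1); exists N => m n Nm Nn.
  pose ps := (\sum_(k <- window (m, n)) c k *: transl y k : L2 R).
  have Wps : W ps by apply: (csub_sum _ cW) => k; exact: (csubZ _ cW).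
  have := hC (l - ps) (fun t => gl t - partial_sum c y (m, n) t) (WV _ (csubB cW Wl Wps))
    (@ccontB R gl (partial_sum c y (m, n)) cgl (@ccont_partial_sum R c y (m, n) cy)).
  move=> /(_ _ x) h; apply: (le_lt_trans (h _)).
    by apply: ae_mono lgl => t; rewrite L2addE L2oppE partial_sum_window => ->.
  apply: (@le_lt_trans _ _ ((C + 1) * nrm (l - ps))); first by rewrite ler_wpM2r// lerDl.
  by rewrite -ltr_pdivlMl// mulrC; exact: hN.
- move=> h Wh; have Lh := shift_space_L2 Wh; pose hh := mkL2 Lh.
  have [gh [cgh hgh0 cv unif]] := samp hh (WV hh Wh).
  have hgh := ae_eqT hgh0.
  exists gh; set c := (fun k : int => gh k%:~R).
  have Lgh : in_Lp 2%:E gh.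
    by apply: (@L2_ae _ gh hh (ccont_cmeas cgh)); apply: ae_mono hgh => t ->.
  pose gg := mkL2 Lgh.
  have Wgg : W gg by exact: (closed_subspace_ae (y := gg) cW hgh Wh).
  pose ps mn := (\sum_(k <- window mn) c k *: transl y k : L2 R).
  pose pt mn := (\sum_(k <- window mn) c k *: transl s k : L2 R).
  have Wps mn : W (ps mn) by apply: (csub_sum _ cW) => k; exact: (csubZ _ cW).
  have psE mn : norm2 (gh \- partial_sum c y mn) = (nrm (gg - ps mn))%:E.
    by rewrite -norm2_nrm partial_sum_window.
  have ptE mn : norm2 (gh \- partial_sum c s mn) = (nrm (gg - pt mn))%:E.
    by rewrite -norm2_nrm partial_sum_window.
  (* gg - ps mn is the projection of gg - pt mn onto S(f) *)
  have le mn : nrm (gg - ps mn) <= nrm (gg - pt mn).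
    apply: (@projection_contract _ _ (@L2H R) W); first exact: (csubB cW).
    move=> w Ww; rewrite opprB addrC addrA subrK /ps /pt -sumrB ip_suml big1// => k _.
    by rewrite -scalerBr ipZl -opprB ipNl yTP// oppr0 mulr0.
  have small (e : R) : 0 < e -> exists N, forall m n, (N <= m)%N -> (N <= n)%N ->
      nrm (gg - ps (m, n)) < e.
    move=> e0; have [N hN] := norm2_cvg (y := fun mn => gg - pt mn) ptE cv e0.
    by exists N => m n Nm Nn; apply: (le_lt_trans (le _)); exact: hN.
  split => //.
    exact: (cvge_norm2 (y := fun mn => gg - ps mn) psE small).
  move=> e e0; apply: near_oo2.
  have C1 : 0 < C + 1 by rewrite ltr_wpDl.
  have [N hN] := small _ (divr_gt0 e0 C1); exists N => m n Nm Nn x.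
  have := hC (gg - ps (m, n)) (fun t => gh t - partial_sum c y (m, n) t) (WV _ (csubB cW Wgg (Wps _)))
    (@ccontB R gh (partial_sum c y (m, n)) cgh (@ccont_partial_sum R c y (m, n) cy)).
  move=> /(_ _ x) hh'; apply: (le_lt_trans (hh' _)).
    by apply: aeW => t; rewrite L2addE L2oppE partial_sum_window.
  apply: (@le_lt_trans _ _ ((C + 1) * nrm (gg - ps (m, n)))); first by rewrite ler_wpM2r// lerDl.
  by rewrite -ltr_pdivlMl// mulrC; exact: hN.
Qed.

End Heredity.

(** * The moment problem on a bounded interval *)

Section Moments.
Context {R : realType}.
Local Notation mu := (@lebesgue_measure R).
Local Notation mR := (measurableTypeR R).
Implicit Types (u v p : R -> R).

Lemma integrable_bounded (u p : mR -> R) (K : R) : mu.-integrable [set: mR] (EFin \o u) ->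
  measurable_fun [set: mR] p -> (forall x, `|p x| <= K) ->
  mu.-integrable [set: mR] (EFin \o (fun x => u x * p x)).
Proof.
move=> iu mp pK; have K0 : 0 <= K by exact: le_trans (pK 0).
have mu_ : measurable_fun [set: mR] u by case/integrableP: iu => /measurable_EFinP.
apply: (le_integrable measurableT _ _ (integrable_scale K iu)).
  by apply/measurable_EFinP; exact: measurable_funM.
move=> x _; rewrite !lee_fin /= !normrM [in leRHS]mulrC ler_wpM2l//.
by rewrite (le_trans (pK x))// ler_norm.
Qed.

Lemma integrable_addr (u v : mR -> R) : mu.-integrable [set: mR] (EFin \o u) ->
  mu.-integrable [set: mR] (EFin \o v) ->
  mu.-integrable [set: mR] (EFin \o (fun x => u x + v x)).
Proof.
move=> iu iv; rewrite (_ : _ \o _ = (EFin \o u) \+ (EFin \o v))%E//.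
exact: integrableD.
Qed.

Lemma measurable_of_integrable (u : mR -> R) :
  mu.-integrable [set: mR] (EFin \o u) -> measurable_fun [set: mR] u.
Proof. by case/integrableP => /measurable_EFinP. Qed.

(** Dominated convergence: the weights killed by u are stable under bounded limits. *)
Lemma bounded_limit_weight (u p : mR -> R) (q : nat -> mR -> R) (K : R) :
  mu.-integrable [set: mR] (EFin \o u) ->
  (forall n, measurable_fun [set: mR] (q n)) -> (forall n x, `|q n x| <= K) ->
  (forall x, u x != 0 -> q n x @[n --> \oo] --> p x) -> measurable_fun [set: mR] p ->
  (forall n, \int[mu]_x (u x * q n x) = 0) -> \int[mu]_x (u x * p x) = 0.
Proof.
move=> iu mq qK qp mp q0.
have mu_ := measurable_of_integrable iu.
have [] := @dominated_convergence _ mR R mu setT measurableT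
  (fun n x => (u x * q n x)%:E) (fun x => (u x * p x)%:E) (fun x => (`|K| * `|u x|)%:E).
- by move=> n; apply/measurable_EFinP; exact: measurable_funM.
- by apply/measurable_EFinP; exact: measurable_funM.
- apply: aeW => x _; apply: cvg_EFin; first exact: nearW.
  have [->|u0] := eqVneq (u x) 0.
    by under eq_fun do rewrite mul0r; rewrite mul0r; exact: cvg_cst.
  by apply: cvgM; [exact: cvg_cst|exact: qp].
- have := integrable_scale `|K| (u := fun x => `|u x|); apply.
  exact: (integrable_abse iu).
- apply: aeW => x n _; rewrite lee_fin normrM mulrC ler_wpM2r//.
  by rewrite (le_trans (qK n x))// ler_norm.
move=> _ _ h; rewrite /Rintegral.
have : (\int[mu]_x (u x * q n x)%:E)%E @[n --> \oo] --> 0%E.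
  rewrite (_ : (fun n => _) = cst 0%E); first exact: cvg_cst.
  apply/funext => n; apply/eqP; rewrite -fine_eq0; last first.
    exact: (integrable_fin_num measurableT (integrable_bounded iu (mq n) (qK n))).
  by apply/eqP; exact: q0.
by move=> /(cvg_unique _ h) ->.
Qed.

Lemma moment_poly (u v : mR -> R) (M : R) (P : {poly R}) :
  mu.-integrable [set: mR] (EFin \o u) ->
  measurable_fun [set: mR] v -> (forall x, `|v x| <= M) ->
  (forall n, \int[mu]_x (u x * v x ^+ n) = 0) ->
  \int[mu]_x (u x * P.[v x]) = 0.
Proof.
move=> iu mv vM uv.
have ivn n : mu.-integrable [set: mR] (EFin \o (fun x => u x * v x ^+ n)).
  apply: (integrable_bounded (K := M ^+ n)) => //; first exact: measurable_funX.
  move=> x; rewrite normrX lerXn2r ?nnegrE//; exact: le_trans (vM x).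
suff [] : mu.-integrable [set: mR] (EFin \o (fun x => u x * P.[v x])) /\
    \int[mu]_x (u x * P.[v x]) = 0 by [].
rewrite -[P]coefK poly_def; elim: (size P) => [|n [IH1 IH2]].
  under eq_fun do rewrite big_ord0 horner0 mulr0.
  split; first by rewrite (_ : _ \o _ = cst 0%E)//; exact: integrable0.
  by rewrite Rintegral_cst// mul0r.
have e x : u x * (\sum_(i < n.+1) P`_i *: 'X^i).[v x] =
    u x * (\sum_(i < n) P`_i *: 'X^i).[v x] + P`_n * (u x * v x ^+ n).
  by rewrite big_ord_recr /= hornerD hornerZ hornerXn; ring.
have i2 := integrable_scale P`_n (ivn n).
split.
  under eq_fun do rewrite e; exact: integrable_addr.
under eq_Rintegral do rewrite e.
by rewrite RintegralD// IH2 RintegralZl// uv mulr0 addr0.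
Qed.

Lemma measurable_horner (P : {poly R}) (v : mR -> R) : measurable_fun [set: mR] v ->
  measurable_fun [set: mR] (fun x => P.[v x]).
Proof.
move=> mv; under eq_fun do rewrite horner_coef.
apply: measurable_sum => i; apply: measurable_funM; first exact: measurable_cst.
exact: measurable_funX.
Qed.

Lemma cvg_ltr1_expn (a : R) : 0 <= a < 1 -> a ^+ n @[n --> \oo] --> 0.
Proof. by move=> /andP[a0 a1]; apply: cvg_expr; rewrite ger0_norm. Qed.

(** With c so large that |v - r| <= c, the polynomials 1 - ((v - r) / c)^2 raised to
the k-th power are bounded by 1 and tend to the indicator of v = r. *)
Lemma moment_level (u v : mR -> R) (M r : R) :
  mu.-integrable [set: mR] (EFin \o u) ->
  measurable_fun [set: mR] v -> (forall x, `|v x| <= M) ->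
  (forall n, \int[mu]_x (u x * v x ^+ n) = 0) ->
  forall n, \int[mu]_x (u x * (v x ^+ n * (v x == r)%:R)) = 0.
Proof.
move=> iu mv vM uv n; pose c := M + `|r| + 1.
have M0 : 0 <= M by exact: le_trans (vM 0).
have c0 : 0 < c by rewrite ltr_wpDl// addr_ge0.
pose d x := ((v x - r) / c) ^+ 2.
have d01 x : 0 <= d x <= 1.
  rewrite /d sqr_ge0/= -real_normK ?num_real// exprn_ile1//.
  rewrite normrM normfV (gtr0_norm c0) ler_pdivrMr// mul1r.
  by apply: (le_trans (ler_normB _ _)); have := vM x; rewrite /c; lra.
pose P k : {poly R} := 'X^n * (1 - (c^-1 *: ('X - r%:P)) ^+ 2) ^+ k.
have PE k x : (P k).[v x] = v x ^+ n * (1 - d x) ^+ k.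
  by rewrite /P !hornerE /d [c^-1 * _]mulrC.
apply: (@bounded_limit_weight u _ (fun k x => (P k).[v x]) (M ^+ n)) => //.
- by move=> k; exact: measurable_horner.
- move=> k x; rewrite PE normrM normrX.
  have /andP[h0 h1] := d01 x.
  rewrite -[leRHS]mulr1 ler_pM//; first by rewrite lerXn2r ?nnegrE.
  by rewrite normrX exprn_ile1// ger0_norm; lra.
- move=> x _; under eq_fun do rewrite PE.
  apply: cvgM; first exact: cvg_cst.
  rewrite /d; have [->|vr] := eqVneq (v x) r.
    apply: cvg_near_cst; apply: nearW => k.
    by rewrite subrr mul0r expr0n subr0 expr1n.
  apply: cvg_ltr1_expn; have /andP[_ h1] := d01 x.
  rewrite -/(d x) subr_ge0 h1 gtrBl lt_neqAle sqr_ge0 andbT eq_sym sqrf_eq0.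
  by rewrite mulf_eq0 negb_or subr_eq0 vr invr_eq0 gt_eqF.
- apply: measurable_funM; first exact: measurable_funX.
  rewrite (_ : (fun x => _) = (\1_(v @^-1` [set r]) : mR -> R)).
    by apply: measurable_indic; rewrite -[X in measurable X]setTI; exact: mv.
  apply/funext => x; rewrite indicE; congr (nat_of_bool _)%:R.
  by apply/eqP/idP => [h|]; rewrite inE.
- by move=> k; exact: (moment_poly _ iu mv vM uv).
Qed.

(** (1 - t^k)^(2^k) tends to 1 for t < 1/2 and to 0 for t > 1/2: these polynomials
approximate a step. Here Bernoulli's inequality bounds
(1 - t^k)^(2^k) (2 t)^k by ((1 - t^k) (1 + t^k))^(2^k) <= 1. *)
Lemma step_cvg0 (t : R) : 2^-1 < t <= 1 -> (1 - t ^+ k) ^+ (2 ^ k) @[k --> \oo] --> 0.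
Proof.
move=> /andP[t2 t1]; have t0 : 0 < t by lra.
apply: (@squeeze_cvgr _ _ _ _ (fun=> 0) (fun k => (2 * t)^-1 ^+ k)).
- apply: nearW => k; have tk0 : 0 < t ^+ k by rewrite exprn_gt0.
  have tk1 : t ^+ k <= 1 by rewrite exprn_ile1// ltW.
  apply/andP; split; first by rewrite exprn_ge0//; lra.
  have b : 1 + (2 ^ k)%:R * t ^+ k <= (1 + t ^+ k) ^+ (2 ^ k).
    elim: (2 ^ k)%N => [|m IH]; first by rewrite mul0r addr0 expr0.
    rewrite exprS; apply: (@le_trans _ _ ((1 + t ^+ k) * (1 + m%:R * t ^+ k))).
      have : 0 <= m%:R * t ^+ k * t ^+ k by rewrite !mulr_ge0// ltW.
      by rewrite -natr1; move: (m%:R) (t ^+ k) => a b; lra.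
    by rewrite ler_pM2l//; lra.
  have b1 : (2 * t) ^+ k <= (1 + t ^+ k) ^+ (2 ^ k).
    by apply: le_trans b; rewrite exprMn natrX lerDr.
  have b2 : (1 - t ^+ k) ^+ (2 ^ k) * (1 + t ^+ k) ^+ (2 ^ k) <= 1.
    rewrite -exprMn exprn_ile1//; first by nra.
    by rewrite mulrDr mulr1 mulrBl mul1r; nra.
  rewrite exprVn -div1r ler_pdivlMr ?exprn_gt0 ?mulr_gt0//.
  apply: le_trans b2; apply: ler_wpM2l => //.
  by rewrite exprn_ge0//; lra.
- exact: cvg_cst.
- by apply: cvg_ltr1_expn; rewrite invr_ge0 mulr_ge0 ?ltW//= invf_lt1; lra.
Qed.

(** Bernoulli's inequality bounds the expression from below by 1 - (2 t)^k. *)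
Lemma step_cvg1 (t : R) : 0 <= t < 2^-1 -> (1 - t ^+ k) ^+ (2 ^ k) @[k --> \oo] --> (1 : R).
Proof.
move=> /andP[t0 t2].
apply: (@squeeze_cvgr _ _ _ _ (fun k => 1 - (2 * t) ^+ k) (fun=> 1)).
- apply: nearW => k; have tk0 : 0 <= t ^+ k by rewrite exprn_ge0.
  have tk1 : t ^+ k <= 1 by rewrite exprn_ile1//; lra.
  apply/andP; split; last by rewrite exprn_ile1//; lra.
  rewrite exprMn -natrX.
  elim: (2 ^ k)%N => [|m IH]; first by rewrite mul0r subr0 expr0.
  have [m1|m1] := leP 0 (1 - m%:R * t ^+ k).
    rewrite exprS; apply: (@le_trans _ _ ((1 - t ^+ k) * (1 - m%:R * t ^+ k))).
      have : 0 <= m%:R * t ^+ k * t ^+ k by rewrite !mulr_ge0.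
      by rewrite -natr1; move: (m%:R) (t ^+ k) => a b; lra.
    by apply: ler_wpM2l => //; lra.
  apply: (@le_trans _ _ 0); last by rewrite exprn_ge0//; lra.
  by rewrite -natr1 mulrDl mul1r; lra.
- rewrite -[X in _ --> X]subr0; apply: cvgB; first exact: cvg_cst.
  by apply: cvg_ltr1_expn; apply/andP; split; lra.
- exact: cvg_cst.
Qed.

(** An affine function t of v maps v < r to t < 1/2 inside [0, 1], so the step
polynomials in t converge to the indicator of v < r off the level set v = r,
which moment_level allows to remove. *)
Lemma moment_halfline (u v : mR -> R) (M r : R) :
  mu.-integrable [set: mR] (EFin \o u) ->
  measurable_fun [set: mR] v -> (forall x, `|v x| <= M) ->
  (forall n, \int[mu]_x (u x * v x ^+ n) = 0) ->
  \int[mu]_x (u x * (v x < r)%R%:R) = 0.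
Proof.
move=> iu mv vM uv; pose c := M + `|r| + 1.
have M0 : 0 <= M by exact: le_trans (vM 0).
have c0 : 0 < c by rewrite ltr_wpDl// addr_ge0.
have meq : measurable_fun [set: mR] (fun x => (v x == r)%:R : R).
  rewrite (_ : (fun x => _) = (\1_(v @^-1` [set r]) : mR -> R)).
    by apply: measurable_indic; rewrite -[X in measurable X]setTI; exact: mv.
  apply/funext => x; rewrite indicE; congr (nat_of_bool _)%:R.
  by apply/eqP/idP => [h|]; rewrite inE.
pose u' x := u x * (1 - (v x == r)%:R).
have bneq x : `|1 - (v x == r)%:R : R| <= 1.
  by case: (v x == r); rewrite ?subrr ?subr0 ?normr0 ?normr1.
have mneq : measurable_fun [set: mR] (fun x => 1 - (v x == r)%:R : R).
  by apply: measurable_funB => //; exact: measurable_cst.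
have iu' : mu.-integrable [set: mR] (EFin \o u').
  exact: (integrable_bounded iu mneq bneq).
have uv' n : \int[mu]_x (u' x * v x ^+ n) = 0.
  have bvn x : `|v x ^+ n| <= M ^+ n by rewrite normrX lerXn2r ?nnegrE.
  have b2 x : `|v x ^+ n * (v x == r)%:R| <= M ^+ n.
    rewrite normrM -[leRHS]mulr1 ler_pM//.
    by case: (v x == r); rewrite ?normr0 ?normr1.
  rewrite -[RHS](subrr 0) -[X in _ = X - _](uv n) -[X in _ = _ - X](moment_level r iu mv vM uv n).
  rewrite -RintegralB//.
  - by apply: eq_Rintegral => x _; rewrite /u'; ring.
  - by apply: (integrable_bounded iu _ bvn); exact: measurable_funX.
  - by apply: (integrable_bounded iu _ b2); apply: measurable_funM => //; exact: measurable_funX.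
have -> : \int[mu]_x (u x * (v x < r)%R%:R) = \int[mu]_x (u' x * (v x < r)%R%:R).
  apply: eq_Rintegral => x _; rewrite /u'.
  by case: ltgtP => // _; rewrite ?subr0 ?mulr1 ?mulr0.
pose t x := 2^-1 + (v x - r) / (2 * c).
have t01 x : 0 <= t x <= 1.
  have : `|(v x - r) / (2 * c)| <= 2^-1.
    rewrite normrM normfV (gtr0_norm (mulr_gt0 (ltr0n _ 2) c0)) ler_pdivrMr ?mulr_gt0//.
    rewrite mulrA mulVf// mul1r.
    by apply: (le_trans (ler_normB _ _)); have := vM x; rewrite /c; lra.
  by rewrite ler_norml /t => /andP[h1 h2]; apply/andP; split; lra.
pose P k : {poly R} := (1 - (2^-1%:P + (2 * c)^-1 *: ('X - r%:P)) ^+ k) ^+ (2 ^ k).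
have PE k x : (P k).[v x] = (1 - t x ^+ k) ^+ (2 ^ k).
  by rewrite /P !hornerE /t [_^-1 * (_ - _)]mulrC.
apply: (@bounded_limit_weight u' _ (fun k x => (P k).[v x]) 1) => //.
- by move=> k; exact: measurable_horner.
- move=> k x; rewrite PE; have /andP[h0 h1] := t01 x.
  have h2 : 0 <= t x ^+ k by rewrite exprn_ge0.
  have h3 : t x ^+ k <= 1 by rewrite exprn_ile1.
  by rewrite normrX exprn_ile1// ger0_norm; lra.
- move=> x; rewrite /u' => ux; under eq_fun do rewrite PE.
  have /andP[h0 h1] := t01 x.
  have [vr|vr|vr] := ltgtP (v x) r.
  + apply: step_cvg1; rewrite h0 /= /t gtrDl.
    by rewrite ltr_pdivrMr ?mul0r ?subr_lt0// mulr_gt0.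
  + apply: step_cvg0; rewrite h1 andbT /t ltrDl.
    by rewrite divr_gt0 ?subr_gt0// mulr_gt0.
  + by move: ux; rewrite vr eqxx subrr mulr0 eqxx.
- rewrite (_ : (fun x => _) = (\1_(v @^-1` `]-oo, r[) : mR -> R)).
    by apply: measurable_indic; rewrite -[X in measurable X]setTI; exact: mv.
  apply/funext => x; rewrite indicE; congr (nat_of_bool _)%:R.
  by apply/idP/idP; rewrite inE /= in_itv.
- by move=> k; exact: (moment_poly _ iu' mv vM uv').
Qed.

(** The image of u mu under v is a signed measure on a bounded interval, hence
determined by its moments: the sets B with vanishing integral form a Dynkin
system that contains the half-lines. *)
Theorem moment_zero (u v : mR -> R) (M : R) (B : set mR) :
  mu.-integrable [set: mR] (EFin \o u) ->
  measurable_fun [set: mR] v -> (forall x, `|v x| <= M) ->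
  (forall n, \int[mu]_x (u x * v x ^+ n) = 0) ->
  measurable B -> \int[mu]_x (u x * \1_B (v x)) = 0.
Proof.
move=> iu mv vM uv mB.
have b1 (A : set mR) x : `|\1_A (v x) : R| <= 1.
  by rewrite indicE; case: (_ \in _); rewrite ?normr0 ?normr1.
have mI (A : set mR) : measurable A -> measurable_fun [set: mR] (fun x => \1_A (v x) : R).
  move=> mA; rewrite (_ : (fun x => _) = (\1_(v @^-1` A) : mR -> R)).
    by apply: measurable_indic; rewrite -[X in measurable X]setTI; exact: mv.
  by apply/funext => x; rewrite !indicE; congr (nat_of_bool _)%:R; apply/idP/idP; rewrite !inE.
have u0 : \int[mu]_x u x = 0.
  by have := uv 0%N; under eq_Rintegral do rewrite expr0 mulr1.
have iI (A : set mR) : measurable A -> mu.-integrable [set: mR] (EFin \o (fun x => u x * \1_A (v x))).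
  by move=> mA; exact: (integrable_bounded iu (mI A mA) (b1 A)).
pose Z (A : set mR) := \int[mu]_x (u x * \1_A (v x)) = 0.
suff ZS : forall S, <<s @RGenInftyO.G R >> S -> Z S.
  have mG : (@RGenInftyO.G R).-sigma.-measurable B by rewrite -RGenInftyO.measurableE.
  exact: ZS mG.
apply: (@dynkin_induction _ mR (@RGenInftyO.G R) Z).
- exact: RGenInftyO.measurableE.
- move=> _ _ [a ->] [b ->]; exists (Num.min a b).
  by apply/seteqP; split => x /=; rewrite !in_itv/= lt_min => /andP.
- by rewrite /Z; under eq_Rintegral do rewrite indicE in_setT mulr1.
- move=> _ [r ->]; rewrite /Z -[RHS](moment_halfline r iu mv vM uv).
  by apply: eq_Rintegral => x _; rewrite indicE mem_setE in_itv.
- move=> A mA A0; rewrite /Z -[RHS](subrr 0) -[X in _ = X - _]u0 -[X in _ = _ - X]A0.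
  rewrite -RintegralB//; last exact: iI.
  apply: eq_Rintegral => x _; rewrite !indicE in_setC.
  by case: (v x \in A) => /=; rewrite ?mulr1 ?mulr0 ?subrr ?subr0.
- move=> F mF tF F0.
  have mU n : measurable (\bigcup_(k < n) F k) by exact: bigcup_measurable.
  apply: (@bounded_limit_weight u _ (fun n x => \1_(\bigcup_(k < n) F k) (v x)) 1) => //.
  + by move=> n; exact: mI.
  + move=> x _; have [[k _ Fk]|nF] := pselect ((\bigcup_k F k) (v x)).
      rewrite [X in _ --> X]indicE mem_set; last by exists k.
      apply: cvg_near_cst; exists k.+1 => // n /= kn.
      by rewrite indicE mem_set//; exists k.
    rewrite [X in _ --> X]indicE memNset//.
    apply: cvg_near_cst; apply: nearW => n; rewrite indicE memNset// => -[k _ Fk].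
    by apply: nF; exists k.
  + by apply: mI; exact: bigcupT_measurable.
  + elim=> [|n IH].
      rewrite bigcup_mkord big_ord0; under eq_Rintegral do rewrite indic0 mulr0.
      by rewrite Rintegral_cst// mul0r.
    rewrite -[RHS](addr0 0) -[X in _ = X + _]IH -[X in _ = _ + X](F0 n) -RintegralD//; try exact: iI.
    apply: eq_Rintegral => x _; rewrite -mulrDr; congr (_ * _).
    rewrite bigcup_mkord big_ord_recr/= -bigcup_mkord !indicE.
    have [Fn|nFn] := pselect (F n (v x)).
      rewrite mem_set; last by right.
      rewrite (mem_set Fn) memNset ?add0r// => -[k /= kn Fk].
      have /trivIsetP/(_ k n I I) := tF.
      rewrite neq_ltn kn => /(_ isT)/seteqP[/(_ (v x)) h _].
      exact: h.
    rewrite (memNset nFn) addr0; congr (nat_of_bool _)%:R.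
    apply/idP/idP; rewrite !inE; first by case.
    by left.
Qed.

End Moments.

(** * Integrals of exponentials over half-lines *)

Section Exponentials.
Context {R : realType}.
Local Notation mu := (@lebesgue_measure R).
Local Notation mR := (measurableTypeR R).
Implicit Types (a b w x : R).

Lemma ge0_integral_refl (f : mR -> \bar R) : measurable_fun [set: mR] f ->
  (forall x, (0 <= f x)%E) -> (\int[mu]_x f (- x)%R = \int[mu]_x f x)%E.
Proof.
move=> mf f0; have ms : measurable_fun [set: mR] (fun x : mR => (- x)%R : mR).
  by apply: measurable_funN; exact: measurable_id.
transitivity (\int[pushforward mu (fun x : mR => (- x)%R : mR)]_x f x)%E.
  by rewrite ge0_integral_pushforward//= preimage_setT.
by apply: eq_measure_integral => A mA _; exact: lebesgue_measureN.
Qed.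

Lemma integrable_refl (u : mR -> R) : mu.-integrable [set: mR] (EFin \o u) ->
  mu.-integrable [set: mR] (EFin \o (fun x => u (- x))).
Proof.
move=> /integrableP[mu_ iu]; apply/integrableP; split.
  apply: measurableT_comp mu_ _.
  by apply: measurable_funN; exact: measurable_id.
rewrite (ge0_integral_refl (f := fun x => `|(EFin \o u) x|%E))//.
exact: measurableT_comp.
Qed.

Lemma Rintegral_refl (u : mR -> R) : mu.-integrable [set: mR] (EFin \o u) ->
  \int[mu]_x u (- x) = \int[mu]_x u x.
Proof.
move=> iu; congr fine; have ms : measurable_fun [set: mR] (fun x : mR => (- x)%R : mR).
  by apply: measurable_funN; exact: measurable_id.
transitivity (\int[pushforward mu (fun x : mR => (- x)%R : mR)]_x (u x)%:E)%E.
  have mEu : measurable_fun [set: mR] (EFin \o u) by case/integrableP: iu.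
  have := @integral_pushforward _ _ _ _ R _ ms mu setT (EFin \o u) mEu.
  rewrite preimage_setT => h; apply/esym; apply: h => //.
  exact: integrable_refl.
by apply: eq_measure_integral => A mA _; exact: lebesgue_measureN.
Qed.

(** Used for the imaginary parts of the inner products of the functions etail_hat. *)
Lemma Rintegral_odd (u : mR -> R) : mu.-integrable [set: mR] (EFin \o u) ->
  (forall x, u (- x) = - u x) -> \int[mu]_x u x = 0.
Proof.
move=> iu odd; have := Rintegral_refl iu; under eq_Rintegral do rewrite odd -mulN1r.
rewrite RintegralZl// mulN1r => /eqP; rewrite eq_sym -subr_eq0 opprK -mulr2n mulrn_eq0/=.
by move=> /eqP.
Qed.

(** Nonnegativity of f supplies its integrability. *)
Lemma FTC_halfline (f F : R -> R) (l : R) : (forall x, 0 <= x -> 0 <= f x) -> continuous f ->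
  F x @[x --> +oo] --> l -> (forall x, is_derive x 1 F (f x)) ->
  mu.-integrable `[0, +oo[ (EFin \o (f : mR -> R)) /\
  \int[mu]_(x in `[0, +oo[) f x = l - F 0.
Proof.
move=> f0 cf Fl dF.
have h : (\int[mu]_(x in `[0%R, +oo[) (f x)%:E = l%:E - (F 0%R)%:E)%E.
  apply: ge0_continuous_FTC2y => //.
  - exact: continuous_subspaceT.
  - have : {for 0, continuous F} by apply/differentiable_continuous/derivable1_diffP; case: (dF 0).
    by move=> /(@cvg_at_right_filter _ _ _ _).
  - by move=> x _; rewrite derive1E; apply: derive_val.
split; last by rewrite /Rintegral h.
apply/integrableP; split.
  by apply/measurable_EFinP/measurable_funTS; exact: continuous_measurable_fun.
rewrite (_ : (\int[mu]_(x in _) _)%E = (\int[mu]_(x in `[0%R, +oo[) (f x)%:E)%E).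
  by rewrite h -EFinB ltry.
by apply: eq_integral => x; rewrite inE/= in_itv/= andbT => x0; rewrite ger0_norm// f0.
Qed.

Lemma expR_decay a (p : R -> R) (K : R) : 0 < a -> (forall x, `|p x| <= K) ->
  expR (- (a * x)) * p x @[x --> +oo] --> (0 : R).
Proof.
move=> a0 pK.
have e0 : expR (- (a * x)) @[x --> +oo] --> (0 : R).
  apply: (@cvg_comp _ _ _ (fun x => a * x) (fun x => expR (- x)) _ +oo); last exact: cvgr_expR.
  by apply: gt0_cvgMry => //; exact: cvg_id.
apply/cvgr0Pnorm_lt => e e_gt0.
have K1 : 0 < `|K| + 1 by rewrite ltr_wpDl.
move/cvgr0Pnorm_lt : e0 => /(_ (e / (`|K| + 1)) (divr_gt0 e_gt0 K1)).
apply: filterS => x; rewrite ltr_pdivlMr// => h.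
rewrite normrM; apply: le_lt_trans h; apply: ler_wpM2l => //.
by rewrite (le_trans (pK x))// (le_trans (ler_norm K))// lerDl.
Qed.

Lemma halfline_exp a : 0 < a ->
  mu.-integrable `[0, +oo[ (EFin \o (fun x : mR => expR (- (a * x)))) /\
  \int[mu]_(x in `[0, +oo[) expR (- (a * x)) = a^-1.
Proof.
move=> a0; have an : a != 0 by rewrite gt_eqF.
have [| | | |h1 h2] := @FTC_halfline (fun x => expR (- (a * x)))
  (fun x => expR (- (a * x)) * (- a^-1)) 0.
- by move=> x _; exact: expR_ge0.
- move=> x; apply: (@continuous_comp _ _ _ (fun x => - (a * x)) expR); last exact: continuous_expR.
  by apply: cvgN; apply: cvgM; [exact: cvg_cst|exact: cvg_id].
- by apply: (@expR_decay a (cst (- a^-1)) `|a^-1|) => // x; rewrite normrN.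
- by move=> x; apply: is_derive_eq; rewrite /GRing.scale /=; field.
by split=> //; rewrite h2 mulr0 oppr0 expR0 mul1r sub0r opprK.
Qed.

Lemma halfline_trig a w (A B : R) : 0 < a ->
  mu.-integrable `[0, +oo[ (EFin \o (fun x : mR => expR (- (a * x)) * (A * cos (w * x) + B * sin (w * x)))) /\
  \int[mu]_(x in `[0, +oo[) (expR (- (a * x)) * (A * cos (w * x) + B * sin (w * x))) =
  (a * A + w * B) / (a ^+ 2 + w ^+ 2).
Proof.
move=> a0; have an : a != 0 by rewrite gt_eqF.
have dn : a ^+ 2 + w ^+ 2 != 0.
  by rewrite gt_eqF// ltr_wpDr ?sqr_ge0// exprn_gt0.
pose K := `|A| + `|B|.
have bd x : `|A * cos (w * x) + B * sin (w * x)| <= K.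
  apply: (le_trans (ler_normD _ _)); rewrite !normrM.
  by apply: lerD; rewrite -[leRHS]mulr1 ler_wpM2l// ler_norml ?cos_geN1 ?cos_le1 ?sin_geN1 ?sin_le1.
have cexp : continuous (fun x => expR (- (a * x))).
  move=> x; apply: (@continuous_comp _ _ _ (fun x => - (a * x)) expR); last exact: continuous_expR.
  by apply: cvgN; apply: cvgM; [exact: cvg_cst|exact: cvg_id].
have ctrig : continuous (fun x => A * cos (w * x) + B * sin (w * x)).
  move=> x; apply: cvgD; apply: cvgM; try exact: cvg_cst.
    apply: (@continuous_comp _ _ _ (fun x => w * x) cos); last exact: continuous_cos.
    by apply: cvgM; [exact: cvg_cst|exact: cvg_id].
  apply: (@continuous_comp _ _ _ (fun x => w * x) sin); last exact: continuous_sin.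
  by apply: cvgM; [exact: cvg_cst|exact: cvg_id].
pose C := (a * A + w * B) / (a ^+ 2 + w ^+ 2); pose D := (w * A - a * B) / (a ^+ 2 + w ^+ 2).
(* adding K makes the integrand nonnegative; the integral of K e^(-a x) is
   subtracted at the end *)
have [| | | |h1 h2] := @FTC_halfline
  (fun x => expR (- (a * x)) * (K + (A * cos (w * x) + B * sin (w * x))))
  (fun x => expR (- (a * x)) * (- K / a - C * cos (w * x) + D * sin (w * x))) 0.
- move=> x _; rewrite mulr_ge0 ?expR_ge0//.
  by have := bd x; rewrite ler_norml => /andP[+ _]; lra.
- by move=> x; apply: cvgM; [exact: cexp|apply: cvgD; [exact: cvg_cst|exact: ctrig]].
- apply: (@expR_decay a _ (`|K / a| + `|C| + `|D|)) => // x.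
  apply: (le_trans (ler_normD _ _)); apply: lerD; last first.
    by rewrite normrM -[leRHS]mulr1 ler_wpM2l// ler_norml sin_geN1 sin_le1.
  apply: (le_trans (ler_normB _ _)); rewrite mulNr normrN lerD2l.
  by rewrite normrM -[leRHS]mulr1 ler_wpM2l// ler_norml cos_geN1 cos_le1.
- move=> x; apply: is_derive_eq; rewrite /GRing.scale /= /C /D; field.
  by rewrite dn an.
have [i1 e1] := halfline_exp a0.
have i2 : mu.-integrable `[0, +oo[ (EFin \o (fun x : mR => expR (- (a * x)) * K)).
  rewrite (_ : _ \o _ = fun x => (K%:E * (EFin \o (fun x : mR => expR (- (a * x)))) x)%E).
    exact: integrableZl.
  by apply/funext => x /=; rewrite -EFinM mulrC.
have e x : expR (- (a * x)) * (A * cos (w * x) + B * sin (w * x)) =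
   expR (- (a * x)) * (K + (A * cos (w * x) + B * sin (w * x))) - expR (- (a * x)) * K by ring.
split.
  rewrite (_ : EFin \o _ = (fun x : mR => (EFin \o (fun x : mR => expR (- (a * x)) *
      (K + (A * cos (w * x) + B * sin (w * x))))%R) x -
      (EFin \o (fun x : mR => expR (- (a * x)) * K)%R) x)%E); last first.
    by apply/funext => x /=; rewrite e.
  exact: integrableB.
under eq_Rintegral do rewrite e.
rewrite RintegralB// h2; under [X in _ - X]eq_Rintegral do rewrite mulrC.
rewrite RintegralZl// e1 mulr0 oppr0 expR0 mulr0 cos0 sin0.
by rewrite /C; field; rewrite dn an.
Qed.

(** The exponential e^(-a x) cut off to the half-line where it decays: the right
one for a > 0, the left one for a < 0. *)
Definition etail a x : R := if 0 < a * x then expR (- (a * x)) else 0.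

Lemma etail_refl a x : etail a (- x) = etail (- a) x.
Proof. by rewrite /etail mulrN mulNr. Qed.

Lemma etail_trig_pos a w (A B : R) : 0 < a ->
  mu.-integrable [set: mR] (EFin \o (fun x : mR => etail a x * (A * cos (w * x) + B * sin (w * x)))) /\
  \int[mu]_x (etail a x * (A * cos (w * x) + B * sin (w * x))) =
  (a * A + w * B) / (a ^+ 2 + w ^+ 2).
Proof.
move=> a0; have [i1 e1] := halfline_trig w A B a0.
pose f (x : mR) := expR (- (a * x)) * (A * cos (w * x) + B * sin (w * x)).
have E : (fun x : mR => etail a x * (A * cos (w * x) + B * sin (w * x))) = f \_ `]0, +oo[.
  apply/funext => x; rewrite patchE; case: ifPn; rewrite ?inE ?notin_setE /= in_itv /= andbT /etail pmulr_rgt0//.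
    by move=> ->.
  by move=> /negP/negbTE ->; rewrite mul0r.
have sub : mu.-integrable `]0, +oo[ (EFin \o f).
  apply: (integrableS _ _ _ i1) => //.
  by move=> x /=; rewrite !in_itv/= !andbT => /ltW.
rewrite E; split.
  by rewrite -restrict_EFin; apply/integrable_restrict => //; rewrite setTI.
by rewrite -Rintegral_mkcond Rintegral_itv_obnd_cbnd.
Qed.

(** The real and imaginary parts of the transform of a tail are the cases
(A, B) = (1, 0) and (0, -1). *)
Lemma etail_trig a w (A B : R) : a != 0 ->
  mu.-integrable [set: mR] (EFin \o (fun x : mR => etail a x * (A * cos (w * x) + B * sin (w * x)))) /\
  \int[mu]_x (etail a x * (A * cos (w * x) + B * sin (w * x))) =
  Num.sg a * (a * A + w * B) / (a ^+ 2 + w ^+ 2).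
Proof.
move=> an; have [a0|a0|a0] := ltgtP a 0; last by rewrite a0 eqxx in an.
  have [] := @etail_trig_pos (- a) w A (- B) (ltac:(by rewrite oppr_gt0)) => /integrable_refl i1 e1.
  have e x : etail (- a) (- x) * (A * cos (w * - x) + - B * sin (w * - x)) =
             etail a x * (A * cos (w * x) + B * sin (w * x)).
    by rewrite etail_refl opprK mulrN cosN sinN mulrNN.
  split; first by move: i1; under eq_fun do rewrite e.
  rewrite ltr0_sg//; under eq_Rintegral do rewrite -e.
  have [i2 _] := @etail_trig_pos (- a) w A (- B) (ltac:(by rewrite oppr_gt0)).
  rewrite (Rintegral_refl i2) e1 sqrrN; congr (_ / _); ring.
by rewrite gtr0_sg// mul1r; exact: etail_trig_pos.
Qed.

End Exponentials.

(** * Transforms of exponential tails *)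

Section Lorentzians.
Context {R : realType}.
Local Notation mu := (@lebesgue_measure R).
Local Notation mR := (measurableTypeR R).
Implicit Types (a b w x : R).

(** Tails on opposite half-lines have product 0. *)
Lemma etail_prod a b x : a != 0 -> b != 0 ->
  etail a x * etail b x = if 0 < a * b then etail (a + b) x else 0.
Proof.
move=> an bn; rewrite /etail mulrDl; case: ifPn => h1; last first.
  rewrite mul0r; case: ifP => // h3; rewrite ifF//; apply/negbTE/negP => h4.
  move/negP: h1; apply; have [x0|x0|x0] := ltgtP x 0.
  - have [a0|a0|a0] := ltgtP a 0; first by nra.
    + have b0 : 0 < b by rewrite -(pmulr_rgt0 _ a0).
      have := mulr_gt0 a0; nra.
    + by rewrite a0 eqxx in an.
  - have [a0|a0|a0] := ltgtP a 0.
    + have b0 : b < 0 by nra.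
      nra.
    + nra.
    + by rewrite a0 eqxx in an.
  - by move: h4; rewrite x0 !mulr0 addr0 ltxx.
case: (ifPn (0 < b * x)) => h2.
  have ab : 0 < a * b.
    have x2 : 0 < x ^+ 2 by rewrite exprn_even_gt0//=; apply/eqP => x0; rewrite x0 mulr0 ltxx in h1.
    rewrite -(pmulr_lgt0 _ x2); have := mulr_gt0 h1 h2; congr (_ < _); ring.
  by rewrite ab addr_gt0// -expRD -opprD.
rewrite mulr0; case: ifP => // ab; exfalso; move/negP: h2; apply.
have a2 : 0 < a ^+ 2 by rewrite exprn_even_gt0.
rewrite -(pmulr_rgt0 _ a2); have := mulr_gt0 h1 ab; congr (_ < _); ring.
Qed.

Lemma integral_etail a : a != 0 -> mu.-integrable [set: mR] (EFin \o (fun x : mR => etail a x)) /\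
  \int[mu]_x etail a x = `|a|^-1.
Proof.
move=> an; have [i e] := etail_trig 0 1 0 an.
have E : (fun x : mR => etail a x * (1 * cos (0 * x) + 0 * sin (0 * x))) = etail a.
  by apply/funext => x; rewrite mul0r cos0 mul0r addr0 !mulr1.
rewrite E in i e; split => //; rewrite e !mulr1 mul0r addr0 expr0n/= addr0 -normrEsg.
by rewrite -real_normK ?num_real// expr2 invfM mulrA divff ?mul1r// normr_eq0.
Qed.

Definition cetail a x : R[i] := (etail a x)%:C.

Definition lorentz a w := (a ^+ 2 + (2 * pi * w) ^+ 2)^-1.

(** The function sg(a) / (a + 2 pi i w), by its real and imaginary parts. *)
Definition etail_hat a w : R[i] :=
  (Num.sg a * a * lorentz a w) -i* (Num.sg a * (2 * pi * w) * lorentz a w).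

Lemma lorentz_gt0 a w : a != 0 -> 0 < lorentz a w.
Proof. by move=> an; rewrite invr_gt0 ltr_wpDr ?sqr_ge0// exprn_even_gt0. Qed.

Lemma fourier1_cetail a w : a != 0 -> fourier1 (cetail a) w = etail_hat a w.
Proof.
move=> an; rewrite /fourier1 /cintegral /etail_hat /lorentz.
have e x : 2 * pi * x * w = 2 * pi * w * x by ring.
congr (_ +i* _).
  under eq_Rintegral => x _.
    rewrite (_ : Re _ = etail a x * (1 * cos (2 * pi * w * x) + 0 * sin (2 * pi * w * x))); last first.
      by rewrite /cetail Re_mul/= e; ring.
    over.
  by rewrite (etail_trig _ _ _ an).2; congr (_ / _); ring.
under eq_Rintegral => x _.
  rewrite (_ : Im _ = etail a x * (0 * cos (2 * pi * w * x) + (-1) * sin (2 * pi * w * x))); last first.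
    by rewrite /cetail Im_mul/= e; ring.
  over.
by rewrite (etail_trig _ _ _ an).2 -mulNr; congr (_ / _); ring.
Qed.

Lemma measurable_etail a : measurable_fun [set: mR] (fun x : mR => etail a x).
Proof.
have [->|an] := eqVneq a 0.
  rewrite (_ : (fun _ => _) = cst 0); first exact: measurable_cst.
  by apply/funext => x; rewrite /etail mul0r ltxx.
by case: (integral_etail an) => /integrableP[/measurable_EFinP].
Qed.

Lemma etail_ge0 a x : 0 <= etail a x.
Proof. by rewrite /etail; case: ifP => // _; exact: expR_ge0. Qed.

Lemma etail_le1 a x : etail a x <= 1.
Proof.
by rewrite /etail; case: ifP => // h; rewrite -expR0 ler_expR oppr_le0 ltW.
Qed.

Lemma cetail_inner_int a b : a != 0 -> b != 0 -> a + b != 0 ->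
  cintegrable (fun x => cetail a x * (cetail b x)^*) /\
  inner (cetail a) (cetail b) = (if 0 < a * b then `|a + b|^-1 else 0)%:C.
Proof.
move=> an bn abn.
have e x : cetail a x * (cetail b x)^* = (if 0 < a * b then etail (a + b) x else 0)%:C.
  by rewrite -etail_prod//; apply: complex_ext; rewrite /cetail !reimE /=; ring.
have [i1 e1] := integral_etail abn.
have E : (fun x => cetail a x * (cetail b x)^*) = fun x => (if 0 < a * b then etail (a + b) x else 0)%:C.
  exact/funext.
have R0 : \int[mu]_(_ in [set: mR]) (0 : R) = 0 by rewrite /Rintegral integral0.
rewrite /inner E /cintegral /cintegrable /=; case: (0 < a * b); split.
- by split => //; exact: integrable0.
- by rewrite R0 ?e1.
- by split; exact: integrable0.
- by rewrite R0 ?e1.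
Qed.

Lemma L2_cetail a : a != 0 -> in_Lp 2%:E (cetail a).
Proof.
move=> an; apply/in_Lp2P; split.
  by split; [exact: measurable_etail|exact: measurable_cst].
have [] := @integral_etail (a + a); first by rewrite -mulr2n mulrn_eq0.
move=> /integrableP[_ +] _; congr (_ < _)%E; apply: eq_integral => x _.
rewrite sqr_normcE /= ger0_norm ?etail_ge0// expr2 etail_prod//.
have -> : 0 < a * a by rewrite -expr2 exprn_even_gt0.
by rewrite expr0n addr0.
Qed.

Lemma L1_cetail a : a != 0 -> in_Lp 1%:E (cetail a).
Proof.
move=> an; apply/in_Lp1P; split; first by case: (integral_etail an).
exact: integrable0.
Qed.

Lemma lorentz_sym a w : lorentz a (- w) = lorentz a w.
Proof. by rewrite /lorentz mulrN sqrrN. Qed.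

(** An antiderivative is atan (2 pi w / a) / (2 pi a). *)
Lemma integral_lorentz a : a != 0 -> mu.-integrable [set: mR] (EFin \o (fun w : mR => lorentz a w)) /\
  \int[mu]_w lorentz a w = (2 * `|a|)^-1.
Proof.
move=> an; wlog a0 : a an / 0 < a.
  move=> H; have [a0|a0|a0] := ltgtP a 0; last by rewrite a0 eqxx in an.
    have -> : lorentz a = lorentz (- a) by rewrite /lorentz sqrrN.
    by rewrite -normrN; apply: H; rewrite ?oppr_eq0// oppr_gt0.
  exact: H.
have p0 : 0 < pi :> R by exact: pi_gt0.
have cl : continuous (lorentz a).
  move=> w; apply: cvgV; first by rewrite gt_eqF// -invr_gt0; exact: lorentz_gt0.
  apply: cvgD; first exact: cvg_cst.
  rewrite /=; apply: (@continuous_comp _ _ _ (fun w => 2 * pi * w) (fun x => x ^+ 2)).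
    by apply: cvgM; [exact: cvg_cst|exact: cvg_id].
  exact: exprn_continuous.
have [| | | |h1 h2] := @FTC_halfline _ (lorentz a) (fun w => (2 * pi * a)^-1 * atan (2 * pi / a * w))
  ((2 * pi * a)^-1 * (pi / 2)).
- by move=> x _; rewrite ltW// lorentz_gt0.
- exact: cl.
- apply: cvgM; first exact: cvg_cst.
  apply: (@cvg_comp _ _ _ (fun w => 2 * pi / a * w) atan _ +oo); last exact: cvgy_atan.
  by apply: gt0_cvgMry; [rewrite divr_gt0// mulr_gt0|exact: cvg_id].
- move=> x; apply: is_derive_eq; rewrite /GRing.scale /= /lorentz.
  have dn : a ^+ 2 + (2 * pi * x) ^+ 2 != 0 by rewrite gt_eqF// -invr_gt0; exact: lorentz_gt0.
  move: (pi) p0 dn => p p0 dn; field.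
  by rewrite dn an gt_eqF.
have E : (\int[mu]_w (lorentz a w)%:E)%E = ((2 * `|a|)^-1)%:E.
  rewrite ge0_symfun_integralT//; first last.
  - by move=> w /=; rewrite lorentz_sym.
  - by move=> w; rewrite ltW// lorentz_gt0.
  rewrite (_ : [set x | _] = `[0, +oo[%classic); last by apply/seteqP; split => x /=; rewrite in_itv/= andbT.
  have -> : (\int[mu]_(x in `[0%R, +oo[) (lorentz a x)%:E)%E = (\int[mu]_(x in `[0, +oo[) lorentz a x)%:E.
    rewrite /Rintegral fineK//; exact: integrable_fin_num.
  rewrite h2 -EFinM mulr0 atan0 mulr0 subr0; congr EFin; rewrite gtr0_norm//.
  move: (pi) p0 => p p0; field; by rewrite !gt_eqF.
split; last by rewrite /Rintegral E.
apply/integrableP; split; first by apply/measurable_EFinP; exact: continuous_measurable_fun.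
rewrite (_ : (\int[mu]_(x in _) _)%E = (\int[mu]_w (lorentz a w)%:E)%E); first by rewrite E ltry.
by apply: eq_integral => x _ /=; rewrite gtr0_norm// lorentz_gt0.
Qed.

Lemma measurable_lorentz a : a != 0 -> measurable_fun [set: mR] (fun w : mR => lorentz a w).
Proof. by move=> an; case: (integral_lorentz an) => /integrableP[/measurable_EFinP]. Qed.

Lemma cmeas_etail_hat a : a != 0 -> cmeas (etail_hat a).
Proof.
move=> an; split => /=.
  by apply: measurable_funM; [exact: measurable_cst|exact: measurable_lorentz].
apply: measurable_funN; apply: measurable_funM; last exact: measurable_lorentz.
apply: measurable_funM; first exact: measurable_cst.
by apply: measurable_funM; [exact: measurable_cst|exact: measurable_id].
Qed.

Lemma L2_etail_hat a : a != 0 -> in_Lp 2%:E (etail_hat a).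
Proof.
move=> an; apply/in_Lp2P; split; first exact: cmeas_etail_hat.
have [/integrableP[_ +] _] := integral_lorentz an.
congr (_ < _)%E; apply: eq_integral => x _.
rewrite sqr_normcE /= gtr0_norm ?lorentz_gt0//; congr EFin.
have dn : a ^+ 2 + (2 * pi * x) ^+ 2 != 0 by rewrite gt_eqF// -invr_gt0; exact: lorentz_gt0.
have s2 : Num.sg a ^+ 2 = 1 by rewrite sqr_sg an.
transitivity (Num.sg a ^+ 2 * ((a ^+ 2 + (2 * pi * x) ^+ 2) * lorentz a x) * lorentz a x); last by ring.
by rewrite /lorentz divff ?s2 ?mul1r.
Qed.

(** For the real part, partial fractions:
(a b + W^2) lorentz a lorentz b = (a lorentz a + b lorentz b) / (a + b) where
W = 2 pi w; the imaginary part is odd. The value is the inner product of the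
tails themselves. *)
Lemma etail_hat_inner a b : a != 0 -> b != 0 -> a + b != 0 ->
  inner (etail_hat a) (etail_hat b) = (if 0 < a * b then `|a + b|^-1 else 0)%:C.
Proof.
move=> an bn abn; have [i1 i2] := L2_inner (L2_etail_hat an) (L2_etail_hat bn).
have D c w : c != 0 -> c ^+ 2 + (2 * pi * w) ^+ 2 != 0.
  by move=> cn; rewrite gt_eqF// -invr_gt0; exact: lorentz_gt0.
have E2 : \int[mu]_w Im (etail_hat a w * (etail_hat b w)^*) = 0.
  apply: (Rintegral_odd i2) => w.
  by rewrite !Im_mul !ReJ !ImJ /= !lorentz_sym !mulrN !mulNr; ring.
have e w : Re (etail_hat a w * (etail_hat b w)^*) =
    Num.sg a * Num.sg b / (a + b) * a * lorentz a w + Num.sg a * Num.sg b / (a + b) * b * lorentz b w.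
  rewrite Re_mul ReJ ImJ /= /lorentz.
  move: (D a w an) (D b w bn) => da db; move: (2 * pi * w) da db => W da db.
  move: (Num.sg a) (Num.sg b) => sa sb; field.
  by rewrite da db abn.
have [ia ea] := integral_lorentz an; have [ib eb] := integral_lorentz bn.
suff E1 : \int[mu]_w Re (etail_hat a w * (etail_hat b w)^*) = if 0 < a * b then `|a + b|^-1 else 0.
  by rewrite /inner /cintegral E1 E2.
under eq_Rintegral do rewrite e.
rewrite RintegralD ?RintegralZl ?ea ?eb//; try exact: integrable_scale.
have [a0|a0|a0] := ltgtP a 0; have [b0|b0|b0] := ltgtP b 0; rewrite ?a0 ?b0 ?eqxx// in an bn.
- rewrite nmulr_rgt0// b0 !ltr0_sg// !ltr0_norm//; last by rewrite -oppr_gt0 opprD addr_gt0// oppr_gt0.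
  by field; rewrite an bn abn.
- rewrite nmulr_rgt0// ltNge ltW//= (ltr0_sg a0) (gtr0_sg b0) (ltr0_norm a0) (gtr0_norm b0).
  by field; rewrite an bn abn.
- rewrite pmulr_rgt0// ltNge ltW//= (gtr0_sg a0) (ltr0_sg b0) (gtr0_norm a0) (ltr0_norm b0).
  by field; rewrite an bn abn.
- rewrite pmulr_rgt0// b0 !gtr0_sg// !gtr0_norm//; last by rewrite addr_gt0.
  by field; rewrite an bn abn.
Qed.

End Lorentzians.

(** * The multiplication formula *)

Section Density.
Context {R : realType}.
Local Notation mu := (@lebesgue_measure R).
Local Notation mR := (measurableTypeR R).
Implicit Types (a b w x : R).

Lemma Fubini_kernel_aux (u v : mR -> R) (k : mR * mR -> R) :
  mu.-integrable [set: mR] (EFin \o u) -> mu.-integrable [set: mR] (EFin \o v) ->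
  measurable_fun [set: mR * mR] k -> (forall z, `|k z| <= 1) ->
  mu.-integrable [set: mR] (EFin \o (fun x => u x * \int[mu]_y (v y * k (x, y)))) /\
  \int[mu]_y ((\int[mu]_x (u x * k (x, y))) * v y) =
  \int[mu]_x (u x * \int[mu]_y (v y * k (x, y))).
Proof.
move=> iu iv mk k1.
have mu_ : measurable_fun [set: mR] u by case/integrableP: iu => /measurable_EFinP.
have mv : measurable_fun [set: mR] v by case/integrableP: iv => /measurable_EFinP.
pose F (z : mR * mR) := u z.1 * v z.2 * k z.
have mF : measurable_fun [set: mR * mR] F.
  apply: measurable_funM => //; apply: measurable_funM.
    by apply: measurableT_comp => //; exact: measurable_fst.
  by apply: measurableT_comp => //; exact: measurable_snd.
have mF' : measurable_fun [set: mR * mR] (EFin \o F) by apply/measurable_EFinP.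
have i1 y := integrable_bounded iu (measurableT_comp mk (measurable_pair2 y)) (fun x => k1 (x, y)).
have i2 x := integrable_bounded iv (measurableT_comp mk (measurable_pair1 x)) (fun y => k1 (x, y)).
have iF : (mu \x mu)%E.-integrable [set: mR * mR] (EFin \o F).
  apply/(integrable12ltyP mu mu mF').
  have [_ fu] := integrableP _ _ _ iu; have [_ fv] := integrableP _ _ _ iv.
  apply: (@le_lt_trans _ _ (\int[mu]_x (`|(u x)%:E| * \int[mu]_y `|(v y)%:E|))%E).
    apply: ge0_le_integral => //.
    - by move=> x _; exact: integral_ge0.
    - apply: (measurable_fun_fubini_tonelli_F (abse \o (EFin \o F))) => //.
        exact: measurableT_comp.
      by move=> z; exact: abse_ge0.
    - apply: emeasurable_funM; last exact: measurable_cst.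
      by apply: measurableT_comp => //; exact/measurable_EFinP.
    - move=> x _; rewrite -ge0_integralZl//; last first.
        by apply: measurableT_comp => //; exact/measurable_EFinP.
      apply: ge0_le_integral => //.
      + by apply: measurableT_comp => //; apply: (measurableT_comp mF'); exact: measurable_pair1.
      + apply: emeasurable_funM; first exact: measurable_cst.
        by apply: measurableT_comp => //; exact/measurable_EFinP.
      + move=> y _; rewrite /F /= -EFinM lee_fin !normrM -[leRHS]mulr1 ler_wpM2l//.
  rewrite ge0_integralZr//.
  - by apply: lte_mul_pinfty => //; [exact: integral_ge0|rewrite ge0_fin_numE//; exact: integral_ge0].
  - by apply: measurableT_comp => //; exact/measurable_EFinP.
  - exact: integral_ge0.
have e1 : (fun x => \int[mu]_y (EFin \o F) (x, y))%E = EFin \o (fun x => u x * \int[mu]_y (v y * k (x, y))).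
  apply/funext => x /=; rewrite -(RintegralZl (u x) measurableT (i2 x)).
  rewrite /Rintegral fineK.
    by apply: eq_integral => y _; rewrite /F /= mulrA.
  have := integrable_fin_num measurableT (integrable_scale (u x) (i2 x)).
  by congr (_ \in _); apply: eq_integral.
have e2 : (fun y => \int[mu]_x (EFin \o F) (x, y))%E = EFin \o (fun y => (\int[mu]_x (u x * k (x, y))) * v y).
  apply/funext => y /=; rewrite mulrC -(RintegralZl (v y) measurableT (i1 y)).
  rewrite /Rintegral fineK.
    by apply: eq_integral => x _; rewrite /F /= mulrCA mulrA.
  have := integrable_fin_num measurableT (integrable_scale (v y) (i1 y)).
  by congr (_ \in _); apply: eq_integral.
split.
  by have := integrable_fubini_F iF; rewrite /fubini_F e1.
by rewrite /Rintegral; congr fine; have := Fubini iF; rewrite e1 e2 => ->.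
Qed.

Lemma Fubini_kernel (u v : mR -> R) (k : mR * mR -> R) :
  mu.-integrable [set: mR] (EFin \o u) -> mu.-integrable [set: mR] (EFin \o v) ->
  measurable_fun [set: mR * mR] k -> (forall z, `|k z| <= 1) ->
  [/\ mu.-integrable [set: mR] (EFin \o (fun y => (\int[mu]_x (u x * k (x, y))) * v y)),
      mu.-integrable [set: mR] (EFin \o (fun x => u x * \int[mu]_y (v y * k (x, y)))) &
      \int[mu]_y ((\int[mu]_x (u x * k (x, y))) * v y) =
      \int[mu]_x (u x * \int[mu]_y (v y * k (x, y)))].
Proof.
move=> iu iv mk k1; have [h1 h2] := Fubini_kernel_aux iu iv mk k1; split => //.
have [| |h3 _] := @Fubini_kernel_aux v u (fun z => k (z.2, z.1)) iv iu.
- by apply: measurableT_comp mk _; exact: measurable_swap.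
- by move=> z; exact: k1.
by apply: eq_integrable h3 => // y _ /=; rewrite mulrC.
Qed.

Lemma measurable_angle : measurable_fun [set: mR * mR] (fun z : mR * mR => 2 * pi * z.1 * z.2).
Proof.
apply: measurable_funM; last exact: measurable_snd.
by apply: measurable_funM; [exact: measurable_cst|exact: measurable_fst].
Qed.

Lemma measurable_cos_angle : measurable_fun [set: mR * mR] (fun z : mR * mR => cos (2 * pi * z.1 * z.2)).
Proof.
apply: (measurableT_comp _ measurable_angle).
by apply: continuous_measurable_fun; exact: continuous_cos.
Qed.

Lemma measurable_sin_angle : measurable_fun [set: mR * mR] (fun z : mR * mR => sin (2 * pi * z.1 * z.2)).
Proof.
apply: (measurableT_comp _ measurable_angle).
by apply: continuous_measurable_fun; exact: continuous_sin.
Qed.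

Lemma cos_norm1 x : `|cos x| <= 1. Proof. by rewrite ler_norml cos_geN1 cos_le1. Qed.
Lemma sin_norm1 x : `|sin x| <= 1. Proof. by rewrite ler_norml sin_geN1 sin_le1. Qed.

(** Fubini: the kernel e^(-2 pi i x w) is symmetric in x and w. Taking v real
suffices for the pairing with tails. *)
Lemma multiplication_formula (g : R -> R[i]) (v : mR -> R) : cintegrable g ->
  mu.-integrable [set: mR] (EFin \o v) ->
  cintegral (fun w => fourier1 g w * (v w)%:C) =
  cintegral (fun x => g x * fourier1 (fun y => (v y)%:C) x).
Proof.
move=> [i1 i2] iv.
pose g1 (x : mR) := Re (g x); pose g2 (x : mR) := Im (g x).
pose kc (z : mR * mR) := cos (2 * pi * z.1 * z.2); pose ks (z : mR * mR) := sin (2 * pi * z.1 * z.2).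
have mk z : measurable_fun [set: mR] (fun x : mR => cos (2 * pi * x * z)).
  exact: (measurableT_comp measurable_cos_angle (measurable_pair2 z)).
have msk z : measurable_fun [set: mR] (fun x : mR => sin (2 * pi * x * z)).
  exact: (measurableT_comp measurable_sin_angle (measurable_pair2 z)).
have hc p z : mu.-integrable [set: mR] (EFin \o p) ->
    mu.-integrable [set: mR] (EFin \o (fun x : mR => p x * kc (x, z))).
  by move=> ip; exact: (integrable_bounded ip (mk z) (fun _ => cos_norm1 _)).
have hs p z : mu.-integrable [set: mR] (EFin \o p) ->
    mu.-integrable [set: mR] (EFin \o (fun x : mR => p x * ks (x, z))).
  by move=> ip; exact: (integrable_bounded ip (msk z) (fun _ => sin_norm1 _)).
have FC p : mu.-integrable [set: mR] (EFin \o p) -> _ :=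
  fun ip => @Fubini_kernel p v kc ip iv measurable_cos_angle (fun _ => cos_norm1 _).
have FS p : mu.-integrable [set: mR] (EFin \o p) -> _ :=
  fun ip => @Fubini_kernel p v ks ip iv measurable_sin_angle (fun _ => sin_norm1 _).
pose C (p : mR -> R) y := \int[mu]_x (p x * kc (x, y)).
pose S (p : mR -> R) y := \int[mu]_x (p x * ks (x, y)).
have eg w : fourier1 g w = (C g1 w + S g2 w) +i* (C g2 w - S g1 w).
  rewrite /fourier1 /cintegral; congr (_ +i* _).
    rewrite -RintegralD//; [|exact: hc|exact: hs].
    by apply: eq_Rintegral => x _; rewrite Re_mul /= /g1 /g2 /kc /ks /=; ring.
  rewrite -RintegralB//; [|exact: hc|exact: hs].
  by apply: eq_Rintegral => x _; rewrite Im_mul /= /g1 /g2 /kc /ks /=; ring.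
have ev x : fourier1 (fun y => (v y)%:C) x =
    (\int[mu]_y (v y * kc (x, y))) -i* (\int[mu]_y (v y * ks (x, y))).
  rewrite /fourier1 /cintegral; congr (_ +i* _).
    by apply: eq_Rintegral => y _; rewrite Re_mul /= /kc /= (mulrAC _ x y); ring.
  rewrite -mulN1r -RintegralZl//; last first.
    exact: (integrable_bounded iv (measurableT_comp measurable_sin_angle (measurable_pair1 x)) (fun _ => sin_norm1 _)).
  by apply: eq_Rintegral => y _; rewrite Im_mul /= /ks /= (mulrAC _ x y); ring.
have [c1 c1' c1e] := FC _ i1; have [c2 c2' c2e] := FC _ i2.
have [s1 s1' s1e] := FS _ i1; have [s2 s2' s2e] := FS _ i2.
rewrite /cintegral; congr (_ +i* _).
  transitivity (\int[mu]_w (C g1 w * v w) + \int[mu]_w (S g2 w * v w)).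
    rewrite -RintegralD//; apply: eq_Rintegral => w _.
    by rewrite eg Re_mul /=; ring.
  rewrite c1e s2e -RintegralD//; apply: eq_Rintegral => x _.
  by rewrite ev Re_mul /= /g1 /g2; ring.
transitivity (\int[mu]_w (C g2 w * v w) - \int[mu]_w (S g1 w * v w)).
  rewrite -RintegralB//; apply: eq_Rintegral => w _.
  by rewrite eg Im_mul /=; ring.
rewrite c2e s1e -RintegralB//; apply: eq_Rintegral => x _.
by rewrite ev Im_mul /= /g1 /g2; ring.
Qed.

End Density.

(** * Exponential tails are total *)

Section Total.
Context {R : realType}.
Local Notation mu := (@lebesgue_measure R).
Local Notation mR := (measurableTypeR R).
Implicit Types (a b w x : R).

Lemma etail_pow a b x n : 0 < a * b -> etail a x * etail b x ^+ n = etail (a + b * n%:R) x.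
Proof.
move=> ab; have an : a != 0 by apply/eqP => a0; rewrite a0 mul0r ltxx in ab.
have abn m : 0 < a * (a + b * m%:R).
  have a2 : 0 < a * a by rewrite -expr2 exprn_even_gt0.
  by have := mulr_ge0 (ltW ab) (ler0n R m); rewrite -mulrA mulrDr; lra.
elim: n => [|n IH]; first by rewrite mulr0 addr0 expr0 mulr1.
have bn : b != 0 by apply/eqP => b0; rewrite b0 mulr0 ltxx in ab.
have cn : a + b * n%:R != 0 by apply/eqP => c0; have := abn n; rewrite c0 mulr0 ltxx.
rewrite exprS mulrCA IH mulrC etail_prod// -addrA.
rewrite ifT; first by rewrite -[in RHS]natr1 mulrDr mulr1.
have a2 : 0 < a ^+ 2 by rewrite exprn_even_gt0.
rewrite -(pmulr_rgt0 _ a2); have := mulr_gt0 (abn n) ab; congr (_ < _); ring.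
Qed.

(** With u = r etail_a, all moments of u against the bounded function
v = e^(-b x) vanish, so u has integral 0 over every Borel set defined by v. The
function v determines x on the half-line, so the set where r > 0 can be taken. *)
Lemma etail_total_le a b (r : mR -> R) : 0 < a * b -> measurable_fun [set: mR] r ->
  mu.-integrable [set: mR] (EFin \o (fun x : mR => r x * etail a x)) ->
  (forall n, \int[mu]_x (r x * etail (a + b * n%:R) x) = 0) ->
  {ae mu, forall x, 0 < a * x -> r x <= 0}.
Proof.
move=> ab mr iu h0.
have bn : b != 0 by apply/eqP => b0; rewrite b0 mulr0 ltxx in ab.
pose g y : R := - ln y / b; pose B := [set y : mR | 0 < y /\ 0 < r (g y)].
have mg : measurable_fun [set: mR] (g : mR -> mR).
  apply: measurable_funM; last exact: measurable_cst.
  by apply: measurable_funN; exact: measurable_ln.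
have mB : measurable B.
  rewrite (_ : B = `]0, +oo[%classic `&` ((r \o g) @^-1` `]0, +oo[%classic)).
    apply: measurableI => //; rewrite -[X in measurable X]setTI.
    by have := measurableT_comp mr mg; apply.
  by apply/seteqP; split => y /=; rewrite !in_itv/= !andbT.
have hz := @moment_zero R (fun x => r x * etail a x) (etail b) 1 B iu (measurable_etail b).
have {}hz : \int[mu]_x (r x * etail a x * \1_B (etail b x)) = 0.
  apply: hz => //.
    by move=> x; rewrite ger0_norm ?etail_ge0 ?etail_le1.
  by move=> n; rewrite -[RHS](h0 n); apply: eq_Rintegral => x _; rewrite -mulrA etail_pow.
have bx x : 0 < a * x -> 0 < b * x.
  have a2 : 0 < a ^+ 2 by rewrite exprn_even_gt0//=; apply/eqP => a0; rewrite a0 mul0r ltxx in ab.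
  move=> ax; rewrite -(pmulr_rgt0 _ a2); have := mulr_gt0 ax ab; congr (_ < _); ring.
have u0 x : 0 <= r x * etail a x * \1_B (etail b x).
  have [ax|ax] := ltP 0 (a * x); last by rewrite /etail ltNge ax /= mulr0 mul0r.
  rewrite indicE; case: (boolP (_ \in _)) => hB; last by rewrite mulr0.
  move: hB; rewrite inE /B /g /= /etail bx// expRK opprK mulrAC divff// mul1r => -[_ rx].
  by rewrite mulr1 mulr_ge0 ?etail_ge0// ltW.
have iB : mu.-integrable [set: mR] (EFin \o (fun x => r x * etail a x * \1_B (etail b x))).
  apply: (integrable_bounded (K := 1)) => //.
    rewrite (_ : (fun x => _) = (\1_B : mR -> R) \o (etail b : mR -> mR))//.
    by apply: measurableT_comp => //; exact: measurable_etail.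
  by move=> x; rewrite indicE; case: (_ \in _); rewrite ?normr0 ?normr1.
have [mE _] := integrableP _ _ _ iB.
have : (\int[mu]_x `|(EFin \o (fun x => (r x * etail a x * \1_B (etail b x))%R)) x| = 0)%E.
  rewrite (_ : (\int[mu]_x _)%E = (\int[mu]_x (r x * etail a x * \1_B (etail b x))%:E)%E).
    have := integrable_fin_num measurableT iB => /fineK <-.
    by congr EFin; exact: hz.
  by apply: eq_integral => x _ /=; rewrite ger0_norm.
move=> /(ae_eq_integral_abs mu measurableT mE).1; apply: ae_mono => x /(_ I) [] h ax.
rewrite leNgt; apply/negP => rx; move: h; rewrite indicE mem_set/=; last first.
  by rewrite /B /g /= /etail bx// expR_gt0 expRK opprK mulrAC divff// mul1r.
rewrite mulr1 /etail ax => /eqP; rewrite mulf_eq0 => /orP[/eqP r0|]; first by rewrite r0 ltxx in rx.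
by rewrite gt_eqF// expR_gt0.
Qed.

Lemma etail_total a b (r : mR -> R) : 0 < a * b -> measurable_fun [set: mR] r ->
  mu.-integrable [set: mR] (EFin \o (fun x : mR => r x * etail a x)) ->
  (forall n, \int[mu]_x (r x * etail (a + b * n%:R) x) = 0) ->
  {ae mu, forall x, 0 < a * x -> r x = 0}.
Proof.
move=> ab mr iu h0; have h1 := etail_total_le ab mr iu h0.
have ii n : mu.-integrable [set: mR] (EFin \o (fun x : mR => r x * etail (a + b * n%:R) x)).
  have := @integrable_bounded R _ (fun x => etail b x ^+ n) 1 iu (measurable_funX n (measurable_etail b)).
  rewrite (_ : (fun x => _) = (fun x => r x * etail (a + b * n%:R) x)); last first.
    by apply/funext => x; rewrite -etail_pow// mulrA.
  by apply => x; rewrite normrX exprn_ile1// ger0_norm ?etail_ge0 ?etail_le1.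
have h2 : {ae mu, forall x, 0 < a * x -> - r x <= 0}.
  apply: (@etail_total_le a b (fun x => - r x)) => //.
  - exact: measurable_funN.
  - have := integrable_scale (-1) iu; apply: eq_integrable => // x _ /=.
    by rewrite mulN1r mulNr.
  - move=> n.
    rewrite -[RHS]oppr0 -(h0 n) -mulN1r -(RintegralZl (-1) measurableT (ii n)).
    by apply: eq_Rintegral => x _; ring.
apply: ae_mono (ae_and h1 h2) => x [k1 k2] ax; apply/eqP; rewrite eq_le k1//=.
by have := k2 ax; rewrite oppr_le0.
Qed.

(** No two of these rates have sum 0, the one case that the formula for the Gram
matrix leaves out. *)
Definition rate (i : bool * nat) : R := if i.1 then 1 + 2 * i.2%:R else -2 + -2 * i.2%:R.

Lemma rate_add_neq0 i j : rate i + rate j != 0.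
Proof.
have mixed m n : 1 + 2 * m%:R + (-2 + -2 * n%:R) != 0 :> R.
  rewrite (_ : _ + _ = (m.*2.+1)%:R - (n.*2.+2)%:R).
    by rewrite subr_eq0 eqr_nat eqSS; apply/eqP => /(congr1 odd); rewrite /= !odd_double.
  by rewrite -!natr1 -!muln2 !natrM; ring.
rewrite /rate; case: i j => [[] m] [[] n] /=.
- by rewrite gt_eqF//; have := ler0n R m; have := ler0n R n; lra.
- exact: mixed.
- by rewrite addrC; exact: mixed.
- by rewrite lt_eqF//; have := ler0n R m; have := ler0n R n; lra.
Qed.

Lemma rate_neq0 i : rate i != 0.
Proof. by have := rate_add_neq0 i i; rewrite -mulr2n mulrn_eq0. Qed.

Lemma ae_neq0 : {ae mu, forall x : R, x <> 0}.
Proof.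
exists [set 0]; split => //; first exact: lebesgue_measure_set1.
by move=> x /= /contrapT.
Qed.

(** The rates on each side of 0 form an arithmetic progression, so etail_total
applies on both half-lines. *)
Lemma cetail_total (x : L2 R) : (forall i, inner x (cetail (rate i)) = 0) -> {ae mu, forall t, x t = 0}.
Proof.
move=> h0; have [mre mim] := ((in_Lp2P _).1 (L2P x)).1.
have mulE i t : x t * (cetail (rate i) t)^* = (Re (x t) * etail (rate i) t) +i* (Im (x t) * etail (rate i) t).
  rewrite /cetail; case: (x t) => p q; apply: complex_ext; rewrite !reimE.
    rewrite -[RHS]/(p * etail (rate i) t) /=; ring.
  rewrite -[RHS]/(q * etail (rate i) t) /=; ring.
have hi i := L2_inner (L2P x) (L2_cetail (rate_neq0 i)).
have zre i : \int[mu]_t (Re (x t) * etail (rate i) t) = 0.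
  have := congr1 (@Re R) (h0 i); rewrite /= => <-; apply: eq_Rintegral => t _.
  by rewrite mulE.
have zim i : \int[mu]_t (Im (x t) * etail (rate i) t) = 0.
  have := congr1 (@Im R) (h0 i); rewrite /= => <-; apply: eq_Rintegral => t _.
  by rewrite mulE.
have ire i : mu.-integrable [set: mR] (EFin \o (fun t : mR => Re (x t) * etail (rate i) t)).
  by have [+ _] := hi i; apply: eq_integrable => // t _ /=; rewrite mulE.
have iim i : mu.-integrable [set: mR] (EFin \o (fun t : mR => Im (x t) * etail (rate i) t)).
  by have [_ +] := hi i; apply: eq_integrable => // t _ /=; rewrite mulE.
have a1 : rate (true, 0%N) = 1 by rewrite /rate /= mulr0 addr0.
have a2 : rate (false, 0%N) = -2 by rewrite /rate /= mulr0 addr0.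
have p1 : 0 < 1 * 2 :> R by rewrite mulr_gt0.
have p2 : 0 < -2 * -2 :> R by rewrite mulrNN mulr_gt0.
have i1 := ire (true, 0%N); have i2 := ire (false, 0%N).
have i3 := iim (true, 0%N); have i4 := iim (false, 0%N).
rewrite a1 in i1 i3; rewrite a2 in i2 i4.
have k1 := etail_total p1 mre i1 (fun n => zre (true, n)).
have k2 := etail_total p2 mre i2 (fun n => zre (false, n)).
have k3 := etail_total p1 mim i3 (fun n => zim (true, n)).
have k4 := etail_total p2 mim i4 (fun n => zim (false, n)).
apply: ae_mono (ae_and (ae_and (ae_and k1 k2) (ae_and k3 k4)) ae_neq0) => t [[[e1 e2] [e3 e4]] tn].
have [t0|t0|t0] := ltgtP t 0; last by [].
  have n0 : 0 < -2 * t by lra.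
  by apply: complex_ext => /=; [exact: e2|exact: e4].
have n0 : 0 < 1 * t by lra.
by apply: complex_ext => /=; [exact: e1|exact: e3].
Qed.

End Total.

(** * The Fourier transform on L^2 *)

Section FourierL2.
Context {R : realType}.
Local Notation mu := (@lebesgue_measure R).
Local Notation mR := (measurableTypeR R).
Local Notation H := (@L2H R).
Local Notation nrm := (nrm H).
Local Notation "''[' x , y ]" := (ip H x y).
Local Notation I := (bool * nat)%type.
Implicit Types (x y X Y : L2 R) (i : I).

Definition etailv i : L2 R := mkL2 (L2_cetail (rate_neq0 i)).
Definition etail_hatv i : L2 R := mkL2 (L2_etail_hat (rate_neq0 i)).
Definition etail_hatcv i : L2 R := mkL2 (L2J (L2_etail_hat (rate_neq0 i))).

(** Hence linear combinations of tails have the same mutual distances as the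
corresponding combinations of their transforms. *)
Lemma gram_cetail_etail_hat i j : '[etailv i, etailv j] = '[etail_hatv i, etail_hatv j].
Proof.
have n := @rate_add_neq0 R i j; have ni := @rate_neq0 R i; have nj := @rate_neq0 R j.
by rewrite -[LHS]/(inner (cetail _) (cetail _)) -[RHS]/(inner (etail_hat _) (etail_hat _)) etail_hat_inner// (cetail_inner_int ni nj n).2.
Qed.

Lemma ip_comb (J J' : {fset I}) (c c' : I -> R[i]) :
  '[\sum_(i <- J) c i *: etailv i, \sum_(i <- J') c' i *: etailv i] =
  '[\sum_(i <- J) c i *: etail_hatv i, \sum_(i <- J') c' i *: etail_hatv i].
Proof.
rewrite !ip_suml; apply: eq_bigr => i _.
rewrite !ip_sumr; apply: eq_bigr => j _.
by rewrite !ipZl !ipZr gram_cetail_etail_hat.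
Qed.

Lemma nrm_nconv_le (u v : nat -> L2 R) x y : nconv H u x -> nconv H v y ->
  (forall n, nrm (u n) = nrm (v n)) -> nrm x <= nrm y.
Proof.
move=> ux vy uv; apply/ler_addgt0Pr => e e0.
have e2 : 0 < e / 2 by rewrite divr_gt0.
have [N1 h1] := ux _ e2; have [N2 h2] := vy _ e2; pose n := maxn N1 N2.
have := h1 n (leq_maxl _ _); have := h2 n (leq_maxr _ _) => k2 k1.
have := ler_nrmD H (x - u n) (u n); rewrite subrK nrmB uv => k3.
have := ler_nrmD H (v n - y) y; rewrite subrK => k4.
lra.
Qed.

(** A vector orthogonal to the closed span vanishes by totality. *)
Lemma cetail_span x : closed_span H etailv x.
Proof.
have cV := closed_span_closed H etailv.
have [p Vp hp] := projection x cV.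
apply: (closed_subspace_ae cV _ Vp).
have : {ae mu, forall t, (x - p : L2 R) t = 0}.
  by apply: cetail_total => i; exact: (hp (etailv i) (closed_span_gen H etailv i)).
by apply: ae_mono => t /eqP; rewrite L2addE L2oppE subr_eq0 => /eqP.
Qed.

Lemma cintegrable0 : cintegrable (fun _ : R => 0 : R[i]).
Proof. by split; exact: integrable0. Qed.

Lemma cintegrable_unit (g : R -> R[i]) (e : R -> R[i]) : cintegrable g -> cmeas e ->
  (forall t, normc (e t) = 1) -> cintegrable (fun t => g t * e t).
Proof.
move=> ig me e1; apply: (cintegrable_le _ ig).
  by apply: (cmeasM _ me); exact: cintegrable_meas.
by move=> t; rewrite normcMl e1 mulr1.
Qed.

Lemma normc_trig (t : R) : normc (cos t -i* sin t) = 1.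
Proof. by rewrite /= sqrrN cos2Dsin2 sqrtr1. Qed.

Lemma cmeas_trig (c : R) : cmeas (fun t => cos (c * t) -i* sin (c * t)).
Proof.
have m : measurable_fun [set: mR] (fun t : mR => c * t).
  by apply: measurable_funM; [exact: measurable_cst|exact: measurable_id].
split => /=.
  by apply: measurableT_comp m; apply: continuous_measurable_fun; exact: continuous_cos.
apply: measurable_funN.
by apply: measurableT_comp m; apply: continuous_measurable_fun; exact: continuous_sin.
Qed.

Lemma fourier1_kernel_integrable (g : R -> R[i]) w : cintegrable g ->
  cintegrable (fun t => g t * (cos (2 * pi * t * w) -i* sin (2 * pi * t * w))).
Proof.
move=> ig; apply: cintegrable_unit => //; last by move=> t; exact: normc_trig.
by have := cmeas_trig (2 * pi * w); under eq_fun do rewrite mulrAC.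
Qed.

Lemma fourier1DZ a (g h : R -> R[i]) w : cintegrable g -> cintegrable h ->
  fourier1 (fun t => a * g t + h t) w = a * fourier1 g w + fourier1 h w.
Proof.
move=> ig ih; have kg := fourier1_kernel_integrable w ig; have kh := fourier1_kernel_integrable w ih.
rewrite /fourier1 -(cintegralZ a kg) -(cintegralD (cintegrableZ a kg) kh).
by congr cintegral; apply/funext => t; rewrite /= mulrDl mulrA.
Qed.

Lemma fourier1_0 w : fourier1 (fun _ : R => 0 : R[i]) w = 0.
Proof.
have e := fourier1DZ (-1) w cintegrable0 cintegrable0.
have z : (fun _ : R => -1 * 0 + 0 : R[i]) = fun=> 0 by apply/funext => t; rewrite mulr0 addr0.
by rewrite z mulN1r in e; rewrite e addNr.
Qed.

Lemma fourier1_comb (J : {fset I}) (c : I -> R[i]) :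
  cintegrable (\sum_(i <- J) c i *: etailv i : L2 R) /\
  fourier1 (\sum_(i <- J) c i *: etailv i : L2 R) = (\sum_(i <- J) c i *: etail_hatv i : L2 R) :> (R -> R[i]).
Proof.
elim/big_rec2: _ => [|i y x _ [iy ey]].
  split; first exact: cintegrable0.
  by apply/funext => w; exact: fourier1_0.
have iE := (in_Lp1P _).1 (L1_cetail (@rate_neq0 R i)).
split; first exact: cintegrableD (cintegrableZ (c i) iE) iy.
apply/funext => w; rewrite [RHS]/(c i * etail_hat (rate i) w + y w) -ey -fourier1_cetail ?rate_neq0//.
exact: fourier1DZ.
Qed.

(** Approximate x by sums of tails; their transforms have the same mutual
distances, hence converge. *)
Lemma fourier_exists x : exists X, is_fourier x X /\ nrm X = nrm x.
Proof.
have /choice [s hs] n : exists s : {fset I} * (I -> R[i]),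
    nrm (x - \sum_(i <- s.1) s.2 i *: etailv i) < n.+1%:R^-1.
  have [|J [c h]] := cetail_span x (e := n.+1%:R^-1); first by rewrite invr_gt0.
  by exists (J, c).
pose u n := \sum_(i <- (s n).1) (s n).2 i *: etailv i.
pose v n := \sum_(i <- (s n).1) (s n).2 i *: etail_hatv i.
have small (e : R) : 0 < e -> exists N, forall n, (N <= n)%N -> nrm (x - u n) < e.
  move=> /archi_lt[N hN]; exists N => n Nn; apply: (lt_trans (hs n)).
  by apply: le_lt_trans hN; rewrite lef_pV2 ?posrE ?ltr0n// ler_nat ltnS.
have uvip m n : '[u m, u n] = '[v m, v n] := ip_comb _ _ _ _.
have uv n : nrm (u n) = nrm (v n) by rewrite !nrmE uvip.
have uvB m n : nrm (v m - v n) = nrm (u m - u n).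
  exact: (nrmB_ip (esym (uvip m m)) (esym (uvip n n)) (esym (uvip m n))).
have [X hX] : exists X, nconv H v X.
  apply: ncauchy_conv => e e0; have [N hN] := small (e / 2) (divr_gt0 e0 (ltr0n R 2)).
  exists N => m n Nm Nn; rewrite uvB.
  apply: le_lt_trans (ler_nrmB_add H _ x _) _.
  rewrite (nrmB _ (u m)).
  have := hN m Nm.
  have := hN n Nn.
  move: (nrm _) (nrm _) => p q; lra.
exists X; split.
  split; first exact: L2P.
  move=> e e0; have [N1 h1] := small e e0; have [N2 h2] := hX e e0.
  pose n := maxn N1 N2; exists (u n); have [iu fu] := fourier1_comb (s n).1 (s n).2.
  rewrite -/(u n) -/(v n) in iu fu; split.
  - exact/in_Lp1P.
  - exact: L2P.
  - by rewrite fu; exact: L2P.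
  - rewrite -[(_ \- _)%R]/(L2val (x - u n)) norm2_nrm lte_fin; apply: h1; exact: leq_maxl.
  - by rewrite fu -[(_ \- _)%R]/(L2val (X - v n)) norm2_nrm lte_fin nrmB; apply: h2; exact: leq_maxr.
have hu : nconv H u x.
  by move=> e /small[N hN]; exists N => n /hN; rewrite nrmB.
by apply/eqP; rewrite eq_le (nrm_nconv_le hX hu)// (nrm_nconv_le hu hX).
Qed.

(** This identity passes to the limit in the definition of is_fourier, and it
determines X up to null sets. *)
Lemma fourier_pairing x X i : is_fourier x X -> '[X, etailv i] = '[x, etail_hatcv i].
Proof.
move=> [_ xX]; apply/eqP; rewrite -subr_eq0; apply/eqP/ComplexField.Normc.eq0_normc.
apply/eqP; rewrite eq_le normc_ge0 andbT; apply/ler_addgt0Pr => e e0; rewrite add0r.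
pose K := nrm (etailv i) + nrm (etail_hatcv i) + 1.
have K0 : 0 < K by rewrite ltr_wpDl// addr_ge0// nrm_ge0.
have [g [/in_Lp1P g1 g2 g3 xg Xg]] := xX (e / K) (divr_gt0 e0 K0).
pose g' := mkL2 g2; pose G := mkL2 g3.
have {}xg : nrm (x - g') < e / K by move: xg; rewrite -[(_ \- _)%R]/(L2val (x - g')) norm2_nrm lte_fin.
have {}Xg : nrm (X - G) < e / K by move: Xg; rewrite -[(_ \- _)%R]/(L2val (X - G)) norm2_nrm lte_fin.
have gG : '[G, etailv i] = '[g', etail_hatcv i].
  have [iex _] := integral_etail (@rate_neq0 R i).
  rewrite -[LHS]/(cintegral (fun w => fourier1 g w * (cetail (rate i) w)^*)).
  rewrite -[RHS]/(cintegral (fun w => g w * ((etail_hat (rate i) w)^*)^*)).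
  have := multiplication_formula g1 iex => h.
  transitivity (cintegral (fun w => fourier1 g w * (etail (rate i) w)%:C)).
    by congr cintegral; apply/funext => w; rewrite /cetail conjcC.
  rewrite h; congr cintegral; apply/funext => w; congr (_ * _).
  rewrite -[LHS]/(fourier1 (cetail (rate i)) w) fourier1_cetail ?rate_neq0//.
  by apply: complex_ext; rewrite !reimE ?opprK.
have -> : '[X, etailv i] - '[x, etail_hatcv i] = '[X - G, etailv i] - '[x - g', etail_hatcv i].
  by rewrite !ipBl gG; ring.
apply: (le_trans (ler_normcD _ _)); rewrite normcNE.
have c1 := cauchy_schwarz H (X - G) (etailv i); have c2 := cauchy_schwarz H (x - g') (etail_hatcv i).
have e1 : nrm (X - G) * nrm (etailv i) <= e / K * nrm (etailv i) by rewrite ler_wpM2r ?nrm_ge0// ltW.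
have e2 : nrm (x - g') * nrm (etail_hatcv i) <= e / K * nrm (etail_hatcv i) by rewrite ler_wpM2r ?nrm_ge0// ltW.
have eK : e / K * nrm (etailv i) + e / K * nrm (etail_hatcv i) + e / K = e.
  rewrite -[X in _ + X]mulr1 -!mulrDr -/K; field; exact: lt0r_neq0.
have : 0 < e / K by rewrite divr_gt0.
move=> p; rewrite -[leRHS]eK; apply: ler_wpDr; first exact: ltW.
by apply: lerD; [exact: le_trans c1 e1|exact: le_trans c2 e2].
Qed.

Lemma fourier_unique x X Y : is_fourier x X -> is_fourier x Y -> {ae mu, forall t, X t = Y t}.
Proof.
move=> hX hY; have : {ae mu, forall t, (X - Y : L2 R) t = 0}.
  apply: cetail_total => i; rewrite -[LHS]/('[X - Y, etailv i]) ipBl.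
  by rewrite (fourier_pairing i hX) (fourier_pairing i hY) subrr.
by apply: ae_mono => t /eqP; rewrite L2addE L2oppE subr_eq0 => /eqP.
Qed.

Lemma fourierP x : is_fourier x (fourier x).
Proof.
have [X [hX _]] := fourier_exists x.
by rewrite /fourier; case: xgetP => [F -> //|/(_ (X : R -> R[i]))] /(_ hX).
Qed.

Definition hat x : L2 R := mkL2 (fourierP x).1.

Lemma hatE x : hat x = fourier x :> (R -> R[i]). Proof. by []. Qed.

Lemma hat_pairing x i : '[hat x, etailv i] = '[x, etail_hatcv i].
Proof. by apply: fourier_pairing; exact: fourierP. Qed.

Lemma hat_unique x X : (forall i, '[X, etailv i] = '[x, etail_hatcv i]) -> {ae mu, forall t, hat x t = X t}.
Proof.
move=> h; have : {ae mu, forall t, (hat x - X : L2 R) t = 0}.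
  apply: cetail_total => i; rewrite -[LHS]/('[hat x - X, etailv i]) ipBl.
  by rewrite hat_pairing h subrr.
by apply: ae_mono => t /eqP; rewrite L2addE L2oppE subr_eq0 => /eqP.
Qed.

(** Only almost everywhere: the representatives of the three transforms are chosen
independently. *)
Lemma hatDZ a x y : {ae mu, forall t, hat (a *: x + y) t = a * hat x t + hat y t}.
Proof.
apply: (@hat_unique _ (a *: hat x + hat y)) => i.
by rewrite ipDZl !hat_pairing -ipDZl.
Qed.

Lemma hat_nrm x : nrm (hat x) = nrm x.
Proof.
have [X [hX <-]] := fourier_exists x.
have /nrm_ae h := @fourier_unique x (hat x) X (fourierP x) hX.
apply/eqP; rewrite eq_le; apply/andP; split.
  by have := ler_nrmD H (hat x - X) X; rewrite subrK h add0r.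
by have := ler_nrmD H (X - hat x) (hat x); rewrite subrK nrmB h add0r.
Qed.

Lemma nrm_aeE X Y : {ae mu, forall t, X t = Y t} -> nrm X = nrm Y.
Proof.
move=> /nrm_ae h; apply/eqP; rewrite eq_le; apply/andP; split.
  by have := ler_nrmD H (X - Y) Y; rewrite subrK h add0r.
by have := ler_nrmD H (Y - X) X; rewrite subrK nrmB h add0r.
Qed.

Lemma ip_hat x y : '[hat x, hat y] = '[x, y].
Proof.
apply: polarization => [a|]; last exact: hat_nrm.
rewrite -[in RHS]hat_nrm; apply: nrm_aeE.
apply: ae_mono (hatDZ a y x) => t; rewrite [x + _]addrC => ->.
by rewrite addrC.
Qed.

(** The function e^(-2 pi i k w). *)
Definition wave (k : int) (w : R) : R[i] := cos (2 * pi * k%:~R * w) -i* sin (2 * pi * k%:~R * w).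

Lemma L2_wave k (f : R -> R[i]) : in_Lp 2%:E f -> in_Lp 2%:E (fun w => wave k w * f w).
Proof.
move=> /in_Lp2P[mf h]; apply/in_Lp2P; split.
  exact: (cmeasM (cmeas_trig (2 * pi * k%:~R)) mf).
by rewrite /sqint; under eq_integral do rewrite normcMl normc_trig mul1r.
Qed.

Definition modulate k X : L2 R := mkL2 (L2_wave k (L2P X)).

Lemma nrm_modulate k X : nrm (modulate k X) = nrm X.
Proof.
apply/eqP; rewrite -(@eqrXn2 _ 2) ?nrm_ge0//; apply/eqP/EFin_inj.
by rewrite -!sqint_nrm /sqint; apply: eq_integral => t _; rewrite /= normcMl normc_trig mul1r.
Qed.

Lemma modulateB k X Y : modulate k (X - Y) = modulate k X - modulate k Y.
Proof. by apply: L2_ext; apply/funext => t; exact: mulrBr. Qed.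

Lemma fourier1_translate k (g : R -> R[i]) w : cintegrable g ->
  fourier1 (translates g k) w = wave k w * fourier1 g w.
Proof.
move=> ig; have kg := fourier1_kernel_integrable w ig.
rewrite /fourier1 -(cintegralZ (wave k w) kg) -[RHS](cintegral_shift (- k%:~R) (cintegrableZ (wave k w) kg)).
congr cintegral; apply/funext => t; rewrite /translates mulrCA; congr (_ * _).
have -> : 2 * pi * t * w = 2 * pi * k%:~R * w + 2 * pi * (t - k%:~R) * w by ring.
rewrite cosD sinD /wave; move: (cos _) (sin _) (cos _) (sin _) => p q p' q'.
apply: complex_ext; rewrite ?Re_mul ?Im_mul /=; ring.
Qed.

(** A translate of g is integrable and has transform wave k times that of g; the
approximations in is_fourier are translated accordingly. *)
Lemma hat_transl x k : {ae mu, forall t, hat (transl x k) t = wave k t * hat x t}.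
Proof.
apply: (@fourier_unique (transl x k) (hat (transl x k)) (modulate k (hat x)) (fourierP _)).
split; first exact: L2P.
move=> e e0; have [_ /(_ e e0)[g [/in_Lp1P g1 g2 g3 xg Xg]]] := fourierP x.
have eF : fourier1 (translates g k) = modulate k (mkL2 g3).
  by apply/funext => w; exact: fourier1_translate.
exists (translates g k); split.
- by apply/in_Lp1P; exact: cintegrable_shift.
- exact: in_Lp2_translates.
- by rewrite eF; exact: L2P.
- rewrite -[(_ \- _)%R]/(L2val (transl (x - mkL2 g2) k)) norm2_nrm nrm_transl -norm2_nrm.
  exact: xg.
- rewrite eF -[(_ \- _)%R]/(L2val (modulate k (hat x) - modulate k (mkL2 g3))) norm2_nrm -modulateB nrm_modulate -norm2_nrm.
  exact: Xg.
Qed.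

End FourierL2.

(** * Fourier coefficients and periodic sets *)

Section Periodic.
Context {R : realType}.
Local Notation mu := (@lebesgue_measure R).
Local Notation mR := (measurableTypeR R).
Implicit Types (u : R -> R[i]).

Definition tcos (w : R) : R := cos (2 * pi * w).
Definition tsin (w : R) : R := sin (2 * pi * w).
Local Notation c := tcos.
Local Notation s := tsin.

(** All Fourier coefficients of the 1-periodization of u vanish. *)
Definition nofreq u := cintegrable u /\ forall k, cintegral (fun w => u w * (wave k w)^*) = 0.

Lemma cintegrable_wave u k : cintegrable u -> cintegrable (fun w => u w * (wave k w)^*).
Proof.
move=> iu; apply: cintegrable_unit => //; last by move=> t; rewrite normcJE normc_trig.
by apply: cmeasJ; exact: cmeas_trig.
Qed.

(** A trigonometric monomial p of degree 1 shifts the frequencies by 1 and -1, so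
multiplication by p preserves the property. *)
Lemma nofreq_step u (p : R -> R) (a b : R[i]) : nofreq u ->
  measurable_fun [set: mR] (p : mR -> R) -> (forall w, `|p w| <= 1) ->
  (forall k w, (p w)%:C * (wave k w)^* = a * (wave (k + 1) w)^* + b * (wave (k - 1) w)^*) ->
  nofreq (fun w => u w * (p w)%:C).
Proof.
move=> [iu u0] mp p1 e; split.
  apply: (cintegrable_le _ iu) => [|w].
    apply: cmeasM; first exact: cintegrable_meas.
    by split => //; exact: measurable_cst.
  by rewrite normcMl normc_real -[leRHS]mulr1 ler_wpM2l ?normc_ge0.
move=> k; transitivity (a * cintegral (fun w => u w * (wave (k + 1) w)^*) +
    b * cintegral (fun w => u w * (wave (k - 1) w)^*)); last by rewrite !u0 !mulr0 addr0.
have i1 := cintegrable_wave (k + 1) iu; have i2 := cintegrable_wave (k - 1) iu.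
rewrite -(cintegralZ a i1) -(cintegralZ b i2) -(cintegralD (cintegrableZ a i1) (cintegrableZ b i2)).
by congr cintegral; apply/funext => w; rewrite /= -mulrA e; ring.
Qed.

Lemma measurable_tcos : measurable_fun [set: mR] (c : mR -> R).
Proof. by case: (cmeas_trig (2 * pi : R)). Qed.

Lemma measurable_tsin : measurable_fun [set: mR] (s : mR -> R).
Proof. have [_ /measurable_funN] := cmeas_trig (2 * pi : R).
by congr (measurable_fun _ _); apply/funext => w; rewrite /= opprK. Qed.

Lemma waveD1 k w : wave (k + 1) w = (wave k w) * (c w -i* s w) /\ wave (k - 1) w = (wave k w) * (c w +i* s w).
Proof.
rewrite /wave /tcos /tsin intrB intrD.
rewrite (_ : 2 * pi * (k%:~R + 1%:~R) * w = 2 * pi * k%:~R * w + 2 * pi * w); last by ring.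
rewrite (_ : 2 * pi * (k%:~R - 1%:~R) * w = 2 * pi * k%:~R * w - 2 * pi * w); last by ring.
rewrite cosD sinD cosB sinB; move: (cos _) (sin _) (cos _) (sin _) => p q p' q'.
by split; apply: complex_ext; rewrite ?Re_mul ?Im_mul /=; ring.
Qed.

Lemma nofreq_tcos u : nofreq u -> nofreq (fun w => u w * (c w)%:C).
Proof.
move=> h; apply: (@nofreq_step _ c (2^-1)%:C (2^-1)%:C) => //.
- exact: measurable_tcos.
- by move=> w; exact: cos_norm1.
- move=> k w; have [-> ->] := waveD1 k w; move: (wave k w) (c w) (s w) => [a b] p q.
  by apply: complex_ext; rewrite !reimE /=; field.
Qed.

Lemma nofreq_tsin u : nofreq u -> nofreq (fun w => u w * (s w)%:C).
Proof.
move=> h; apply: (@nofreq_step _ s (0 -i* 2^-1) (0 +i* 2^-1)) => //.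
- exact: measurable_tsin.
- by move=> w; exact: sin_norm1.
- move=> k w; have [-> ->] := waveD1 k w; move: (wave k w) (c w) (s w) => [a b] p q.
  by apply: complex_ext; rewrite !reimE /= !mul0r; field.
Qed.

Lemma nofreq_pow u n m : nofreq u -> nofreq (fun w => u w * (s w ^+ m * c w ^+ n)%:C).
Proof.
move=> h; elim: n => [|n IH].
  elim: m => [|m IH].
    rewrite (_ : (fun w => _) = u)//; apply/funext => w.
    by rewrite !expr0 mulr1 mulr1.
  have := nofreq_tsin IH; congr nofreq; apply/funext => w; rewrite !expr0 !mulr1 exprSr.
  by case: (u w) => a b; apply: complex_ext; rewrite !reimE /=; ring.
have := nofreq_tcos IH; congr nofreq; apply/funext => w; rewrite [c w ^+ n.+1]exprSr.
by case: (u w) => a b; apply: complex_ext; rewrite !reimE /=; ring.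
Qed.

Lemma nofreq_moments u n m : nofreq u ->
  \int[mu]_w (Re (u w) * s w ^+ m * c w ^+ n) = 0 /\
  \int[mu]_w (Im (u w) * s w ^+ m * c w ^+ n) = 0.
Proof.
move=> /(nofreq_pow n m)[_ /(_ 0)].
have m0 w : (wave 0 w : R[i])^* = 1.
  by rewrite /wave mulr0 mul0r cos0 sin0; apply: complex_ext; rewrite !reimE /= ?oppr0.
under eq_fun do rewrite m0 mulr1.
move=> h; split.
  have := congr1 (@Re R) h; rewrite /= => <-; apply: eq_Rintegral => w _.
  by rewrite Re_mul ReC ImC mulr0 subr0 mulrA.
have := congr1 (@Im R) h; rewrite /= => <-; apply: eq_Rintegral => w _.
by rewrite Im_mul ReC ImC /=; ring.
Qed.

(** The moment problem solved in one variable after the other. *)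
Lemma moment_zero_sc (r : mR -> R) (B1 B2 : set mR) : mu.-integrable [set: mR] (EFin \o r) ->
  (forall n m, \int[mu]_w (r w * s w ^+ m * c w ^+ n) = 0) -> measurable B1 -> measurable B2 ->
  \int[mu]_w (r w * (\1_B1 (c w) * \1_B2 (s w))) = 0.
Proof.
move=> ir r0 mB1 mB2.
have b1 (A : set mR) x : `|\1_A x : R| <= 1.
  by rewrite indicE; case: (_ \in _); rewrite ?normr0 ?normr1.
have mI (A : set mR) (v : mR -> R) : measurable_fun [set: mR] v -> measurable A ->
    measurable_fun [set: mR] (fun x => \1_A (v x) : R).
  move=> mv mA; rewrite (_ : (fun x => _) = (\1_A : mR -> R) \o (v : mR -> mR))//.
  by apply: measurableT_comp => //; exact: measurable_indic.
have ms := measurable_tsin; have mc := measurable_tcos.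
have ir1 m : mu.-integrable [set: mR] (EFin \o (fun w => r w * s w ^+ m)).
  apply: (integrable_bounded (K := 1) ir); first exact: measurable_funX.
  by move=> w; rewrite normrX exprn_ile1// sin_norm1.
under eq_Rintegral do rewrite mulrA.
apply: (@moment_zero R (fun w => r w * \1_B1 (c w)) s 1 B2) => //.
- by apply: (integrable_bounded (K := 1) ir); [exact: mI|move=> w; exact: b1].
- by move=> w; exact: sin_norm1.
- move=> m; under eq_Rintegral do rewrite mulrAC.
  by apply: (@moment_zero R (fun w => r w * s w ^+ m) c 1 B1) => // w; exact: cos_norm1.
Qed.

(** acos is continuous on the open interval, and the two end points are measurable
by themselves. *)
Lemma measurable_acos_preimage (Q : set mR) : measurable Q ->
  measurable ([set x | -1 <= x <= 1 /\ Q (acos x)] : set mR).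
Proof.
move=> mQ.
have ma : measurable_fun (`]-1, 1[%classic : set mR) (acos : mR -> mR).
  apply: open_continuous_measurable_fun; first exact: interval_open.
  by move=> x; rewrite inE /= in_itv /= => h; exact: continuous_acos.
have mP (x : R) (A : Prop) : measurable ([set y | y = x /\ A] : set mR).
  have [a|na] := pselect A.
    rewrite (_ : [set y | _] = [set x])//.
    by apply/seteqP; split => y /= => [[]|->].
  rewrite (_ : [set y | _] = set0)//.
  by apply/seteqP; split => y /= => [[]|].
rewrite (_ : [set x | _] = ((`]-1, 1[%classic : set mR) `&` acos @^-1` Q) `|`
  ([set y | y = 1 /\ Q (acos 1)] `|` [set y | y = -1 /\ Q (acos (-1))])).
  apply: measurableU; last exact: measurableU.
  exact: ma.
apply/seteqP; split => x /=; rewrite ?in_itv /=.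
  move=> [/andP[]]; rewrite le_eqVlt => /orP[/eqP <- _|x1]; first by right; right.
  by rewrite le_eqVlt => /orP[/eqP ->|x2 q]; [right; left|left; rewrite x1 x2].
move=> [[/andP[/ltW -> /ltW ->]]//|[[-> q]|[-> q]]]; split => //; rewrite ?lexx ?andbT ?lerN10//; lra.
Qed.

Lemma periodic_int (P : set R) : (forall w, P (w + 1) <-> P w) -> forall (k : int) w, P (w + k%:~R) <-> P w.
Proof.
move=> per; have nat1 n w : P (w + n%:R) <-> P w.
  elim: n w => [|n IH] w; first by rewrite addr0.
  by rewrite -natr1 addrA per IH.
case=> n w; first exact: nat1.
by rewrite NegzE mulrNz -(nat1 n.+1 (w - _)) subrK.
Qed.

Lemma trig_int (n : int) w : c (w + n%:~R) = c w /\ s (w + n%:~R) = s w.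
Proof.
have nat1 (n' : nat) y : c (y + n'%:R) = c y /\ s (y + n'%:R) = s y.
  rewrite /tcos /tsin (_ : 2 * pi * (y + n'%:R) = 2 * pi * y + (pi *+ 2) *+ n'); last first.
    by rewrite -mulr_natr -[pi *+ 2]mulr_natr; ring.
  by rewrite (periodicn (@cosD2pi R)) (periodicn (@sinD2pi R)).
case: n => n; first exact: nat1.
by have := nat1 n.+1 (w + (Negz n)%:~R); rewrite NegzE mulrNz subrK => -[-> ->].
Qed.

Lemma period_cancel (p w : R) : 0 < p -> 2 * p * w / (2 * p) = w.
Proof. by move=> p0; field; rewrite gt_eqF. Qed.

(** The circle is the union of the arcs sin >= 0 and sin < 0, and on each of them
the cosine is a coordinate. *)
Lemma periodic_split (P : set R) w : (forall w, P (w + 1) <-> P w) ->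
  P w <-> (0 <= s w /\ P (acos (c w) / (2 * pi))) \/ (s w < 0 /\ P (- acos (c w) / (2 * pi))).
Proof.
move=> per; have pint := periodic_int per.
have p0 : 0 < pi :> R by exact: pi_gt0.
wlog : w / - 2^-1 <= w < 2^-1.
  pose k := Num.floor (w + 2^-1) => h.
  have /andP[k1 k2] := floor_itv (w + 2^-1); rewrite -/k intrD in k1 k2.
  have hk : - 2^-1 <= w + (- k)%:~R < 2^-1.
    by rewrite mulrNz; apply/andP; split; move: k1 k2; move: (k%:~R : R) => q; lra.
  by have := h _ hk; rewrite pint !(trig_int _ _).1 !(trig_int _ _).2.
move=> /andP[w1 w2]; have [w0|w0] := leP 0 w.
  have t0 : 0 <= 2 * pi * w <= pi by apply/andP; split; [rewrite !mulr_ge0// ltW|nra].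
  have ec : acos (c w) = 2 * pi * w by rewrite /tcos cosK// in_itv.
  have es : 0 <= s w by exact: sin_ge0_pi.
  rewrite ec (period_cancel w p0).
  rewrite ltNge es /=; split; [by left|by case=> -[]].
have t0 : - pi <= 2 * pi * w <= 0 by apply/andP; split; nra.
have ec : acos (c w) = - (2 * pi * w) by rewrite /tcos cosKN.
rewrite ec opprK (period_cancel w p0).
have [s0|s0] := leP 0 (s w); last first.
  by split; [right|case=> -[]].
have w2' : w = - 2^-1.
  apply/eqP; move: w1; rewrite eq_le => ->; rewrite andbT leNgt; apply/negP => w3.
  have : 0 < sin (- (2 * pi * w)) by apply: sin_gt0_pi; apply/andP; split; nra.
  by rewrite sinN oppr_gt0 ltNge s0.
have -> : - (2 * pi * w) / (2 * pi) = w + 1.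
  by rewrite mulNr (period_cancel w p0) w2'; lra.
by rewrite per; split; [left|case=> -[]].
Qed.

(** By periodic_split, membership in P is a Borel condition on the pair
(cos 2 pi w, sin 2 pi w). *)
Lemma moment_zero_periodic (r : mR -> R) (P : set mR) : mu.-integrable [set: mR] (EFin \o r) ->
  (forall n m, \int[mu]_w (r w * s w ^+ m * c w ^+ n) = 0) ->
  measurable P -> (forall w, P (w + 1) <-> P w) ->
  \int[mu]_w (r w * \1_P w) = 0.
Proof.
move=> ir r0 mP per.
pose Q1 : set mR := (fun x : mR => x / (2 * pi)) @^-1` P.
pose Q2 : set mR := (fun x : mR => - x / (2 * pi)) @^-1` P.
have mQ1 : measurable Q1.
  rewrite -[X in measurable X]setTI.
  have m : measurable_fun [set: mR] (fun x : mR => x / (2 * pi) : mR).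
    by apply: measurable_funM; [exact: measurable_id|exact: measurable_cst].
  exact: m.
have mQ2 : measurable Q2.
  rewrite -[X in measurable X]setTI.
  have m : measurable_fun [set: mR] (fun x : mR => - x / (2 * pi) : mR).
    apply: measurable_funM; last exact: measurable_cst.
    by apply: measurable_funN; exact: measurable_id.
  exact: m.
have mB1 := measurable_acos_preimage mQ1; have mB2 := measurable_acos_preimage mQ2.
have c1 w : -1 <= c w <= 1 by rewrite cos_geN1 cos_le1.
have h1 := moment_zero_sc ir r0 mB1 (measurable_itv `[0, +oo[).
have h2 := moment_zero_sc ir r0 mB2 (measurable_itv `]-oo, 0[).
have e w : r w * \1_P w =
    r w * (\1_[set x | -1 <= x <= 1 /\ Q1 (acos x)] (c w) * \1_`[0, +oo[ (s w)) +
    r w * (\1_[set x | -1 <= x <= 1 /\ Q2 (acos x)] (c w) * \1_`]-oo, 0[ (s w)).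
  rewrite -mulrDr; congr (_ * _); rewrite !indicE !mem_setE !in_itv /= andbT.
  have pw := @periodic_split P w per.
  have [hs|hs] := leP 0 (s w).
    rewrite mulr1 mulr0 addr0; congr (nat_of_bool _)%:R; apply/idP/idP; rewrite !inE.
      by move=> /pw [[_ q]|[]]; [split|rewrite ltNge hs].
    by move=> [_ q]; apply/pw; left.
  rewrite mulr1 mulr0 add0r; congr (nat_of_bool _)%:R; apply/idP/idP; rewrite !inE.
    by move=> /pw [[+ _]|[_ q]]; [rewrite leNgt hs|split].
  by move=> [_ q]; apply/pw; right.
have b1 (A B : set mR) (x y : R) : `|\1_A x * \1_B y : R| <= 1.
  by rewrite !indicE; case: (_ \in _); case: (_ \in _); rewrite ?mulr0 ?mul0r ?mulr1 ?normr0 ?normr1.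
have mI (A B : set mR) : measurable A -> measurable B ->
    measurable_fun [set: mR] (fun w : mR => \1_A (c w) * \1_B (s w) : R).
  move=> mA mB; apply: measurable_funM.
    rewrite (_ : (fun x => _) = (\1_A : mR -> R) \o (c : mR -> mR))//.
    by apply: measurableT_comp; [exact: measurable_indic|exact: measurable_tcos].
  rewrite (_ : (fun x => _) = (\1_B : mR -> R) \o (s : mR -> mR))//.
  by apply: measurableT_comp; [exact: measurable_indic|exact: measurable_tsin].
under eq_Rintegral do rewrite e.
rewrite RintegralD//.
- by rewrite h1 h2 addr0.
- apply: (integrable_bounded (K := 1) ir) => [|w]; last exact: b1.
  by apply: mI => //; exact: measurable_itv.
- apply: (integrable_bounded (K := 1) ir) => [|w]; last exact: b1.
  by apply: mI => //; exact: measurable_itv.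
Qed.

End Periodic.

(** * Fibres of the Fourier transform *)

Section Fiber.
Context {R : realType}.
Local Notation mu := (@lebesgue_measure R).
Local Notation mR := (measurableTypeR R).
Local Notation H := (@L2H R).
Local Notation nrm := (nrm H).
Local Notation "''[' x , y ]" := (ip H x y).
Implicit Types (d f s x y X Y Z phi : L2 R) (k : int) (t : R).

Lemma L2_abs X : in_Lp 2%:E (fun t => (normc (X t))%:C).
Proof.
have /in_Lp2P[mX fX] := L2P X; apply/in_Lp2P; split.
  by split; [exact: measurable_normc|exact: measurable_cst].
by rewrite /sqint; under eq_integral do rewrite normc_real ger0_norm ?normc_ge0//.
Qed.

(** Cauchy-Schwarz applied to the absolute values. *)
Lemma L1_mul_le X Y :
  mu.-integrable [set: mR] (fun t : mR => (normc (X t * Y t))%:E) /\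
  (\int[mu]_t (normc (X t * Y t))%:E <= (nrm X * nrm Y)%:E)%E.
Proof.
pose aX := mkL2 (L2_abs X); pose aY := mkL2 (L2_abs Y).
have nX Z : nrm (mkL2 (L2_abs Z)) = nrm Z.
  apply/eqP; rewrite -(@eqrXn2 _ 2) ?nrm_ge0//; apply/eqP/EFin_inj.
  rewrite -!sqint_nrm /sqint; apply: eq_integral => t _.
  by rewrite /= -[Num.sqrt _]/(normc ((normc (Z t))%:C)) normc_real ger0_norm ?normc_ge0.
have e t : Re (aX t * (aY t)^*) = normc (X t * Y t).
  by rewrite normcMl Re_mul ReJ ImJ /=; ring.
have [i1 _] := L2_inner (L2P aX) (L2P aY).
have i2 : mu.-integrable [set: mR] (fun t : mR => (normc (X t * Y t))%:E).
  by apply: eq_integrable i1 => // t _; rewrite e.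
split => //; rewrite -(nX X) -(nX Y).
rewrite (_ : (\int[mu]_t _)%E = (Re '[aX, aY])%:E).
  rewrite lee_fin (le_trans (ler_norm _))// (le_trans (normc_le_Re _))//.
  exact: cauchy_schwarz.
rewrite -[Re _]/(\int[mu]_t Re (aX t * (aY t)^*)) /Rintegral fineK; last exact: integrable_fin_num.
by apply: eq_integral => t _; rewrite e.
Qed.

(** A 2 x 2 minor of the fibres of x and y over t: when it vanishes for all k and
almost all t, almost all pairs of fibres are proportional. *)
Definition cross k x y t := hat x (t - k%:~R) * hat y t - hat x t * hat y (t - k%:~R).

Lemma crossDZ k a x z y :
  {ae mu, forall t, cross k (a *: x + z) y t = a * cross k x y t + cross k z y t}.
Proof.
have h := hatDZ a x z; have h' := ae_shift (- k%:~R) h.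
by apply: ae_mono (ae_and h h') => t [e1 e2]; rewrite /cross e1 e2; ring.
Qed.

Lemma cmeas_cross k x y : cmeas (cross k x y).
Proof.
have m z : cmeas (hat z) by case/in_Lp2P: (L2P (hat z)).
by apply: cmeasB; apply: cmeasM => //; apply: cmeas_shift.
Qed.

Lemma measurable_cross k x y :
  measurable_fun [set: mR] (fun t : mR => (normc (cross k x y t))%:E).
Proof. by apply/measurable_EFinP; apply: measurable_normc; exact: cmeas_cross. Qed.

Lemma cross_le k x y :
  (\int[mu]_t (normc (cross k x y t))%:E <= (2 * (nrm x * nrm y))%:E)%E.
Proof.
have [i1 h1] := L1_mul_le (transl (hat x) k) (hat y).
have [i2 h2] := L1_mul_le (hat x) (transl (hat y) k).
rewrite !nrm_transl !hat_nrm in h1 h2.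
apply: (@le_trans _ _ (\int[mu]_t ((normc (transl (hat x) k t * hat y t))%:E +
   (normc (hat x t * transl (hat y) k t))%:E))%E).
  apply: ge0_le_integral => //.
  - by move=> t _; rewrite lee_fin normc_ge0.
  - exact: measurable_cross.
  - by apply: emeasurable_funD; [case/integrableP: i1|case/integrableP: i2].
  - by move=> t _; rewrite -EFinD lee_fin (le_trans (ler_normcD _ _))// normcNE.
rewrite integralD//.
rewrite (_ : 2 * _ = nrm x * nrm y + nrm x * nrm y); last by ring.
by rewrite EFinD; exact: leeD.
Qed.

(** By cross_le the minor is continuous in x, as a map from L^2 to L^1. *)
Lemma cross_closed k y : closed_subspace H [set x | {ae mu, forall t, cross k x y t = 0}].
Proof.
have DZ a x z : {ae mu, forall t, cross k x y t = 0} -> {ae mu, forall t, cross k z y t = 0} ->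
    {ae mu, forall t, cross k (a *: x + z) y t = 0}.
  move=> hx hz; apply: ae_mono (ae_and (crossDZ k a x z y) (ae_and hx hz)) => t [-> [-> ->]].
  by rewrite mulr0 addr0.
split => //=.
- have : {ae mu, forall t, hat (0 : L2 R) t = 0} by apply: nrm_eq0_ae; rewrite hat_nrm nrm0.
  by move=> h; apply: ae_mono (ae_and h (ae_shift (- k%:~R) h)) => t [e1 e2]; rewrite /cross e1 e2 !mul0r subr0.
- move=> x hx.
  have m : measurable_fun [set: mR] (fun t : mR => (normc (cross k x y t))%:E).
    exact: measurable_cross.
  have : (\int[mu]_t `|(normc (cross k x y t))%:E| = 0)%E.
    rewrite (_ : (\int[mu]_t _)%E = (\int[mu]_t (normc (cross k x y t))%:E)%E); last first.
      by apply: eq_integral => t _; rewrite gee0_abs// lee_fin normc_ge0.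
    apply/eqP; rewrite eq_le integral_ge0 ?andbT; last by move=> t _; rewrite lee_fin normc_ge0.
    apply/lee_addgt0Pr => e e0; rewrite add0e.
    have K0 : 0 < 2 * nrm y + 1 by rewrite ltr_wpDl// mulr_ge0// nrm_ge0.
    have [v hv xv] := hx (e / (2 * nrm y + 1)) (divr_gt0 e0 K0).
    have xe : {ae mu, forall t, cross k x y t = cross k (x - v) y t}.
      have := crossDZ k 1 (x - v) v y; rewrite scale1r subrK => h.
      by apply: ae_mono (ae_and h hv) => t [-> ->]; rewrite mul1r addr0.
    rewrite (_ : (\int[mu]_t _)%E = (\int[mu]_t (normc (cross k (x - v) y t))%:E)%E); last first.
      apply: ae_eq_integral => //.
        exact: measurable_cross.
      by apply: ae_mono xe => t -> _.
    apply: (le_trans (cross_le k (x - v) y)); rewrite lee_fin.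
    have : nrm (x - v) * (2 * nrm y) <= e / (2 * nrm y + 1) * (2 * nrm y).
      by rewrite ler_wpM2r ?mulr_ge0 ?nrm_ge0// ltW.
    have : e / (2 * nrm y + 1) * (2 * nrm y) <= e.
      rewrite mulrAC ler_pdivrMr// ler_pM2l//; lra.
    move=> h1 h2; apply: le_trans h1; apply: le_trans h2; rewrite mulrCA; lra.
  move=> /(ae_eq_integral_abs mu measurableT m).1; apply: ae_mono => t /(_ I) [].
  exact: ComplexField.Normc.eq0_normc.
Qed.

Lemma crossC k x y t : cross k y x t = - cross k x y t.
Proof. by rewrite /cross; ring. Qed.

Lemma wave_periodic l k t : wave l (t - k%:~R : R) = wave l t.
Proof.
have [hc hs] := trig_int (- (l * k)) (l%:~R * t).
rewrite /wave (_ : 2 * pi * l%:~R * (t - k%:~R) = 2 * pi * (l%:~R * t + (- (l * k))%:~R)).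
  by move: hc hs; rewrite /tcos /tsin => -> ->; rewrite mulrA.
by rewrite mulrNz intrM; ring.
Qed.

(** The factor wave l is constant on fibres. *)
Lemma cross_gen k l x y : {ae mu, forall t, cross k x y t = 0} ->
  {ae mu, forall t, cross k (transl x l) y t = 0}.
Proof.
move=> h; have g := hat_transl x l; have g' := ae_shift (- k%:~R) g.
apply: ae_mono (ae_and h (ae_and g g')) => t [e0 [e1 e2]]; rewrite /cross e1 e2 wave_periodic.
by rewrite -!mulrA -mulrBr -/(cross k x y t) e0 mulr0.
Qed.

(** The fibres of the vectors of S(phi) are multiples of the fibre of phi. This
holds for the translates of phi, and cross_closed extends it, first to (y, phi)
and then to (x, y). *)
Lemma rank_one k phi x y : shift_space phi x -> shift_space phi y ->
  {ae mu, forall t, cross k x y t = 0}.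
Proof.
move=> Sx Sy; apply: (shift_space_min (cross_closed k y) _ Sx) => l.
apply: cross_gen; apply: (@ae_mono _ (fun t => cross k y phi t = 0)) => [t e|].
  by rewrite crossC e oppr0.
apply: (shift_space_min (cross_closed k phi) _ Sy) => m.
by apply: cross_gen; apply: aeW => t; rewrite /cross mulrC subrr.
Qed.

(** The union P of the fibres on which r is positive somewhere is periodic, and
r >= 0 almost everywhere on P; since r has integral 0 over P, it vanishes
there. *)
Lemma periodic_nonpos (r : mR -> R) : mu.-integrable [set: mR] (EFin \o r) ->
  (forall n m, \int[mu]_w (r w * tsin w ^+ m * tcos w ^+ n) = 0) ->
  {ae mu, forall t, forall k : int, 0 < r (t - k%:~R) -> 0 <= r t} ->
  {ae mu, forall t, r t <= 0}.
Proof.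
move=> ir r0 pos; pose P : set mR := [set t | exists k : int, 0 < r (t - k%:~R)].
have mr : measurable_fun [set: mR] r by case/integrableP: ir => /measurable_EFinP.
have mP : measurable P.
  pose d n : int := odflt 0 (choice.unpickle n).
  have dK k : d (choice.pickle k) = k by rewrite /d choice.pickleK.
  rewrite (_ : P = \bigcup_n ((fun t : mR => r (t + - (d n)%:~R)) @^-1` `]0, +oo[%classic)).
    apply: bigcupT_measurable => n; rewrite -[X in measurable X]setTI.
    have := measurableT_comp mr (measurable_shift (- (d n)%:~R)); apply => //.
  apply/seteqP; split => t /=.
    by move=> [k hk]; exists (choice.pickle k) => //=; rewrite dK in_itv /= andbT.
  by move=> [n _]; rewrite /= in_itv /= andbT => h; exists (d n).
have per w : P (w + 1) <-> P w.
  rewrite /P /=; split=> -[k hk].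
    by exists (k - 1); rewrite (_ : w - (k - 1)%:~R = w + 1 - k%:~R)// intrB; ring.
  by exists (k + 1); rewrite (_ : w + 1 - (k + 1)%:~R = w - k%:~R)// intrD; ring.
have h0 := moment_zero_periodic ir r0 mP per.
have iP : mu.-integrable [set: mR] (EFin \o (fun t => r t * \1_P t)).
  apply: (integrable_bounded (K := 1) ir) => [|t]; first exact: measurable_indic.
  by rewrite indicE; case: (_ \in _); rewrite ?normr0 ?normr1.
have [mE _] := integrableP _ _ _ iP.
have : (\int[mu]_t `|(EFin \o (fun t => (r t * \1_P t)%R)) t| = 0)%E.
  rewrite (_ : (\int[mu]_t _)%E = (\int[mu]_t (r t * \1_P t)%:E)%E).
    have := integrable_fin_num measurableT iP => /fineK <-.
    by congr EFin; exact: h0.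
  apply: ae_eq_integral => //.
    exact: measurableT_comp.
  apply: ae_mono pos => t ht _ /=; rewrite ger0_norm// indicE.
  case: (boolP (t \in P)) => [|_]; last by rewrite mulr0.
  by rewrite inE mulr1 => -[k hk]; exact: ht hk.
move=> /(ae_eq_integral_abs mu measurableT mE).1; apply: ae_mono => t /(_ I) [] h.
rewrite leNgt; apply/negP => rt; move: h; rewrite indicE mem_set/=; last by exists 0; rewrite subr0.
by rewrite mulr1 => r00; rewrite r00 ltxx in rt.
Qed.

Lemma ip_aer X Y Z : {ae mu, forall t, Y t = Z t} -> '[X, Y] = '[X, Z].
Proof.
move=> /nrm_ae/nrm_eq0_ip h; apply/eqP; rewrite -subr_eq0 -ipBr ipC h.
by apply/eqP; apply: complex_ext; rewrite !reimE ?oppr0.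
Qed.

(** Let u = Fd (Ff)^*. By rank_one, u(t) |Ff(t - k)|^2 = u(t - k) |Ff(t)|^2, so
the values of u along a fibre have the same argument and periodic_nonpos
applies to e u for e = 1, -1, i, -i. Once u = 0, proportionality of the fibres
carries the zero of Fd at a point where Ff is nonzero to the whole fibre. *)
Lemma fiber_vanish phi d f : shift_space phi d -> shift_space phi f ->
  (forall k, '[d, transl f k] = 0) ->
  {ae mu, forall t, (exists k : int, hat f (t - k%:~R) != 0) -> hat d t = 0}.
Proof.
move=> Sd Sf df; pose u t := hat d t * (hat f t)^*.
have u_nofreq : nofreq u.
  split; first exact: L2_inner (L2P _) (L2P _).
  move=> k; rewrite -(df k) -ip_hat (ip_aer _ (Z := modulate k (hat f))); last exact: hat_transl.
  congr cintegral; apply/funext => t; rewrite /u -[modulate k _ t]/(wave k t * hat f t).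
  have -> : ((wave k t * hat f t)^*)%C = (wave k t)^* * (hat f t)^* := conjcM _ _.
  ring.
have hc : {ae mu, forall t, forall k, cross k d f t = 0}.
  by apply: ae_all_int => k; exact: rank_one Sd Sf.
have cE t k : cross k d f t = 0 -> hat d (t - k%:~R) * hat f t = hat d t * hat f (t - k%:~R).
  by move=> /eqP; rewrite subr_eq0 => /eqP.
have nonpos (e : R[i]) : {ae mu, forall t, Re (e * u t) <= 0}.
  have [ieu eu0] : nofreq (fun t => e * u t).
    have [iu u0] := u_nofreq; split; first exact: cintegrableZ.
    move=> k; under eq_fun do rewrite -mulrA.
    by rewrite (cintegralZ e (cintegrable_wave k iu)) u0 mulr0.
  apply: periodic_nonpos; first by case: ieu.
    by move=> n m; exact: (nofreq_moments n m (conj ieu eu0)).1.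
  apply: ae_mono hc => t ht k; have := cE t k (ht k).
  rewrite /u; move: (hat d t) (hat d (t - k%:~R)) (hat f t) (hat f (t - k%:~R)) => d0 dk f0 fk hk pk.
  have fkn : fk != 0.
    apply/eqP => fk0; move: pk; rewrite fk0 (_ : e * _ = 0) ?ltxx//.
    by rewrite (_ : 0^* = 0) ?mulr0//; apply: complex_ext; rewrite !reimE ?oppr0.
  have key : e * (d0 * f0^*) * (normc fk ^+ 2)%:C = e * (dk * fk^*) * (normc f0 ^+ 2)%:C.
    rewrite -!mulcJ; transitivity (e * (d0 * fk) * (f0^* * fk^*)); first by ring.
    by rewrite -hk; ring.
  have ReZr (z : R[i]) (r : R) : Re (z * r%:C) = Re z * r by rewrite Re_mul ReC ImC mulr0 subr0.
  have kr := congr1 (@Re R) key; rewrite !ReZr in kr.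
  have p2 : 0 < normc fk ^+ 2.
    rewrite exprn_even_gt0//=; apply/eqP => /ComplexField.Normc.eq0_normc/eqP.
    by rewrite (negbTE fkn).
  by rewrite -(pmulr_lge0 _ p2) kr; rewrite mulr_ge0 ?sqr_ge0// ltW.
(* the four half-planes intersect in 0 *)
have rot (z : R[i]) : Re (1 * z) <= 0 -> Re (-1 * z) <= 0 ->
    Re ((0 +i* 1) * z) <= 0 -> Re ((0 -i* 1) * z) <= 0 -> z = 0.
  case: z => a b; rewrite mul1r mulN1r ReN !Re_mul /= => h1 h2 h3 h4.
  by apply: complex_ext => /=; lra.
have u0 : {ae mu, forall t, u t = 0}.
  apply: ae_mono (ae_and (ae_and (nonpos 1) (nonpos (-1))) (ae_and (nonpos (0 +i* 1)) (nonpos (0 -i* 1)))).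
  by move=> t [[h1 h2] [h3 h4]]; exact: rot.
have u0' : {ae mu, forall t, forall k, u (t - k%:~R) = 0}.
  by apply: ae_all_int => k; exact: ae_shift u0.
apply: ae_mono (ae_and hc u0') => t [hk hu] [k fk].
have dk : hat d (t - k%:~R) = 0.
  move: (hu k) => /eqP; rewrite /u mulf_eq0 => /orP[/eqP//|/eqP f0].
  move/eqP: fk; case; apply: ComplexField.Normc.eq0_normc; rewrite -normcJE f0.
  by rewrite ComplexField.Normc.normc0.
have := cE t k (hk k); rewrite dk mul0r => /esym/eqP.
by rewrite mulf_eq0 (negbTE fk) orbF => /eqP.
Qed.

Lemma cmeas_res (Z : set mR) X : measurable Z -> cmeas (fun t => X t * (\1_Z t : R)%:C).
Proof.
move=> mZ; apply: cmeasM; first by case/in_Lp2P: (L2P X).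
by split => /=; [exact: measurable_indic|exact: measurable_cst].
Qed.

Lemma sqint_res_le (Z : set mR) X : measurable Z ->
  (sqint (fun t => X t * (\1_Z t : R)%:C)%R <= sqint X)%E.
Proof.
move=> mZ; have /in_Lp2P[mX fX] := L2P X; apply: ge0_le_integral => //.
- by move=> t _; rewrite lee_fin sqr_ge0.
- by apply/measurable_EFinP; apply: measurable_sqr_normc; exact: cmeas_res.
- by apply/measurable_EFinP; exact: measurable_sqr_normc.
move=> t _; rewrite lee_fin normcMl indicE; case: (_ \in _).
  by rewrite normc_real normr1 mulr1.
by rewrite normc_real normr0 mulr0 expr0n sqr_ge0.
Qed.

Lemma L2_res (Z : set mR) X : measurable Z -> in_Lp 2%:E (fun t => X t * (\1_Z t : R)%:C).
Proof.
move=> mZ; have /in_Lp2P[mX fX] := L2P X; apply/in_Lp2P; split; first exact: cmeas_res.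
exact: le_lt_trans (sqint_res_le X mZ) fX.
Qed.

(** Restriction to Z does not increase the norm. *)
Lemma vanish_closed (Z : set mR) : measurable Z ->
  closed_subspace H [set x | {ae mu, forall t, Z t -> hat x t = 0}].
Proof.
move=> mZ; pose rs X := mkL2 (L2_res X mZ).
have rsE x : nrm (rs (hat x)) = 0 <-> {ae mu, forall t, Z t -> hat x t = 0}.
  have e t : rs (hat x) t = hat x t * (\1_Z t : R)%:C by [].
  split=> h.
    by apply: ae_mono (nrm_eq0_ae h) => t + Zt; rewrite e indicE mem_set// mulr1.
  apply: nrm_ae0; apply: ae_mono h => t h; rewrite e indicE.
  by case: (boolP (t \in Z)) => [|_]; [rewrite inE => /h ->; rewrite mul0r|rewrite mulr0].
have rs_le X : nrm (rs X) <= nrm X.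
  by rewrite -(@ler_pXn2r _ 2) ?nnegrE ?nrm_ge0// -lee_fin -!sqint_nrm sqint_res_le.
split.
- have : {ae mu, forall t, hat (0 : L2 R) t = 0} by apply: nrm_eq0_ae; rewrite hat_nrm nrm0.
  by apply: ae_mono => t ->.
- move=> a x y hx hy; apply: ae_mono (ae_and (hatDZ a x y) (ae_and hx hy)) => t [-> [h1 h2]] Zt.
  by rewrite h1// h2// mulr0 addr0.
- move=> x hx; apply/rsE/eqP; rewrite eq_le nrm_ge0 andbT; apply/ler_addgt0Pr => e e0; rewrite add0r.
  have [v hv xv] := hx e e0.
  have := hatDZ 1 (x - v) v; rewrite scale1r subrK => h.
  rewrite (nrm_aeE (Y := rs (hat (x - v)))); last first.
    apply: ae_mono (ae_and h hv) => t [h1 h2].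
    rewrite -[LHS]/(hat x t * (\1_Z t : R)%:C) -[RHS]/(hat (x - v) t * (\1_Z t : R)%:C) h1 mul1r.
    rewrite indicE; case: (boolP (t \in Z)) => [|_]; last by rewrite !mulr0.
    by rewrite inE => /h2 ->; rewrite addr0.
  by rewrite (le_trans (rs_le _))// hat_nrm ltW.
Qed.

(** The transform of a translate of f is Ff times a bounded function. *)
Lemma hat_vanish f y : shift_space f y -> {ae mu, forall t, hat f t = 0 -> hat y t = 0}.
Proof.
move=> Sy; pose Z : set mR := [set t | hat f t = 0].
have mZ : measurable Z.
  have [m1 m2] : cmeas (hat f) by case/in_Lp2P: (L2P (hat f)).
  rewrite (_ : Z = ((fun t : mR => Re (hat f t)) @^-1` [set 0]) `&` ((fun t : mR => Im (hat f t)) @^-1` [set 0])).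
    apply: measurableI; rewrite -[X in measurable X]setTI; [exact: m1|exact: m2].
  apply/seteqP; split => t /=; rewrite /Z /=; first by move=> ->.
  by move=> [e1 e2]; apply: complex_ext.
apply: (shift_space_min (vanish_closed mZ) _ Sy) => k.
by apply: ae_mono (hat_transl f k) => t -> h; rewrite h mulr0.
Qed.

Lemma grammian_supportP f t : grammian_support f t <-> exists k : int, hat f (t - k%:~R) != 0.
Proof.
rewrite /grammian_support /grammian /=; split => [|[k fk]].
  apply: contraPP => /forallNP f0; rewrite esum1 ?ltxx// => k _.
  have /negP := f0 (- k); rewrite negbK mulrNz opprK => /eqP ->.
  by rewrite ComplexField.Normc.normc0 expr0n.
apply: lt_le_trans (esum_ub [fset (- k)]%fset _); last by move=> i; exact: sqr_ge0.
rewrite big_seq_fset1 lte_fin exprn_even_gt0//= mulrNz.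
by apply/eqP => /ComplexField.Normc.eq0_normc/eqP; rewrite -hatE (negbTE fk).
Qed.

(** With d = s - y, split Fs = Fd + Fy: on E_f the first term vanishes by
fiber_vanish, off E_f the second one by hat_vanish. *)
Lemma fourier_projection phi s f y : shift_space phi s -> shift_space phi f ->
  is_orthogonal_projection (shift_space f) s y ->
  fourier y = (fun w => fourier s w * \1_(grammian_support f) w) %[ae mu].
Proof.
move=> Ss Sf [Sy py]; suff : {ae mu, forall w, fourier y w = fourier s w * \1_(grammian_support f) w}.
  by apply: ae_mono => w e _.
have Sphiy := shift_space_sub Sf Sy.
have Sd : shift_space phi (s - y : L2 R) by apply: (csubB (shift_space_closed phi)).
have := fiber_vanish Sd Sf (fun k => py (transl f k) (shift_space_gen f k)) => h1.
have h2 := hat_vanish Sy; have h3 := hatDZ 1 (s - y) y; rewrite scale1r subrK in h3.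
apply: ae_mono (ae_and h1 (ae_and h2 h3)) => t [k1 [k2 k3]].
rewrite -!hatE k3 indicE; case: (boolP (t \in _)) => [|].
  by rewrite inE => /grammian_supportP /k1 ->; rewrite mulr0 add0r mulr1.
rewrite notin_setE => ng; rewrite mulr0; apply: k2; apply: contrapT => /eqP f0.
by apply: ng; apply/grammian_supportP; exists 0; rewrite subr0.
Qed.

End Fiber.

Theorem theorem1 (R : realType) (phi s f : R -> R[i]) :
  is_frame_generator phi ->
  is_sampling_space (shift_space phi) s ->
  in_Lp 2%:E f ->
  shift_space phi f ->
  exists s_f : R -> R[i],
    [/\ is_orthogonal_projection (shift_space f) s s_f,
        is_sampling_space (shift_space f) s_f
      & fourier s_f = (fun w => fourier s w * \1_(grammian_support f) w)
          %[ae @lebesgue_measure R]].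
Proof.
move=> [Lphi _] Sphi Lf Sf; have [_ [Vs _] _ _] := Sphi.
have Ss := Vs 0; rewrite translates0 in Ss.
have [y [py Sy]] := @sampling_subspace R (mkL2 Lphi) (mkL2 Ss.1) (mkL2 Lf) Sphi Sf.
exists y; split => //.
exact: (@fourier_projection R (mkL2 Lphi) (mkL2 Ss.1) (mkL2 Lf) y Ss Sf py).
Qed.
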